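(* Let $h:\mathbb{R}\to\mathbb{R}$ be a twice continuously differentiable function such that, for some integer $k$, $h(t+2\pi)=h(t)+2k\pi$ for all $t\in\mathbb{R}$. Suppose in addition that: (1) $h''$ has no zeros on $(0,\pi)$; (2) $h$ is odd; (3) there exist functions $m_0$ and $m_\pi$, positive and increasing on $(0,4c)$ for some $c>0$, and a constant $C>0$ such that $$\frac{m_0(2t)}{m_0(t)}\le C,\qquad \frac{m_\pi(2t)}{m_\pi(t)}\le C,\qquad 0<t<2c,$$ and $$m_0(t)\le h''(t)\le C\,m_0(t),\qquad m_\pi(t)\le h''(\pi-t)\le C\,m_\pi(t),\qquad 0<t<4c.$$ Then, as $n\to\infty$ through the positive integers, $$\frac{1}{\sqrt n}\left\lVert e^{inh(t)}\right\rVert_A\longrightarrow\left(\frac{2}{\pi}\right)^{3/2}\int_0^\pi\sqrt{h''(t)}\,dt .$$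
   Context: For a $2\pi$-periodic function $f$ with an absolutely convergent Fourier series $f(t)=\sum_{\nu=-\infty}^{\infty}a_\nu e^{i\nu t}$, the norm is $\lVert f\rVert_A=\sum_{\nu=-\infty}^{\infty}|a_\nu|$. *)

(* Defs.v *)
From Stdlib Require Import Reals ZArith.
From Coquelicot Require Import Coquelicot.
Open Scope R_scope.

Definition twice_continuously_differentiable (h : R -> R) : Prop :=
  forall t : R,
    ex_derive h t /\ ex_derive (Derive h) t /\ continuous (Derive_n h 2) t.

(* Both halves (indices 0, 1, 2, ... and -1, -2, -3, ...) have to converge. *)
Definition is_Zseries {V : NormedModule R_AbsRing} (a : Z -> V) (l : V) : Prop :=
  exists l1 l2 : V,
    is_series (fun n : nat => a (Z.of_nat n)) l1 /\
    is_series (fun n : nat => a (- Z.of_nat (S n))%Z) l2 /\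
    l = plus l1 l2.

Definition Zseries (a : Z -> R) : R :=
  Series (fun n : nat => a (Z.of_nat n)) +
  Series (fun n : nat => a (- Z.of_nat (S n))%Z).

Definition expi (t : R) : C := (cos t, sin t).

Definition Fourier_coeff (f : R -> C) (nu : Z) : C :=
  (RtoC (/ (2 * PI)) *
   RInt (V := C_R_CompleteNormedModule)
        (fun t : R => (f t * expi (- (IZR nu * t)))%C) 0 (2 * PI))%C.

(* Pointwise equality with the sum of the series is part of the definition;
   it forces [f] to be continuous and 2 PI-periodic, so that the total integral
   in [Fourier_coeff] is a genuine one. *)
Definition has_abs_conv_Fourier_series (f : R -> C) : Prop :=
  (exists s : R, is_Zseries (fun nu : Z => Cmod (Fourier_coeff f nu)) s) /\
  (forall t : R,
     is_Zseries (V := C_R_NormedModule)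
       (fun nu : Z => (Fourier_coeff f nu * expi (IZR nu * t))%C) (f t)).

(* Meaningful when [has_abs_conv_Fourier_series f]: [Series] is a total
   function with no significance on divergent series. *)
Definition A_norm (f : R -> C) : R :=
  Zseries (fun nu : Z => Cmod (Fourier_coeff f nu)).

(* Non-strict: the weaker hypothesis, so that strictly increasing functions are
   covered too. *)
Definition increasing_on (a b : R) (m : R -> R) : Prop :=
  forall s t : R, a < s -> s <= t -> t < b -> m s <= m t.

(* Main.v *)
Require Import Defs.
From Stdlib Require Import Reals ZArith Lra Lia.
From Coquelicot Require Import Coquelicot.
Open Scope R_scope.

(** Write [E_n = exp(i n h)]. Because [h] is odd, its [nu]-th Fourier
    coefficient is the real number [fc h n nu], the mean over [[0, PI]] of
    [cos (n h(t) - nu t)]. The phase is stationary where [h'(t) = nu / n]; since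
    [h''] is positive on [(0, PI)], this happens at one point [tau] at most.

    Inside, for [nu / n] between [h'(a)] and [h'(b)] with [0 < a < b < PI],
    stationary phase gives uniformly
    [fc h n nu = (1 / PI) sqrt (2 PI / (n h''(tau))) cos (n g(nu / n) + phi0)] up
    to [o(1 / sqrt n)], where [g(y) = h(tau) - y tau] is a Legendre transform
    ([stationary_phase]). The amplitude comes from the Fresnel integrals, of
    which only the modulus is computed ([fresnel_square], [fresnel_limit]): the
    constant [phi0] disappears in the next step.

    That step is equidistribution ([equidistribution_abs_cos]). As
    [g' (h'(t)) = - t], the phase [n g(nu / n)] changes locally by [- tau]
    when [nu] increases by one. For a fixed frequency [2 j], averaging over
    short shifts of [nu] produces geometric sums of ratio [exp(- 2 i j tau)],
    which are small in mean square with respect to [tau]. Trigonometric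
    polynomials approximate the absolute value of [cos] uniformly, so
    that value may be replaced by its mean [2 / PI]. What remains is a Riemann
    sum, and the substitution [y = h'(t)] turns it into the integral of
    [sqrt h''] over [[a, b]] ([fc_interior_limit]).

    Outside, two estimates suffice ([fc_window_bound]). By Bessel's inequality
    [N] consecutive coefficients have absolute values summing to at most
    [sqrt N]; so the frequencies near the two ends of the range of [n h']
    contribute at most [sqrt (n x)], with [x] as small as desired once [a] is
    near [0] and [b] near [PI]. At distance [d] beyond the range, one
    integration by parts bounds the coefficient by a multiple of [n / d^2],
    whose sum over [d >= n e] is, for fixed [e > 0], bounded uniformly in [n].

    The same two estimates show that the coefficients are absolutely summable.
    That the Fourier series converges to [E_n] at every point follows from the
    Dirichlet kernel: dividing the increment of a differentiable function by
    [sin (x / 2)] leaves a continuous function, whose Fourier coefficients tend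
    to zero by Bessel's inequality again ([dirichlet_limit]). *)

(** * Continuity, integrals and finite sums over integers *)

Lemma cont_const (c x : R) : continuous (fun _ : R => c) x.
Proof. apply continuous_const. Qed.

Lemma cont_id (x : R) : continuous (fun y : R => y) x.
Proof. apply continuous_id. Qed.

Lemma cont_plus (f g : R -> R) (x : R) :
  continuous f x -> continuous g x -> continuous (fun y => f y + g y) x.
Proof. intros; now apply (continuous_plus f g). Qed.

Lemma cont_minus (f g : R -> R) (x : R) :
  continuous f x -> continuous g x -> continuous (fun y => f y - g y) x.
Proof. intros; now apply (continuous_minus f g). Qed.

Lemma cont_opp (f : R -> R) (x : R) :
  continuous f x -> continuous (fun y => - f y) x.
Proof. intros; now apply (continuous_opp f). Qed.

Lemma cont_mult (f g : R -> R) (x : R) :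
  continuous f x -> continuous g x -> continuous (fun y => f y * g y) x.
Proof. intros; now apply (continuous_mult f g). Qed.

Lemma cont_inv (f : R -> R) (x : R) :
  continuous f x -> f x <> 0 -> continuous (fun y => / f y) x.
Proof. intros; now apply continuous_Rinv_comp. Qed.

Lemma cont_pow (f : R -> R) (k : nat) (x : R) :
  continuous f x -> continuous (fun y => f y ^ k) x.
Proof.
  intros Hf; induction k as [|k IH]; simpl.
  - apply cont_const.
  - now apply cont_mult.
Qed.

Lemma cont_cos (f : R -> R) (x : R) :
  continuous f x -> continuous (fun y => cos (f y)) x.
Proof. intros; now apply continuous_cos_comp. Qed.

Lemma cont_sin (f : R -> R) (x : R) :
  continuous f x -> continuous (fun y => sin (f y)) x.
Proof. intros; now apply continuous_sin_comp. Qed.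

Lemma cont_abs (f : R -> R) (x : R) :
  continuous f x -> continuous (fun y => Rabs (f y)) x.
Proof. intros; now apply (continuous_comp f Rabs); [|apply continuous_Rabs]. Qed.

Lemma cont_sqrt (f : R -> R) (x : R) :
  continuous f x -> continuous (fun y => sqrt (f y)) x.
Proof. intros; now apply (continuous_comp f sqrt); [|apply continuous_sqrt]. Qed.

Lemma cont_app (f g : R -> R) (x : R) :
  (forall z, continuous g z) -> continuous f x -> continuous (fun y => g (f y)) x.
Proof. intros; now apply (continuous_comp f g). Qed.

Lemma cont_derive (f : R -> R) (x d : R) : is_derive f x d -> continuous f x.
Proof. intros H; apply (ex_derive_continuous f); now exists d. Qed.

Lemma is_derive_val (f : R -> R) (x d d' : R) :
  is_derive f x d -> d = d' -> is_derive f x d'.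
Proof. now intros H <-. Qed.

(** Structural continuity. The heads without an argument are those that
    unification leaves eta-reduced. *)
Ltac cont :=
  repeat first
    [ assumption
    | match goal with
      | |- continuous (Rplus ?c) _ => apply (cont_plus (fun _ => c) (fun y => y))
      | |- continuous (Rminus ?c) _ => apply (cont_minus (fun _ => c) (fun y => y))
      | |- continuous (Rmult ?c) _ => apply (cont_mult (fun _ => c) (fun y => y))
      | |- continuous (Rdiv ?c) _ => apply (cont_mult (fun _ => c) (fun y => / y))
      | |- continuous Ropp _ => apply (cont_opp (fun y => y))
      | |- continuous Rinv _ => apply (cont_inv (fun y => y))
      | |- continuous cos _ => apply (cont_cos (fun y => y))
      | |- continuous sin _ => apply (cont_sin (fun y => y))
      | |- continuous sqrt _ => apply (cont_sqrt (fun y => y))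
      | |- continuous Rabs _ => apply (cont_abs (fun y => y))
      | |- continuous (fun _ => ?c) _ => apply cont_const
      | |- continuous (fun y => y) _ => apply cont_id
      | |- continuous (fun y => _ + _) _ => apply cont_plus
      | |- continuous (fun y => _ - _) _ => apply cont_minus
      | |- continuous (fun y => - _) _ => apply cont_opp
      | |- continuous (fun y => _ * _) _ => apply cont_mult
      | |- continuous (fun y => _ / _) _ => apply cont_mult
      | |- continuous (fun y => / _) _ => apply cont_inv
      | |- continuous (fun y => cos _) _ => apply cont_cos
      | |- continuous (fun y => sin _) _ => apply cont_sin
      | |- continuous (fun y => Rabs _) _ => apply cont_abs
      | |- continuous (fun y => sqrt _) _ => apply cont_sqrt
      | |- continuous (fun y => _ ^ _) _ => apply cont_pow
      | |- continuous (fun y => ?f _) _ =>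
          is_var f; apply (cont_app _ f); [solve [auto] | ]
      | |- continuous ?f _ => is_var f; solve [auto]
      end ].

(** An equation between two integrals is elaborated in the carrier of a
    structure, where [ring] and [lra] do not see real numbers; an integral alone
    on the left-hand side still hides them, hence the difference. *)
Ltac req := match goal with |- ?x = ?y => change (@eq R x y); apply Rminus_diag_uniq end.

Ltac exint := apply @ex_RInt_continuous; intros; cont.

Lemma RInt_add (f g : R -> R) (a b : R) :
  ex_RInt f a b -> ex_RInt g a b ->
  RInt (fun x => f x + g x) a b = RInt f a b + RInt g a b.
Proof. exact (RInt_plus f g a b). Qed.

Lemma RInt_sub (f g : R -> R) (a b : R) :
  ex_RInt f a b -> ex_RInt g a b ->
  RInt (fun x => f x - g x) a b = RInt f a b - RInt g a b.
Proof. exact (RInt_minus f g a b). Qed.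

Lemma RInt_mul (f : R -> R) (a b c : R) :
  ex_RInt f a b -> RInt (fun x => c * f x) a b = c * RInt f a b.
Proof. exact (RInt_scal f a b c). Qed.

Lemma RInt_cst (a b c : R) : RInt (fun _ => c) a b = (b - a) * c.
Proof. exact (RInt_const a b c). Qed.

Lemma RInt_split (f : R -> R) (a b c : R) :
  ex_RInt f a b -> ex_RInt f b c -> RInt f a c = RInt f a b + RInt f b c.
Proof. intros H1 H2; symmetry; exact (RInt_Chasles f a b c H1 H2). Qed.

Lemma RInt_rev (f : R -> R) (a b : R) :
  ex_RInt f a b -> - RInt f a b = RInt f b a.
Proof. exact (opp_RInt_swap f a b). Qed.

Lemma RInt_eq (f g : R -> R) (a b : R) :
  (forall x, f x = g x) -> RInt f a b = RInt g a b.
Proof. intros H; apply RInt_ext; intros; apply H. Qed.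

Lemma RInt_FTC (f df : R -> R) (a b : R) :
  (forall x, Rmin a b <= x <= Rmax a b -> is_derive f x (df x)) ->
  (forall x, Rmin a b <= x <= Rmax a b -> continuous df x) ->
  RInt df a b = f b - f a.
Proof.
  intros H1 H2; apply is_RInt_unique; exact (is_RInt_derive f df a b H1 H2).
Qed.

Lemma RInt_lin (f : R -> R) (u v a b : R) :
  (forall x, continuous f x) ->
  u * RInt (fun y => f (u * y + v)) a b = RInt f (u * a + v) (u * b + v).
Proof.
  intros Hf. rewrite <- RInt_mul by exint.
  apply (RInt_comp_lin f u v a b). exint.
Qed.

Lemma RInt_reflect (f : R -> R) (v a b : R) :
  (forall x, continuous f x) ->
  RInt (fun y => f (v - y)) a b = RInt f (v - b) (v - a).
Proof.
  intros Hf. assert (H := RInt_lin f (-1) v a b Hf).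
  rewrite (RInt_eq _ (fun y => f (-1 * y + v))) by (intros; f_equal; req; ring).
  replace (v - b) with (-1 * b + v) by ring.
  replace (v - a) with (-1 * a + v) by ring.
  rewrite <- (RInt_rev f (-1 * a + v)), <- H by exint. req. ring.
Qed.

Lemma RInt_even (f : R -> R) (a : R) :
  (forall x, continuous f x) -> (forall x, f (- x) = f x) ->
  RInt f (- a) a = 2 * RInt f 0 a.
Proof.
  intros Hf He. rewrite (RInt_split f (- a) 0 a) by exint.
  replace (- a) with (0 - a) by ring.
  replace (RInt f (0 - a) 0) with (RInt f (0 - a) (0 - 0)) by (f_equal; req; ring).
  rewrite <- RInt_reflect by assumption.
  rewrite (RInt_eq _ f) by (intros; rewrite <- (He x); f_equal; req; ring). req. ring.
Qed.

Lemma RInt_odd (f : R -> R) (a : R) :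
  (forall x, continuous f x) -> (forall x, f (- x) = - f x) ->
  RInt f (- a) a = 0.
Proof.
  intros Hf Ho.
  assert (H : RInt f (- a) a = - RInt f (- a) a); [|lra].
  assert (E : RInt f (0 - a) (0 - - a) = RInt f (- a) a) by (f_equal; req; ring).
  rewrite <- E at 1. rewrite <- RInt_reflect by assumption.
  rewrite (RInt_eq _ (fun x => -1 * f x)).
  - rewrite RInt_mul by exint. req. ring.
  - intros x; replace (0 - x) with (- x) by ring; rewrite Ho; req; ring.
Qed.

Lemma RInt_period (f : R -> R) (L s a : R) :
  (forall x, continuous f x) -> (forall x, f (x + L) = f x) ->
  RInt f (a + s) (a + s + L) = RInt f a (a + L).
Proof.
  intros Hf HL.
  assert (H : RInt f (a + L) (a + s + L) = RInt f a (a + s)).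
  { assert (H := RInt_lin f 1 L a (a + s) Hf).
    rewrite (RInt_eq _ f) in H by (intros; rewrite <- (HL x); f_equal; req; ring).
    replace (a + L) with (1 * a + L) by ring.
    replace (a + s + L) with (1 * (a + s) + L) by ring. rewrite <- H. req. ring. }
  rewrite (RInt_split f (a + s) (a + L) (a + s + L)) by exint.
  rewrite (RInt_split f a (a + s) (a + L)) by exint. rewrite H. req. ring.
Qed.

Lemma RInt_diff_le (f g : R -> R) (a b e : R) :
  a <= b -> ex_RInt f a b -> ex_RInt g a b ->
  (forall t, a <= t <= b -> Rabs (f t - g t) <= e) ->
  Rabs (RInt f a b - RInt g a b) <= (b - a) * e.
Proof.
  intros Hab Hf Hg H. rewrite <- RInt_sub by assumption.
  apply abs_RInt_le_const; [assumption| |assumption].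
  exact (ex_RInt_minus f g a b Hf Hg).
Qed.

(** Indexed by the number of terms and not by the last index, because empty
    sums occur. *)
Fixpoint rsum (F : nat -> R) (N : nat) : R :=
  match N with O => 0 | S N => rsum F N + F N end.

Lemma rsum_ext (F G : nat -> R) (N : nat) :
  (forall i, (i < N)%nat -> F i = G i) -> rsum F N = rsum G N.
Proof.
  induction N as [|N IH]; intros H; simpl; [reflexivity|].
  rewrite IH by (intros; apply H; lia). now rewrite H by lia.
Qed.

Lemma rsum_le (F G : nat -> R) (N : nat) :
  (forall i, (i < N)%nat -> F i <= G i) -> rsum F N <= rsum G N.
Proof.
  induction N as [|N IH]; intros H; simpl; [lra|].
  assert (rsum F N <= rsum G N) by (apply IH; intros; apply H; lia).
  assert (F N <= G N) by (apply H; lia). lra.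
Qed.

Lemma rsum_abs (F : nat -> R) (N : nat) :
  Rabs (rsum F N) <= rsum (fun i => Rabs (F i)) N.
Proof.
  induction N as [|N IH]; simpl; [rewrite Rabs_R0; lra|].
  eapply Rle_trans; [apply Rabs_triang|]. lra.
Qed.

Lemma rsum_plus (F G : nat -> R) (N : nat) :
  rsum (fun i => F i + G i) N = rsum F N + rsum G N.
Proof. induction N as [|N IH]; simpl; [ring|rewrite IH; ring]. Qed.

Lemma rsum_scal (c : R) (F : nat -> R) (N : nat) :
  rsum (fun i => c * F i) N = c * rsum F N.
Proof. induction N as [|N IH]; simpl; [ring|rewrite IH; ring]. Qed.

Lemma rsum_const (c : R) (N : nat) : rsum (fun _ => c) N = INR N * c.
Proof. induction N as [|N IH]; [simpl; ring|]. rewrite S_INR. simpl. rewrite IH. ring. Qed.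

Lemma rsum_add (F : nat -> R) (M N : nat) :
  rsum F (M + N) = rsum F M + rsum (fun i => F (M + i)%nat) N.
Proof.
  induction N as [|N IH]; simpl.
  - rewrite Nat.add_0_r; ring.
  - rewrite Nat.add_succ_r. simpl. rewrite IH. ring.
Qed.

Lemma rsum_sum_n (F : nat -> R) (N : nat) : rsum F (S N) = sum_n F N.
Proof.
  induction N as [|N IH].
  - simpl; rewrite sum_O; ring.
  - rewrite sum_Sn, <- IH. reflexivity.
Qed.

(** Windows of integers are half open, so that consecutive ones concatenate. *)
Definition sumZ (F : Z -> R) (p q : Z) : R :=
  rsum (fun i => F (p + Z.of_nat i)%Z) (Z.to_nat (q - p)).

Lemma sumZ_ext (F G : Z -> R) (p q : Z) :
  (forall v, (p <= v < q)%Z -> F v = G v) -> sumZ F p q = sumZ G p q.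
Proof. intros H; apply rsum_ext; intros i Hi; apply H; lia. Qed.

Lemma sumZ_le (F G : Z -> R) (p q : Z) :
  (forall v, (p <= v < q)%Z -> F v <= G v) -> sumZ F p q <= sumZ G p q.
Proof. intros H; apply rsum_le; intros i Hi; apply H; lia. Qed.

Lemma sumZ_abs (F : Z -> R) (p q : Z) :
  Rabs (sumZ F p q) <= sumZ (fun v => Rabs (F v)) p q.
Proof. apply rsum_abs. Qed.

Lemma sumZ_plus (F G : Z -> R) (p q : Z) :
  sumZ (fun v => F v + G v) p q = sumZ F p q + sumZ G p q.
Proof. apply rsum_plus. Qed.

Lemma sumZ_scal (c : R) (F : Z -> R) (p q : Z) :
  sumZ (fun v => c * F v) p q = c * sumZ F p q.
Proof. apply rsum_scal. Qed.

Lemma sumZ_minus (F G : Z -> R) (p q : Z) :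
  sumZ (fun v => F v - G v) p q = sumZ F p q - sumZ G p q.
Proof.
  rewrite (sumZ_ext _ (fun v => F v + -1 * G v)) by (intros; ring).
  rewrite sumZ_plus, sumZ_scal. ring.
Qed.

Lemma sumZ_const (c : R) (p q : Z) :
  (p <= q)%Z -> sumZ (fun _ => c) p q = (IZR q - IZR p) * c.
Proof.
  intros H; unfold sumZ; rewrite rsum_const, INR_IZR_INZ, Z2Nat.id by lia.
  now rewrite minus_IZR.
Qed.

Lemma sumZ_nil (F : Z -> R) (p q : Z) : (q <= p)%Z -> sumZ F p q = 0.
Proof. intros H; unfold sumZ; replace (Z.to_nat (q - p)) with O by lia; reflexivity. Qed.

Lemma sumZ_Chasles (F : Z -> R) (p q r : Z) :
  (p <= q <= r)%Z -> sumZ F p r = sumZ F p q + sumZ F q r.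
Proof.
  intros H; unfold sumZ.
  replace (Z.to_nat (r - p)) with (Z.to_nat (q - p) + Z.to_nat (r - q))%nat by lia.
  rewrite rsum_add; f_equal; apply rsum_ext; intros; f_equal; lia.
Qed.

Lemma sumZ_S (F : Z -> R) (p q : Z) :
  (p <= q)%Z -> sumZ F p (q + 1) = sumZ F p q + F q.
Proof.
  intros H; rewrite (sumZ_Chasles F p q) by lia; f_equal.
  unfold sumZ; replace (Z.to_nat (q + 1 - q)) with 1%nat by lia; simpl.
  rewrite Z.add_0_r; ring.
Qed.

Lemma sumZ_ge0 (F : Z -> R) (p q : Z) :
  (forall v, (p <= v < q)%Z -> 0 <= F v) -> 0 <= sumZ F p q.
Proof.
  intros H; apply Rle_trans with (sumZ (fun _ => 0 * 0) p q).
  - rewrite sumZ_scal; lra.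
  - apply sumZ_le; intros; rewrite Rmult_0_l; auto.
Qed.

Lemma sumZ_le_const (F : Z -> R) (p q : Z) (c : R) :
  (p <= q)%Z -> (forall v, (p <= v < q)%Z -> Rabs (F v) <= c) ->
  Rabs (sumZ F p q) <= (IZR q - IZR p) * c.
Proof.
  intros Hpq H; rewrite <- sumZ_const by assumption.
  eapply Rle_trans; [apply sumZ_abs|]; now apply sumZ_le.
Qed.

Lemma sumZ_shift (F : Z -> R) (p q l : Z) :
  sumZ (fun v => F (v + l)%Z) p q = sumZ F (p + l) (q + l).
Proof.
  unfold sumZ; replace (q + l - (p + l))%Z with (q - p)%Z by lia.
  apply rsum_ext; intros; f_equal; lia.
Qed.

Lemma sumZ_incr (F : Z -> R) (p q P Q : Z) :
  (forall v, 0 <= F v) -> (P <= p)%Z -> (q <= Q)%Z -> sumZ F p q <= sumZ F P Q.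
Proof.
  intros HF H1 H2. destruct (Z_le_dec p q) as [H|H].
  - rewrite (sumZ_Chasles F P p Q), (sumZ_Chasles F p q Q) by lia.
    assert (0 <= sumZ F P p) by (apply sumZ_ge0; auto).
    assert (0 <= sumZ F q Q) by (apply sumZ_ge0; auto). lra.
  - rewrite (sumZ_nil F p q) by lia. apply sumZ_ge0; auto.
Qed.

Lemma Z_ge_ind (p : Z) (P : Z -> Prop) :
  P p -> (forall q, (p <= q)%Z -> P q -> P (q + 1)%Z) ->
  forall q, (p <= q)%Z -> P q.
Proof.
  intros H0 HS q Hq.
  replace q with (p + Z.of_nat (Z.to_nat (q - p)))%Z by lia.
  generalize (Z.to_nat (q - p)) as N; intros N.
  induction N as [|N IH]; [now rewrite Z.add_0_r|].
  rewrite Nat2Z.inj_succ, Z.add_succ_r. apply HS; [lia|assumption].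
Qed.

Lemma sumZ_RInt (F : Z -> R -> R) (a b : R) (p q : Z) :
  (p <= q)%Z -> (forall v, ex_RInt (F v) a b) ->
  ex_RInt (fun x => sumZ (fun v => F v x) p q) a b /\
  RInt (fun x => sumZ (fun v => F v x) p q) a b
  = sumZ (fun v => RInt (F v) a b) p q.
Proof.
  intros Hpq HF; revert q Hpq. apply Z_ge_ind.
  - split.
    + apply (ex_RInt_ext (fun _ => 0)); [intros; now rewrite sumZ_nil by lia|].
      apply ex_RInt_const.
    + rewrite (RInt_eq _ (fun _ => 0)) by (intros; now rewrite sumZ_nil by lia).
      rewrite RInt_cst, sumZ_nil by lia. req; ring.
  - intros q Hq [E IH]. split.
    + apply (ex_RInt_ext (fun x => sumZ (fun v => F v x) p q + F q x)).
      * intros; now rewrite sumZ_S.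
      * apply (ex_RInt_plus (fun x => sumZ (fun v => F v x) p q)); auto.
    + rewrite (RInt_eq _ (fun x => sumZ (fun v => F v x) p q + F q x))
        by (intros; now rewrite sumZ_S).
      rewrite RInt_add by auto. now rewrite IH, sumZ_S.
Qed.

(** Cauchy-Schwarz against the constant sequence, in the only normalisation
    needed: the squares sum to at most [1]. *)
Lemma sumZ_abs_le_sqrt (F : Z -> R) (p q : Z) (U : R) :
  (p <= q)%Z -> IZR q - IZR p <= U -> sumZ (fun v => F v ^ 2) p q <= 1 ->
  sumZ (fun v => Rabs (F v)) p q <= sqrt U.
Proof.
  intros Hpq HU H2. assert (Hp := IZR_le _ _ Hpq).
  destruct (Rle_lt_dec U 0) as [H0|H0].
  - rewrite sumZ_nil by (apply le_IZR; lra). apply sqrt_pos.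
  - set (s := sqrt U). assert (Hs : 0 < s) by (apply sqrt_lt_R0; lra).
    assert (Hss : s * s = U) by (apply sqrt_sqrt; lra).
    apply Rle_trans with (sumZ (fun v => / (2 * s) + s / 2 * F v ^ 2) p q).
    + apply sumZ_le; intros v _. rewrite <- (pow2_abs (F v)).
      set (x := Rabs (F v)).
      assert (0 <= / (2 * s) * (s * x - 1) ^ 2).
      { apply Rmult_le_pos; [left; apply Rinv_0_lt_compat; lra|apply pow2_ge_0]. }
      assert (/ (2 * s) * (s * x - 1) ^ 2 = / (2 * s) + s / 2 * x ^ 2 - x)
        by (field; lra). lra.
    + rewrite sumZ_plus, sumZ_scal, sumZ_const by assumption.
      assert ((IZR q - IZR p) * / (2 * s) <= U * / (2 * s)).
      { apply Rmult_le_compat_r; [left; apply Rinv_0_lt_compat|]; lra. }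
      assert (U * / (2 * s) = s / 2) by (rewrite <- Hss; field; lra).
      assert (s / 2 * sumZ (fun v => F v ^ 2) p q <= s / 2 * 1)
        by (apply Rmult_le_compat_l; lra). lra.
Qed.

(** * Oscillatory integrals and the Fresnel integrals *)

(** Integrate [B * (sin psi)'] by parts: as [B] is monotone, its total
    variation is again a difference of boundary values. *)
Lemma oscillatory_bound (B B' psi psi' : R -> R) (x y b : R) :
  x <= y ->
  (forall t, x <= t <= y -> is_derive B t (B' t)) ->
  (forall t, x <= t <= y -> is_derive psi t (psi' t)) ->
  (forall t, x <= t <= y -> continuous B' t) ->
  (forall t, x <= t <= y -> continuous psi' t) ->
  (forall t, x <= t <= y -> B' t <= 0) ->
  (forall t, x <= t <= y -> Rabs (B t) <= b) ->
  Rabs (RInt (fun t => B t * psi' t * cos (psi t)) x y) <= 4 * b.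
Proof.
  intros Hxy DB Dp CB Cp HB Hb.
  assert (seg : forall t, Rmin x y <= t <= Rmax x y -> x <= t <= y)
    by (intros t; rewrite Rmin_left, Rmax_right by lra; tauto).
  assert (CB0 : forall t, x <= t <= y -> continuous B t)
    by (intros; eapply cont_derive; eauto).
  assert (Cp0 : forall t, x <= t <= y -> continuous psi t)
    by (intros; eapply cont_derive; eauto).
  assert (E1 : ex_RInt (fun t => B' t * sin (psi t)) x y)
    by (apply @ex_RInt_continuous; intros z Hz; apply seg in Hz; cont; auto).
  assert (E2 : ex_RInt (fun t => B t * psi' t * cos (psi t)) x y)
    by (apply @ex_RInt_continuous; intros z Hz; apply seg in Hz; cont; auto).
  assert (E3 : ex_RInt B' x y)
    by (apply @ex_RInt_continuous; intros z Hz; apply seg in Hz; auto).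
  assert (P : RInt (fun t => B' t * sin (psi t) + B t * psi' t * cos (psi t)) x y
              = B y * sin (psi y) - B x * sin (psi x)).
  { apply (RInt_FTC (fun t => B t * sin (psi t))).
    - intros t Ht; apply seg in Ht.
      replace (B' t * sin (psi t) + B t * psi' t * cos (psi t))
        with (B' t * sin (psi t) + B t * (psi' t * cos (psi t))) by ring.
      apply (is_derive_mult B (fun t => sin (psi t)));
        [auto| |intros; apply Rmult_comm].
      apply (is_derive_comp sin psi); [apply is_derive_sin|auto].
    - intros t Ht; apply seg in Ht; cont; auto. }
  rewrite RInt_add in P by assumption.
  assert (V : RInt B' x y = B y - B x).
  { apply RInt_FTC; intros t Ht; apply seg in Ht; auto. }
  assert (S : Rabs (RInt (fun t => B' t * sin (psi t)) x y) <= B x - B y).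
  { eapply Rle_trans; [apply abs_RInt_le; assumption|].
    replace (B x - B y) with (-1 * RInt B' x y) by (rewrite V; ring).
    rewrite <- RInt_mul by assumption.
    apply RInt_le; [assumption| | |].
    - apply @ex_RInt_continuous; intros z Hz; apply seg in Hz; cont; auto.
    - apply @ex_RInt_continuous; intros z Hz; apply seg in Hz; cont; auto.
    - intros t Ht. rewrite Rabs_mult.
      assert (B' t <= 0) by (apply HB; lra). rewrite (Rabs_left1 (B' t)) by lra.
      assert (Rabs (sin (psi t)) <= 1) by (apply Rabs_le, SIN_bound).
      apply Rle_trans with (- B' t * 1); [|lra].
      apply Rmult_le_compat_l; lra. }
  assert (Bx := Hb x ltac:(lra)). assert (By := Hb y ltac:(lra)).
  assert (T : forall u v, Rabs u <= b -> Rabs (u * sin v) <= b).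
  { intros u v Hu. rewrite Rabs_mult.
    assert (Rabs (sin v) <= 1) by (apply Rabs_le, SIN_bound).
    apply Rle_trans with (Rabs u * 1); [|lra].
    apply Rmult_le_compat_l; [apply Rabs_pos|assumption]. }
  assert (Tx := T _ (psi x) Bx). assert (Ty := T _ (psi y) By).
  revert S Bx By Tx Ty P.
  generalize (RInt (fun t => B' t * sin (psi t)) x y : R).
  generalize (RInt (fun t => B t * psi' t * cos (psi t)) x y : R).
  intros I J. unfold Rabs. repeat destruct (Rcase_abs _); lra.
Qed.

(** van der Corput's first derivative test: here the amplitude is [1 / psi'],
    decreasing because [psi'] is increasing. *)
Lemma first_derivative_test (psi psi1 psi2 : R -> R) (x y lam : R) :
  x <= y -> 0 < lam ->
  (forall t, x <= t <= y -> is_derive psi t (psi1 t)) ->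
  (forall t, x <= t <= y -> is_derive psi1 t (psi2 t)) ->
  (forall t, x <= t <= y -> continuous psi2 t) ->
  (forall t, x <= t <= y -> 0 <= psi2 t) ->
  (forall t, x <= t <= y -> lam <= Rabs (psi1 t)) ->
  Rabs (RInt (fun t => cos (psi t)) x y) <= 4 / lam.
Proof.
  intros Hxy Hl D1 D2 C2 H2 H1.
  assert (N : forall t, x <= t <= y -> psi1 t <> 0).
  { intros t Ht E; specialize (H1 t Ht); rewrite E, Rabs_R0 in H1; lra. }
  assert (C1 : forall t, x <= t <= y -> continuous psi1 t)
    by (intros; eapply cont_derive; eauto).
  rewrite (RInt_ext _ (fun t => / psi1 t * psi1 t * cos (psi t))).
  2:{ intros t; rewrite Rmin_left, Rmax_right by lra; intros Ht.
      rewrite Rinv_l by (apply N; lra); symmetry; apply Rmult_1_l. }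
  apply (oscillatory_bound _ (fun t => - psi2 t / psi1 t ^ 2)); auto.
  - intros t Ht. apply (is_derive_inv psi1); auto.
  - intros t Ht; cont; auto. apply pow_nonzero; auto.
  - intros t Ht. assert (0 <= psi2 t / psi1 t ^ 2); [|unfold Rdiv in *; lra].
    apply Rmult_le_pos; [auto|]. left; apply Rinv_0_lt_compat.
    assert (0 <= psi1 t ^ 2) by apply pow2_ge_0.
    assert (psi1 t ^ 2 <> 0) by (apply pow_nonzero; auto). lra.
  - intros t Ht. rewrite Rabs_inv. apply Rinv_le_contravar; auto.
Qed.

Lemma fresnel_tail (th X Y : R) :
  0 < X <= Y -> Rabs (RInt (fun v => cos (th + v ^ 2)) X Y) <= 2 / X.
Proof.
  intros H. replace (2 / X) with (4 / (2 * X)) by (field; lra).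
  apply (first_derivative_test _ (fun v => 2 * v) (fun _ => 2)); try lra.
  - intros; auto_derive; [trivial|ring].
  - intros; auto_derive; [trivial|ring].
  - intros; apply cont_const.
  - intros; lra.
  - intros; rewrite Rabs_pos_eq; lra.
Qed.

Definition fresnel_cos (X : R) : R := RInt (fun v => cos (v ^ 2)) 0 X.
Definition fresnel_sin (X : R) : R := RInt (fun v => sin (v ^ 2)) 0 X.

Lemma fresnel_cos_sin (th X : R) :
  RInt (fun v => cos (th + v ^ 2)) 0 X
  = cos th * fresnel_cos X - sin th * fresnel_sin X.
Proof.
  unfold fresnel_cos, fresnel_sin.
  rewrite (RInt_eq _ (fun v => cos th * cos (v ^ 2) - sin th * sin (v ^ 2)))
    by (intros; apply cos_plus).
  rewrite RInt_sub, !RInt_mul by exint. reflexivity.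
Qed.

Lemma fresnel_cauchy (th X Y : R) :
  0 < X <= Y ->
  Rabs (cos th * (fresnel_cos Y - fresnel_cos X)
        - sin th * (fresnel_sin Y - fresnel_sin X)) <= 2 / X.
Proof.
  intros H. assert (F := fresnel_tail th X Y H).
  assert (E : RInt (fun v => cos (th + v ^ 2)) 0 Y
              = RInt (fun v => cos (th + v ^ 2)) 0 X
                + RInt (fun v => cos (th + v ^ 2)) X Y) by (apply RInt_split; exint).
  rewrite !fresnel_cos_sin in E.
  replace (cos th * (fresnel_cos Y - fresnel_cos X)
           - sin th * (fresnel_sin Y - fresnel_sin X))
    with (RInt (fun v => cos (th + v ^ 2)) X Y : R) by (req; lra).
  exact F.
Qed.

Lemma fresnel_cauchy_cos (X Y : R) :
  0 < X <= Y -> Rabs (fresnel_cos Y - fresnel_cos X) <= 2 / X.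
Proof.
  intros H. assert (F := fresnel_cauchy 0 X Y H). rewrite cos_0, sin_0 in F.
  replace (fresnel_cos Y - fresnel_cos X)
    with (1 * (fresnel_cos Y - fresnel_cos X) - 0 * (fresnel_sin Y - fresnel_sin X))
    by ring. exact F.
Qed.

Lemma fresnel_cauchy_sin (X Y : R) :
  0 < X <= Y -> Rabs (fresnel_sin Y - fresnel_sin X) <= 2 / X.
Proof.
  intros H. assert (F := fresnel_cauchy (- (PI / 2)) X Y H).
  rewrite cos_neg, sin_neg, cos_PI2, sin_PI2 in F.
  replace (fresnel_sin Y - fresnel_sin X)
    with (0 * (fresnel_cos Y - fresnel_cos X)
          - -1 * (fresnel_sin Y - fresnel_sin X)) by ring.
  replace (- (1)) with (-1) in F by ring. exact F.
Qed.

Lemma limit_at_rate (u : R -> R) :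
  (forall X Y, 0 < X <= Y -> Rabs (u Y - u X) <= 2 / X) ->
  exists l, forall X, 0 < X -> Rabs (u X - l) <= 2 / X.
Proof.
  intros H.
  assert (ex_finite_lim_seq (fun n => u (INR n))) as [l Hl].
  { apply ex_lim_seq_cauchy_corr. intros eps.
    destruct (nfloor_ex (2 / eps)) as [N HN].
    { left; apply Rdiv_lt_0_compat; [lra|apply cond_pos]. }
    exists (S N). intros n m Hn Hm.
    assert (W : forall n m, (S N <= n)%nat -> (n <= m)%nat ->
                Rabs (u (INR m) - u (INR n)) < eps).
    { clear n m Hn Hm. intros n m Hn Hm.
      assert (INR N + 1 <= INR n) by (rewrite <- S_INR; apply le_INR; lia).
      assert (0 <= INR N) by apply pos_INR.
      assert (INR n <= INR m) by (apply le_INR; lia).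
      apply Rle_lt_trans with (2 / INR n); [apply H; lra|].
      assert (He := cond_pos eps).
      apply Rmult_lt_reg_r with (INR n); [lra|].
      unfold Rdiv; rewrite Rmult_assoc, Rinv_l, Rmult_1_r by lra.
      apply Rmult_lt_reg_l with (/ eps); [apply Rinv_0_lt_compat; lra|].
      rewrite <- Rmult_assoc, Rinv_l, Rmult_1_l by lra.
      unfold Rdiv in HN; lra. }
    destruct (le_ge_dec n m) as [L|L].
    - rewrite Rabs_minus_sym. apply W; lia.
    - apply W; lia. }
  exists l. intros X HX. apply Rabs_le_between.
  assert (Hb : forall n, X <= INR n -> - (2 / X) <= u X - u (INR n) <= 2 / X).
  { intros n Hn. apply Rabs_le_between. rewrite Rabs_minus_sym. apply H. lra. }
  destruct (nfloor_ex X) as [N HN]; [lra|].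
  assert (L : is_lim_seq (fun n => u X - u (INR n)) (u X - l)).
  { apply is_lim_seq_minus'; [apply is_lim_seq_const|assumption]. }
  assert (E : eventually (fun n => X <= INR n)).
  { exists (S N). intros n Hn. apply le_INR in Hn. rewrite S_INR in Hn. lra. }
  split.
  - apply (is_lim_seq_le_loc (fun _ => - (2 / X)) (fun n => u X - u (INR n))
             (- (2 / X)) (u X - l)); [|apply is_lim_seq_const|exact L].
    apply (filter_imp (fun n => X <= INR n)); [|exact E].
    intros n Hn; apply Hb; assumption.
  - apply (is_lim_seq_le_loc (fun n => u X - u (INR n)) (fun _ => 2 / X)
             (u X - l) (2 / X)); [|exact L|apply is_lim_seq_const].
    apply (filter_imp (fun n => X <= INR n)); [|exact E].
    intros n Hn; apply Hb; assumption.
Qed.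

(** Integrated over [[0, 1]] in [x], it has the [t]-derivative of the real part
    of [exp(i th) E(t)^2], where [E(t) = int_0^t exp(i u^2) du]. *)
Definition fresnel_kernel (th t x : R) : R :=
  sin (th + t ^ 2 * (1 + x ^ 2)) / (1 + x ^ 2).

Lemma one_plus_sq_pos (x : R) : 0 < 1 + x ^ 2.
Proof. assert (0 <= x ^ 2) by apply pow2_ge_0; lra. Qed.

Lemma fresnel_kernel_derive (th t x : R) :
  is_derive (fun u => fresnel_kernel th u x) t
    (2 * t * cos (th + t ^ 2 * (1 + x ^ 2))).
Proof.
  assert (H := one_plus_sq_pos x).
  unfold fresnel_kernel. auto_derive; [trivial|].
  change (x * (x * 1)) with (x ^ 2); change (t * (t * 1)) with (t ^ 2). field. lra.
Qed.

Lemma fresnel_kernel_cont (th t x : R) : continuous (fresnel_kernel th t) x.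
Proof.
  assert (H := one_plus_sq_pos x). unfold fresnel_kernel. cont. lra.
Qed.

Lemma fresnel_kernel_RInt_derive (th t : R) :
  is_derive (fun u => RInt (fresnel_kernel th u) 0 1) t
    (2 * (cos (th + t ^ 2) * fresnel_cos t - sin (th + t ^ 2) * fresnel_sin t)).
Proof.
  assert (D : forall u x, Derive (fun z => fresnel_kernel th z x) u
                          = 2 * u * cos (th + u ^ 2 * (1 + x ^ 2)))
    by (intros; apply is_derive_unique, fresnel_kernel_derive).
  rewrite <- fresnel_cos_sin.
  replace (2 * RInt (fun v => cos (th + t ^ 2 + v ^ 2)) 0 t)
    with (RInt (fun x => Derive (fun u => fresnel_kernel th u x) t) 0 1).
  - apply is_derive_RInt_param.
    + apply filter_forall; intros u x _. eexists; apply fresnel_kernel_derive.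
    + intros x _.
      apply (continuity_2d_pt_ext (fun u v => 2 * u * cos (th + u ^ 2 * (1 + v ^ 2))));
        [intros; symmetry; apply D|].
      assert (C2 : forall g, continuity_2d_pt g t x ->
                continuity_2d_pt (fun u v => g u v ^ 2) t x).
      { intros g Hg. apply (continuity_2d_pt_ext (fun u v => g u v * g u v));
          [intros; ring|]. now apply continuity_2d_pt_mult. }
      apply (continuity_2d_pt_mult (fun u v => 2 * u)
               (fun u v => cos (th + u ^ 2 * (1 + v ^ 2)))).
      * apply (continuity_2d_pt_mult (fun _ _ => 2) (fun u _ => u));
          [apply continuity_2d_pt_const|apply continuity_2d_pt_id1].
      * apply (continuity_1d_2d_pt_comp cos (fun u v => th + u ^ 2 * (1 + v ^ 2)));
          [apply continuity_cos|].
        apply (continuity_2d_pt_plus (fun _ _ => th)); [apply continuity_2d_pt_const|].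
        apply (continuity_2d_pt_mult (fun u _ => u ^ 2) (fun _ v => 1 + v ^ 2)).
        -- apply (C2 (fun u _ => u)), continuity_2d_pt_id1.
        -- apply (continuity_2d_pt_plus (fun _ _ => 1));
             [apply continuity_2d_pt_const|].
           apply (C2 (fun _ v => v)), continuity_2d_pt_id2.
    + apply filter_forall; intros u. apply @ex_RInt_continuous; intros.
      apply fresnel_kernel_cont.
  - rewrite (RInt_eq _ (fun x => 2 * (t * cos (th + t ^ 2 + (t * x + 0) ^ 2)))).
    2:{ intros x; rewrite D. replace (th + t ^ 2 + (t * x + 0) ^ 2)
          with (th + t ^ 2 * (1 + x ^ 2)) by ring. ring. }
    rewrite RInt_mul by exint. rewrite RInt_mul by exint.
    rewrite (RInt_lin (fun v => cos (th + t ^ 2 + v ^ 2)) t 0 0 1)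
      by (intros; cont).
    replace (t * 0 + 0) with 0 by ring. replace (t * 1 + 0) with t by ring.
    reflexivity.
Qed.

(** The integral over [0, 1/t] is at most [1/t]; past [1/t] the phase
    [t^2 (1 + x^2)] turns faster than [2 t]. *)
Lemma fresnel_kernel_small (th t : R) :
  1 < t -> Rabs (RInt (fresnel_kernel th t) 0 1) <= 3 / t.
Proof.
  intros Ht.
  assert (E : forall a b, ex_RInt (fresnel_kernel th t) a b)
    by (intros; apply @ex_RInt_continuous; intros; apply fresnel_kernel_cont).
  assert (Hi : 0 < / t) by (apply Rinv_0_lt_compat; lra).
  assert (Hi1 : / t < 1) by (rewrite <- Rinv_1; apply Rinv_lt_contravar; lra).
  rewrite (RInt_split _ 0 (/ t) 1) by apply E.
  eapply Rle_trans; [apply Rabs_triang|].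
  assert (I1 : Rabs (RInt (fresnel_kernel th t) 0 (/ t)) <= (/ t - 0) * 1).
  { apply abs_RInt_le_const; [lra|apply E|]. intros x _.
    assert (H := one_plus_sq_pos x). unfold fresnel_kernel, Rdiv.
    rewrite Rabs_mult, Rabs_inv, (Rabs_pos_eq (1 + x ^ 2)) by lra.
    rewrite <- (Rmult_1_l 1).
    apply Rmult_le_compat; [apply Rabs_pos|left; apply Rinv_0_lt_compat; lra| |].
    - apply Rabs_le, SIN_bound.
    - rewrite <- Rinv_1; apply Rinv_le_contravar; [lra|].
      assert (0 <= x ^ 2) by apply pow2_ge_0; lra. }
  assert (I2 : Rabs (RInt (fresnel_kernel th t) (/ t) 1) <= 4 * / (2 * t)).
  { assert (Hx : forall x, / t <= x <= 1 -> 0 < 2 * t ^ 2 * (x * (1 + x ^ 2))).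
    { intros x Hx. assert (H := one_plus_sq_pos x).
      apply Rmult_lt_0_compat; [|apply Rmult_lt_0_compat; lra].
      apply Rmult_lt_0_compat; [lra|apply pow_lt; lra]. }
    rewrite (RInt_ext _ (fun x => / (2 * t ^ 2 * (x * (1 + x ^ 2))) * (2 * t ^ 2 * x)
               * cos (th - PI / 2 + t ^ 2 * (1 + x ^ 2)))).
    2:{ intros x; rewrite Rmin_left, Rmax_right by lra; intros H.
        assert (H2 := Hx x ltac:(lra)). assert (H1 := one_plus_sq_pos x).
        replace (cos (th - PI / 2 + t ^ 2 * (1 + x ^ 2)))
          with (sin (th + t ^ 2 * (1 + x ^ 2)))
          by (rewrite <- cos_shift, <- cos_neg; f_equal; ring).
        unfold fresnel_kernel; req; field. lra. }
    apply (oscillatory_bound _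
             (fun x => - (2 * t ^ 2 * (1 + 3 * x ^ 2))
                       / (2 * t ^ 2 * (x * (1 + x ^ 2))) ^ 2)); try lra.
    - intros x H; assert (H2 := Hx x H).
      apply (is_derive_inv (fun x => 2 * t ^ 2 * (x * (1 + x ^ 2)))); [|lra].
      auto_derive; [trivial|ring].
    - intros x H. auto_derive; [trivial|ring].
    - intros x H. cont. apply pow_nonzero. apply Hx in H; lra.
    - intros x H. cont.
    - intros x H; assert (H2 := Hx x H).
      assert (0 <= 2 * t ^ 2 * (1 + 3 * x ^ 2) / (2 * t ^ 2 * (x * (1 + x ^ 2))) ^ 2);
        [|unfold Rdiv in *; lra].
      apply Rmult_le_pos.
      + assert (0 <= t ^ 2) by apply pow2_ge_0. assert (0 <= x ^ 2) by apply pow2_ge_0.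
        apply Rmult_le_pos; lra.
      + left; apply Rinv_0_lt_compat, pow_lt; lra.
    - intros x H; assert (H2 := Hx x H). rewrite Rabs_inv, Rabs_pos_eq by lra.
      apply Rinv_le_contravar; [lra|].
      assert (0 <= x ^ 2) by apply pow2_ge_0.
      assert (1 <= t * x).
      { rewrite <- (Rinv_r t) by lra. apply Rmult_le_compat_l; lra. }
      replace (2 * t ^ 2 * (x * (1 + x ^ 2))) with (2 * t * ((t * x) * (1 + x ^ 2))) by ring.
      rewrite <- (Rmult_1_r (2 * t)) at 1. apply Rmult_le_compat_l; [lra|].
      rewrite <- (Rmult_1_l 1). apply Rmult_le_compat; lra. }
  replace (3 / t) with ((/ t - 0) * 1 + 4 * / (2 * t)) by (field; lra).
  now apply Rplus_le_compat.
Qed.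

Lemma fresnel_derive_cos (t : R) : is_derive fresnel_cos t (cos (t ^ 2)).
Proof.
  apply (is_derive_RInt (fun v => cos (v ^ 2)) _ 0 t); [|cont].
  apply filter_forall; intros; apply (@RInt_correct R_CompleteNormedModule); exint.
Qed.

Lemma fresnel_derive_sin (t : R) : is_derive fresnel_sin t (sin (t ^ 2)).
Proof.
  apply (is_derive_RInt (fun v => sin (v ^ 2)) _ 0 t); [|cont].
  apply filter_forall; intros; apply (@RInt_correct R_CompleteNormedModule); exint.
Qed.

(** With [E(t) = int_0^t exp(i u^2) du], both sides of this identity between
    real parts have the derivative [Re (2 exp(i (th + t^2)) E(t))]: on the left
    it is that of [exp(i th) E(t)^2], on the right the substitution [u = t x]
    recovers it. *)
Lemma fresnel_square (th t : R) :
  cos th * (fresnel_cos t ^ 2 - fresnel_sin t ^ 2)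
    - sin th * (2 * fresnel_cos t * fresnel_sin t)
  = RInt (fresnel_kernel th t) 0 1 - sin th * (PI / 4).
Proof.
  set (G := fun t => cos th * (fresnel_cos t ^ 2 - fresnel_sin t ^ 2)
                     - sin th * (2 * fresnel_cos t * fresnel_sin t)
                     - RInt (fresnel_kernel th t) 0 1).
  assert (DG : forall u, is_derive G u 0).
  { intros u. unfold G.
    apply (is_derive_val _ _
      ((cos th * (2 * fresnel_cos u * cos (u ^ 2) - 2 * fresnel_sin u * sin (u ^ 2))
        - sin th * (2 * (cos (u ^ 2) * fresnel_sin u + fresnel_cos u * sin (u ^ 2))))
       - 2 * (cos (th + u ^ 2) * fresnel_cos u - sin (th + u ^ 2) * fresnel_sin u))
      ); [|rewrite cos_plus, sin_plus; ring].
    apply (is_derive_minus (fun t => cos th * (fresnel_cos t ^ 2 - fresnel_sin t ^ 2)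
                     - sin th * (2 * fresnel_cos t * fresnel_sin t))).
    2:{ apply fresnel_kernel_RInt_derive. }
    assert (Dc := fresnel_derive_cos u). assert (Ds := fresnel_derive_sin u).
    auto_derive.
    - repeat split; eexists; eassumption.
    - replace (Derive (fun x => fresnel_cos x) u) with (cos (u ^ 2))
        by (symmetry; apply is_derive_unique, Dc).
      replace (Derive (fun x => fresnel_sin x) u) with (sin (u ^ 2))
        by (symmetry; apply is_derive_unique, Ds). ring. }
  assert (G t = G 0).
  { destruct (MVT_gen G 0 t (fun _ => 0)) as [c [_ Hc]].
    - intros; apply DG.
    - intros; apply continuity_pt_filterlim, (cont_derive _ _ _ (DG x)).
    - lra. }
  assert (G 0 = - sin th * (PI / 4)).
  { assert (c0 : fresnel_cos 0 = 0) by exact (RInt_point 0 (fun v => cos (v ^ 2))).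
    assert (s0 : fresnel_sin 0 = 0) by exact (RInt_point 0 (fun v => sin (v ^ 2))).
    unfold G. rewrite c0, s0.
    replace (RInt (fresnel_kernel th 0) 0 1) with (sin th * (PI / 4)); [ring|].
    rewrite <- atan_1.
    rewrite (RInt_eq _ (fun x => sin th * (1 / (1 + x ^ 2)))).
    2:{ intros x. unfold fresnel_kernel.
        replace (th + 0 ^ 2 * (1 + x ^ 2)) with th by ring. unfold Rdiv; ring. }
    rewrite RInt_mul.
    2:{ exint. assert (H1 := one_plus_sq_pos z); lra. }
    rewrite (RInt_FTC atan).
    - rewrite atan_0. ring.
    - intros. apply is_derive_Reals. replace (1 / (1 + x ^ 2)) with (/ (1 + x ^ 2)) by lra.
      apply derivable_pt_lim_atan.
    - intros; cont. assert (H2 := one_plus_sq_pos x); lra. }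
  rewrite H0 in H. unfold G in H. lra.
Qed.

(** The complex Fresnel integral converges to the number of modulus
    [sqrt PI / 2] and argument [phi0]. Only the modulus matters later on, so
    the argument is left unevaluated. *)
Definition fresnel_phase (phi0 : R) : Prop :=
  forall X, 0 < X ->
    Rabs (fresnel_cos X - sqrt PI / 2 * cos phi0) <= 2 / X /\
    Rabs (fresnel_sin X - sqrt PI / 2 * sin phi0) <= 2 / X.

(** Letting [t] grow in [fresnel_square] gives the square of the limit, for
    [th = 0] its real part and for [th = PI / 2] its imaginary part. *)
Lemma fresnel_limit : exists phi0, fresnel_phase phi0.
Proof.
  destruct (limit_at_rate fresnel_cos fresnel_cauchy_cos) as [P HP].
  destruct (limit_at_rate fresnel_sin fresnel_cauchy_sin) as [Q HQ].
  assert (conv : forall u l K, (forall X, 1 < X -> Rabs (u X - l) <= K / X) ->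
                 is_lim_seq (fun n => u (INR n)) l).
  { intros u l K H. apply is_lim_seq_spec. intros eps. assert (He := cond_pos eps).
    assert (HK : K <= Rabs K) by apply Rle_abs.
    assert (HK0 := Rabs_pos K).
    destruct (nfloor_ex (Rabs K / eps)) as [N HN].
    { apply Rmult_le_pos; [lra|left; apply Rinv_0_lt_compat; lra]. }
    exists (S (S N)). intros n Hn. apply le_INR in Hn. rewrite !S_INR in Hn.
    assert (0 <= INR N) by apply pos_INR.
    apply Rle_lt_trans with (K / INR n); [apply H; lra|].
    apply Rmult_lt_reg_r with (INR n); [lra|].
    unfold Rdiv; rewrite Rmult_assoc, Rinv_l, Rmult_1_r by lra.
    apply Rle_lt_trans with (Rabs K); [lra|].
    apply Rmult_lt_reg_l with (/ eps); [apply Rinv_0_lt_compat; lra|].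
    rewrite <- Rmult_assoc, Rinv_l, Rmult_1_l by lra.
    unfold Rdiv in HN; lra. }
  assert (LP : is_lim_seq (fun n => fresnel_cos (INR n)) P)
    by (apply (conv _ _ 2); intros; apply HP; lra).
  assert (LQ : is_lim_seq (fun n => fresnel_sin (INR n)) Q)
    by (apply (conv _ _ 2); intros; apply HQ; lra).
  assert (key : forall th, cos th * (P * P - Q * Q) - sin th * (2 * (P * Q))
                           = - (sin th * (PI / 4))).
  { intros th.
    assert (L1 : is_lim_seq (fun n => cos th * (fresnel_cos (INR n) * fresnel_cos (INR n)
                    - fresnel_sin (INR n) * fresnel_sin (INR n))
                  - sin th * (2 * (fresnel_cos (INR n) * fresnel_sin (INR n))))
              (cos th * (P * P - Q * Q) - sin th * (2 * (P * Q)))).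
    { apply is_lim_seq_minus'.
      - apply (is_lim_seq_scal_l _ (cos th) (P * P - Q * Q)).
        apply is_lim_seq_minus'; apply is_lim_seq_mult'; assumption.
      - apply (is_lim_seq_scal_l _ (sin th) (2 * (P * Q))).
        apply (is_lim_seq_scal_l _ 2 (P * Q)).
        apply is_lim_seq_mult'; assumption. }
    assert (L2 : is_lim_seq (fun n => cos th * (fresnel_cos (INR n) * fresnel_cos (INR n)
                    - fresnel_sin (INR n) * fresnel_sin (INR n))
                  - sin th * (2 * (fresnel_cos (INR n) * fresnel_sin (INR n))))
              (- (sin th * (PI / 4)))).
    { apply (conv (fun t => cos th * (fresnel_cos t * fresnel_cos t
                    - fresnel_sin t * fresnel_sin t)
                  - sin th * (2 * (fresnel_cos t * fresnel_sin t))) _ 3).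
      intros X HX. assert (H := fresnel_square th X).
      replace (cos th * (fresnel_cos X * fresnel_cos X - fresnel_sin X * fresnel_sin X) -
   sin th * (2 * (fresnel_cos X * fresnel_sin X)) - - (sin th * (PI / 4)))
        with (RInt (fresnel_kernel th X) 0 1 : R) by (req; lra).
      apply fresnel_kernel_small; assumption. }
    assert (E := is_lim_seq_unique _ _ L1). rewrite (is_lim_seq_unique _ _ L2) in E.
    injection E; lra. }
  assert (K0 := key 0). rewrite cos_0, sin_0 in K0.
  assert (K1 := key (PI / 2)). rewrite cos_PI2, sin_PI2 in K1.
  assert (HPI := PI_RGT_0).
  assert (N : P ^ 2 + Q ^ 2 = PI / 4).
  { assert (0 <= P ^ 2) by apply pow2_ge_0. assert (0 <= Q ^ 2) by apply pow2_ge_0.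
    assert (((P ^ 2 + Q ^ 2) - PI / 4) * ((P ^ 2 + Q ^ 2) + PI / 4) = 0).
    { replace (((P ^ 2 + Q ^ 2) - PI / 4) * ((P ^ 2 + Q ^ 2) + PI / 4))
        with ((P * P - Q * Q) ^ 2 + (2 * (P * Q)) ^ 2 - (PI / 4) ^ 2) by ring.
      replace (2 * (P * Q)) with (PI / 4) by lra.
      replace (P * P - Q * Q) with 0 by lra. ring. }
    apply Rmult_integral in H1; lra. }
  set (r := sqrt PI / 2).
  assert (Hs : sqrt PI * sqrt PI = PI) by (apply sqrt_sqrt; lra).
  assert (Hr : 0 < r) by (assert (0 < sqrt PI) by (apply sqrt_lt_R0; lra); unfold r; lra).
  assert (Hrr : r ^ 2 = PI / 4).
  { unfold r. replace ((sqrt PI / 2) ^ 2) with (sqrt PI * sqrt PI / 4) by field. lra. }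
  assert (U : exists phi, P / r = cos phi /\ Q / r = sin phi).
  { assert (W : (P / r)² + (Q / r)² = 1).
    { unfold Rsqr. replace (P / r * (P / r) + Q / r * (Q / r))
        with ((P ^ 2 + Q ^ 2) / r ^ 2) by (field; lra). rewrite N, Hrr. field; lra. }
    assert (B : -1 <= P / r <= 1).
    { assert (0 <= (Q / r)²) by apply Rle_0_sqr.
      apply Rabs_le_between. rewrite <- (Rabs_pos_eq 1) by lra.
      apply Rsqr_le_abs_0. unfold Rsqr at 2. lra. }
    destruct (Rle_lt_dec 0 (Q / r)) as [HQ0|HQ0].
    - exists (acos (P / r)). rewrite cos_acos, sin_acos by lra. split; [reflexivity|].
      replace (1 - (P / r)²) with ((Q / r)²) by lra. rewrite sqrt_Rsqr; lra.
    - exists (- acos (P / r)). rewrite cos_neg, sin_neg, cos_acos, sin_acos by lra.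
      split; [reflexivity|].
      replace (1 - (P / r)²) with ((Q / r)²) by lra.
      rewrite sqrt_Rsqr_abs, Rabs_left by lra. ring. }
  destruct U as [phi [U1 U2]]. exists phi. intros X HX.
  rewrite <- U1, <- U2. fold r.
  replace (r * (P / r)) with P by (field; lra).
  replace (r * (Q / r)) with Q by (field; lra). auto.
Qed.

(** * Bessel's inequality and pointwise convergence of Fourier series *)

Lemma sin_Z_PI (k : Z) : sin (IZR k * PI) = 0.
Proof. apply sin_eq_0_1; now exists k. Qed.

Lemma RInt_cos_lin (w a b : R) :
  w <> 0 -> RInt (fun t => cos (w * t)) a b = (sin (w * b) - sin (w * a)) / w.
Proof.
  intros Hw. rewrite (RInt_FTC (fun t => sin (w * t) / w)).
  - req; field; assumption.
  - intros; auto_derive; [trivial|field; assumption].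
  - intros; cont.
Qed.

Lemma RInt_cos_Z (k : Z) :
  k <> 0%Z -> RInt (fun t => cos (IZR k * t)) (- PI) PI = 0.
Proof.
  intros Hk. rewrite RInt_cos_lin by (now apply not_0_IZR).
  replace (IZR k * - PI) with (IZR (- k) * PI) by (rewrite opp_IZR; ring).
  rewrite !sin_Z_PI. req; unfold Rdiv; ring.
Qed.

(** The inner product of [p + i q] with [exp(i nu t)] over one period, up to
    its imaginary part: as a real inner product on pairs of functions it makes
    the pairs [(cos (nu t), sin (nu t))], with [nu] in [Z], orthonormal. *)
Definition coef (p q : R -> R) (nu : Z) : R :=
  / (2 * PI) * RInt (fun t => p t * cos (IZR nu * t) + q t * sin (IZR nu * t)) (- PI) PI.

Definition energy (p q : R -> R) : R :=
  / (2 * PI) * RInt (fun t => p t ^ 2 + q t ^ 2) (- PI) PI.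

Definition cont_period (p : R -> R) : Prop :=
  forall t, - PI <= t <= PI -> continuous p t.

Lemma ex_RInt_period (p : R -> R) : cont_period p -> ex_RInt p (- PI) PI.
Proof.
  intros H; assert (P := PI_RGT_0); apply @ex_RInt_continuous; intros z.
  rewrite Rmin_left, Rmax_right by lra; apply H.
Qed.

Ltac exper := apply ex_RInt_period; intros t Ht; cont; auto.

(** The residual after one projection keeps all the other coefficients, which
    lets Bessel's inequality be proved one basis vector at a time. *)
Lemma projection_step (p q : R -> R) (nu : Z) :
  cont_period p -> cont_period q ->
  let a := coef p q nu in
  let p' := fun t => p t - a * cos (IZR nu * t) in
  let q' := fun t => q t - a * sin (IZR nu * t) in
  cont_period p' /\ cont_period q' /\
  energy p' q' = energy p q - a ^ 2 /\
  forall mu, mu <> nu -> coef p' q' mu = coef p q mu.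
Proof.
  intros Hp Hq a p' q'. assert (P := PI_RGT_0).
  split; [intros t Ht; unfold p'; cont; auto|].
  split; [intros t Ht; unfold q'; cont; auto|]. split.
  - unfold energy, p', q'.
    rewrite (RInt_eq _ (fun t => (p t ^ 2 + q t ^ 2) +
       ((- 2 * a) * (p t * cos (IZR nu * t) + q t * sin (IZR nu * t)) + a ^ 2))).
    2:{ intros t. assert (T := sin2_cos2 (IZR nu * t)). unfold Rsqr in T.
        replace (a ^ 2) with (a ^ 2 * (sin (IZR nu * t) * sin (IZR nu * t)
                               + cos (IZR nu * t) * cos (IZR nu * t)))
          by (rewrite T; ring). ring. }
    rewrite !RInt_add, RInt_mul, RInt_cst by exper.
    replace (RInt (fun t => p t * cos (IZR nu * t) + q t * sin (IZR nu * t)) (- PI) PI : R)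
      with (2 * PI * a) by (unfold a, coef; req; field; lra).
    field; lra.
  - intros mu Hmu. unfold coef, p', q'.
    rewrite (RInt_eq _ (fun t => (p t * cos (IZR mu * t) + q t * sin (IZR mu * t)) +
       (- a) * cos (IZR (nu - mu) * t))).
    2:{ intros t. rewrite minus_IZR.
        replace ((IZR nu - IZR mu) * t) with (IZR nu * t - IZR mu * t) by ring.
        rewrite cos_minus. ring. }
    rewrite RInt_add, RInt_mul, RInt_cos_Z by (try exper; lia). f_equal. req. ring.
Qed.

Lemma bessel (p q : R -> R) (lo hi : Z) :
  cont_period p -> cont_period q ->
  sumZ (fun nu => coef p q nu ^ 2) lo hi <= energy p q.
Proof.
  intros Hp Hq.
  assert (pos : forall p q, cont_period p -> cont_period q -> 0 <= energy p q).
  { clear; intros p q Hp Hq. assert (P := PI_RGT_0). apply Rmult_le_pos.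
    - left; apply Rinv_0_lt_compat; lra.
    - apply RInt_ge_0; [lra|exper|]. intros.
      assert (0 <= p x ^ 2) by apply pow2_ge_0.
      assert (0 <= q x ^ 2) by apply pow2_ge_0. lra. }
  assert (I : forall hi, (lo <= hi)%Z -> exists p' q',
    cont_period p' /\ cont_period q' /\
    energy p' q' = energy p q - sumZ (fun nu => coef p q nu ^ 2) lo hi /\
    forall mu, (hi <= mu)%Z -> coef p' q' mu = coef p q mu).
  { apply Z_ge_ind.
    - exists p, q; rewrite sumZ_nil by lia. repeat split; auto; lra.
    - intros nu Hnu (p' & q' & Hp' & Hq' & HE & Hc).
      destruct (projection_step p' q' nu Hp' Hq') as (Hp2 & Hq2 & HE2 & Hc2).
      do 2 eexists; split; [exact Hp2|]; split; [exact Hq2|]; split.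
      + rewrite HE2, HE, sumZ_S, Hc by lia. ring.
      + intros mu Hmu; rewrite Hc2 by lia; apply Hc; lia. }
  destruct (Z_le_dec lo hi) as [L|L].
  - destruct (I hi L) as (p' & q' & Hp' & Hq' & HE & _).
    assert (0 <= energy p' q') by auto. lra.
  - rewrite sumZ_nil by lia. auto.
Qed.

Lemma riemann_lebesgue (p q : R -> R) :
  cont_period p -> cont_period q ->
  is_lim_seq (fun n => coef p q (Z.of_nat n)) 0.
Proof.
  intros Hp Hq.
  assert (S : ex_series (fun n => coef p q (Z.of_nat n) ^ 2)).
  { apply ex_finite_lim_seq_incr with (M := energy p q).
    - intros n. rewrite sum_Sn. unfold plus; simpl.
      assert (0 <= coef p q (Z.of_nat (S n)) ^ 2) by apply pow2_ge_0.
      simpl in *; lra.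
    - intros n. eapply Rle_trans; [|apply (bessel p q 0 (Z.of_nat (S n)) Hp Hq)].
      right. rewrite <- rsum_sum_n. unfold sumZ.
      replace (Z.to_nat (Z.of_nat (S n) - 0)) with (S n) by lia. reflexivity. }
  assert (L := ex_series_lim_0 _ S).
  apply is_lim_seq_spec; apply is_lim_seq_spec in L. intros eps.
  assert (He := cond_pos eps).
  assert (He2 : 0 < eps ^ 2) by (apply pow_lt; assumption).
  destruct (L (mkposreal _ He2)) as [N HN]. exists N. intros n Hn.
  specialize (HN n Hn). simpl in HN.
  rewrite Rminus_0_r in *.
  rewrite <- (Rabs_pos_eq eps) by lra. apply Rsqr_lt_abs_0.
  unfold Rsqr. rewrite Rabs_pos_eq in HN; [lra|].
  assert (0 <= coef p q (Z.of_nat n) ^ 2) by apply pow2_ge_0. simpl in *; lra.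
Qed.

Definition dirichlet (N : nat) (x : R) : R :=
  sumZ (fun nu => cos (IZR nu * x)) (- Z.of_nat N) (Z.of_nat N + 1).

Lemma dirichlet_closed_form (N : nat) (x : R) :
  sin (x / 2) * dirichlet N x = sin (x / 2 + INR N * x).
Proof.
  induction N as [|N IH].
  - unfold dirichlet, sumZ; simpl. rewrite !Rmult_0_l, cos_0, Rplus_0_r. ring.
  - assert (E : dirichlet (S N) x = dirichlet N x + 2 * cos (INR (S N) * x)).
    { unfold dirichlet. rewrite sumZ_S by lia.
      rewrite (sumZ_Chasles _ _ (- Z.of_nat N)) by lia.
      replace (- Z.of_nat N)%Z with (- Z.of_nat (S N) + 1)%Z at 1 by lia.
      rewrite sumZ_S, sumZ_nil by lia.
      replace (Z.of_nat N + 1)%Z with (Z.of_nat (S N)) by lia.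
      rewrite opp_IZR, <- INR_IZR_INZ.
      replace (- INR (S N) * x) with (- (INR (S N) * x)) by ring. rewrite cos_neg. ring. }
    rewrite E, Rmult_plus_distr_l, IH.
    replace (x / 2 + INR N * x) with (INR (S N) * x - x / 2)
      by (rewrite S_INR; field).
    replace (x / 2 + INR (S N) * x) with (INR (S N) * x + x / 2) by ring.
    rewrite sin_plus, sin_minus. ring.
Qed.

Lemma dirichlet_cont (N : nat) (x : R) : continuous (dirichlet N) x.
Proof.
  unfold dirichlet, sumZ. generalize (Z.to_nat (Z.of_nat N + 1 - - Z.of_nat N)) as M.
  induction M as [|M IH]; simpl; cont.
Qed.

Lemma dirichlet_mass (N : nat) : RInt (dirichlet N) (- PI) PI = 2 * PI.
Proof.
  assert (E : forall k : Z, ex_RInt (fun x => cos (IZR k * x)) (- PI) PI)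
    by (intros; exint).
  unfold dirichlet.
  rewrite (proj2 (sumZ_RInt (fun k x => cos (IZR k * x)) _ _ (- Z.of_nat N)
                    (Z.of_nat N + 1) ltac:(lia) E)).
  rewrite (sumZ_Chasles _ _ 0), (sumZ_Chasles _ 0 1) by lia.
  replace (sumZ _ (- Z.of_nat N) 0) with 0.
  2:{ symmetry. rewrite (sumZ_ext _ (fun _ => 0 * 0)).
      - rewrite sumZ_scal; ring.
      - intros v Hv. rewrite RInt_cos_Z by lia. ring. }
  replace (sumZ _ 1 (Z.of_nat N + 1)) with 0.
  2:{ symmetry. rewrite (sumZ_ext _ (fun _ => 0 * 0)).
      - rewrite sumZ_scal; ring.
      - intros v Hv. rewrite RInt_cos_Z by lia. ring. }
  unfold sumZ; simpl.
  rewrite (RInt_eq _ (fun _ => 1)) by (intros; rewrite Rmult_0_l; apply cos_0).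
  rewrite RInt_cst. ring.
Qed.

(** Quotients of two slopes replace quotients of functions that vanish at [0],
    without a singularity there. *)
Definition slope (f : R -> R) (d x : R) : R :=
  if Req_EM_T x 0 then d else (f x - f 0) / x.

Lemma slope_cont (f : R -> R) (d : R) :
  (forall x, continuous f x) -> is_derive f 0 d ->
  forall x, continuous (slope f d) x.
Proof.
  intros Cf Df x. destruct (Req_dec x 0) as [->|Hx].
  - apply is_derive_Reals in Df.
    apply filterlim_locally. intros eps.
    destruct (Df eps (cond_pos eps)) as [delta Hd].
    exists delta. intros y Hy. unfold slope.
    destruct (Req_EM_T 0 0) as [_|]; [|lra].
    destruct (Req_EM_T y 0) as [|Hy0]; [apply ball_center|].
    assert (Hd' := Hd y Hy0). rewrite Rplus_0_l in Hd'.
    unfold ball in *; simpl in *; unfold AbsRing_ball, abs, minus, plus, opp in *;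
      simpl in *.
    apply Hd'. rewrite Ropp_0, Rplus_0_r in Hy. exact Hy.
  - apply (continuous_ext_loc _ (fun y => (f y - f 0) / y)).
    2:{ cont. }
    assert (Hp : 0 < Rabs x) by (apply Rabs_pos_lt; assumption).
    exists (mkposreal _ Hp). intros y Hy. unfold slope.
    destruct (Req_EM_T y 0) as [E|]; [|reflexivity].
    exfalso. unfold ball in Hy; simpl in Hy; unfold AbsRing_ball, abs, minus, plus, opp in Hy;
      simpl in Hy. rewrite E, Rplus_0_l, Rabs_Ropp in Hy. lra.
Qed.

(** Since [sin (x / 2) D_N(x) = sin ((N + 1/2) x)], dividing [F x - F 0] by
    [sin (x / 2)] turns the error into a Fourier coefficient of a continuous
    function. *)
Lemma dirichlet_limit (F : R -> R) (d : R) :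
  (forall x, continuous F x) -> is_derive F 0 d ->
  is_lim_seq (fun N => / (2 * PI) * RInt (fun x => F x * dirichlet N x) (- PI) PI) (F 0).
Proof.
  intros CF DF. assert (P := PI_RGT_0).
  set (v := slope (fun x => sin (x / 2)) (1 / 2)).
  assert (Cv : forall x, continuous v x).
  { apply slope_cont; [intros; cont; lra|]. auto_derive; [trivial|].
    replace (0 * / 2) with 0 by lra. rewrite cos_0. lra. }
  assert (Hv : forall x, - PI <= x <= PI -> v x <> 0 /\ x * v x = sin (x / 2)).
  { intros x Hx. unfold v, slope. replace (0 / 2) with 0 by lra. rewrite sin_0.
    destruct (Req_EM_T x 0) as [->|H0].
    - split; [lra|]. replace (0 / 2) with 0 by lra. rewrite sin_0; ring.
    - split; [|field; assumption]. intros E.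
      assert (sin (x / 2) = 0).
      { apply (Rmult_eq_reg_r (/ x)); [|now apply Rinv_neq_0_compat].
        unfold Rdiv in E. lra. }
      destruct (Rlt_le_dec 0 x).
      + assert (0 < sin (x / 2)) by (apply sin_gt_0; lra). lra.
      + assert (0 < sin (- (x / 2))) by (apply sin_gt_0; lra).
        rewrite sin_neg in H1. lra. }
  set (g := fun x => slope F d x * / v x).
  assert (Cg : forall x, - PI <= x <= PI -> continuous g x).
  { intros x Hx. unfold g. cont; [|apply Hv; assumption].
    apply slope_cont; assumption. }
  assert (Hg : forall x, - PI <= x <= PI -> F x - F 0 = g x * sin (x / 2)).
  { intros x Hx. destruct (Hv x Hx) as [V1 V2]. rewrite <- V2. unfold g.
    unfold slope. destruct (Req_EM_T x 0) as [->|H0]; field; auto. }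
  assert (L := riemann_lebesgue (fun x => g x * sin (x / 2)) (fun x => g x * cos (x / 2))
                 ltac:(intros t Ht; cont; auto) ltac:(intros t Ht; cont; auto)).
  apply (is_lim_seq_ext (fun N => F 0 + coef (fun x => g x * sin (x / 2))
           (fun x => g x * cos (x / 2)) (Z.of_nat N))).
  2:{ replace (Finite (F 0)) with (Finite (F 0 + 0)) by (f_equal; ring).
      apply is_lim_seq_plus'; [apply is_lim_seq_const|exact L]. }
  intros N. unfold coef. assert (CD := dirichlet_cont N).
  replace (F 0) with (/ (2 * PI) * (F 0 * RInt (dirichlet N) (- PI) PI)) at 1
    by (rewrite dirichlet_mass; field; lra).
  rewrite <- Rmult_plus_distr_l. f_equal.
  rewrite <- RInt_mul by exper. rewrite <- RInt_add by exper.
  apply RInt_ext. intros x. rewrite Rmin_left, Rmax_right by lra. intros Hx.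
  replace (F x) with (F 0 + (F x - F 0)) by ring.
  rewrite (Hg x) by lra.
  transitivity (F 0 * dirichlet N x + g x * (sin (x / 2) * dirichlet N x)); [|req; ring].
  rewrite dirichlet_closed_form, sin_plus, <- INR_IZR_INZ. req. ring.
Qed.

(** * The Fourier coefficients of [exp(i n h)] *)

Record phase (h h1 h2 : R -> R) (k : Z) : Prop := {
  phase_d1 : forall t, is_derive h t (h1 t);
  phase_d2 : forall t, is_derive h1 t (h2 t);
  phase_c2 : forall t, continuous h2 t;
  phase_odd : forall t, h (- t) = - h t;
  phase_per : forall t, h (t + 2 * PI) = h t + 2 * IZR k * PI;
  phase_pos : forall t, 0 < t < PI -> 0 < h2 t
}.

Lemma phase_c0 h h1 h2 k : phase h h1 h2 k -> forall t, continuous h t.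
Proof. intros Ph t; exact (cont_derive _ _ _ (phase_d1 _ _ _ _ Ph t)). Qed.

Lemma phase_c1 h h1 h2 k : phase h h1 h2 k -> forall t, continuous h1 t.
Proof. intros Ph t; exact (cont_derive _ _ _ (phase_d2 _ _ _ _ Ph t)). Qed.

Lemma cos_Z_period (x : R) (m : Z) : cos (x + 2 * PI * IZR m) = cos x.
Proof.
  replace (2 * PI * IZR m) with (2 * (IZR m * PI)) by ring.
  rewrite cos_plus, cos_2a_sin, sin_2a, sin_Z_PI. ring.
Qed.

Lemma sin_Z_period (x : R) (m : Z) : sin (x + 2 * PI * IZR m) = sin x.
Proof.
  replace (2 * PI * IZR m) with (2 * (IZR m * PI)) by ring.
  rewrite sin_plus, cos_2a_sin, sin_2a, sin_Z_PI. ring.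
Qed.

Lemma cos_minus_PI2 (x : R) : cos (x - PI / 2) = sin x.
Proof. rewrite cos_minus, cos_PI2, sin_PI2. ring. Qed.

(** As [h] is odd, the coefficient is real and half a period suffices. *)
Definition fc (h : R -> R) (n : nat) (nu : Z) : R :=
  / PI * RInt (fun t => cos (INR n * h t - IZR nu * t)) 0 PI.

Lemma phase_reflect h h1 h2 k n nu t :
  phase h h1 h2 k ->
  INR n * h (2 * PI - t) - IZR nu * (2 * PI - t)
  = - (INR n * h t - IZR nu * t) + 2 * PI * IZR (Z.of_nat n * k - nu).
Proof.
  intros Ph. replace (2 * PI - t) with (- t + 2 * PI) by ring.
  rewrite (phase_per _ _ _ _ Ph), (phase_odd _ _ _ _ Ph).
  rewrite minus_IZR, mult_IZR, <- INR_IZR_INZ. ring.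
Qed.

(** The reflection [t -> 2 PI - t] changes the sign of the phase modulo [2 PI]:
    the real part of the integral doubles and the imaginary part vanishes. *)
Lemma Fourier_coeff_fc h h1 h2 k n nu :
  phase h h1 h2 k ->
  Fourier_coeff (fun t => expi (INR n * h t)) nu = RtoC (fc h n nu).
Proof.
  intros Ph. assert (Ch := phase_c0 _ _ _ _ Ph). assert (P := PI_RGT_0).
  assert (Ic : RInt (fun t => cos (INR n * h t - IZR nu * t)) 0 (2 * PI)
               = 2 * RInt (fun t => cos (INR n * h t - IZR nu * t)) 0 PI).
  { rewrite (RInt_split _ 0 PI) by exint.
    assert (E := RInt_reflect (fun t => cos (INR n * h t - IZR nu * t)) (2 * PI) 0 PI
                   ltac:(intros; cont)).
    replace (2 * PI - PI) with PI in E by ring. rewrite Rminus_0_r in E.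
    rewrite <- E.
    rewrite (RInt_eq (fun y => cos (INR n * h (2 * PI - y) - IZR nu * (2 * PI - y)))
               (fun t => cos (INR n * h t - IZR nu * t))).
    - req; ring.
    - intros t. rewrite (phase_reflect _ _ _ _ _ _ _ Ph), cos_Z_period. apply cos_neg. }
  assert (Is : RInt (fun t => sin (INR n * h t - IZR nu * t)) 0 (2 * PI) = 0).
  { rewrite (RInt_split _ 0 PI) by exint.
    assert (E := RInt_reflect (fun t => sin (INR n * h t - IZR nu * t)) (2 * PI) 0 PI
                   ltac:(intros; cont)).
    replace (2 * PI - PI) with PI in E by ring. rewrite Rminus_0_r in E.
    rewrite <- E.
    rewrite (RInt_eq (fun y => sin (INR n * h (2 * PI - y) - IZR nu * (2 * PI - y)))
               (fun t => -1 * sin (INR n * h t - IZR nu * t))).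
    - rewrite RInt_mul by exint. req; ring.
    - intros t. rewrite (phase_reflect _ _ _ _ _ _ _ Ph), sin_Z_period, sin_neg. ring. }
  unfold Fourier_coeff.
  assert (M : forall t, (expi (INR n * h t) * expi (- (IZR nu * t)))%C
              = (cos (INR n * h t - IZR nu * t), sin (INR n * h t - IZR nu * t))).
  { intros t. unfold expi, Cmult; simpl. rewrite cos_neg, sin_neg, cos_minus, sin_minus.
    f_equal; ring. }
  replace (RInt (V := C_R_CompleteNormedModule)
             (fun t : R => (expi (INR n * h t) * expi (- (IZR nu * t)))%C) 0 (2 * PI))
    with ((2 * RInt (fun t => cos (INR n * h t - IZR nu * t)) 0 PI, 0) : C).
  - unfold RtoC, Cmult, fc; simpl. f_equal; field; lra.
  - symmetry. apply (@is_RInt_unique C_R_CompleteNormedModule).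
    assert (Jc : ex_RInt (fun t => cos (INR n * h t - IZR nu * t)) 0 (2 * PI)) by exint.
    assert (Js : ex_RInt (fun t => sin (INR n * h t - IZR nu * t)) 0 (2 * PI)) by exint.
    apply (@RInt_correct R_CompleteNormedModule) in Jc. rewrite Ic in Jc.
    apply (@RInt_correct R_CompleteNormedModule) in Js. rewrite Is in Js.
    apply (is_RInt_fct_extend_pair (U := R_NormedModule) (V := R_NormedModule)).
    + eapply is_RInt_ext; [|exact Jc]. intros t _; now rewrite M.
    + eapply is_RInt_ext; [|exact Js]. intros t _; now rewrite M.
Qed.

(** Over a symmetric interval the sine of the phase integrates to zero, so a
    constant phase shift [c] comes out as the factor [cos c]. *)
Lemma fc_full_period h h1 h2 k n nu c :
  phase h h1 h2 k ->
  fc h n nu * cos c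
  = / (2 * PI) * RInt (fun t => cos (INR n * h t - IZR nu * t + c)) (- PI) PI.
Proof.
  intros Ph. assert (Ch := phase_c0 _ _ _ _ Ph). assert (P := PI_RGT_0).
  rewrite (RInt_eq _ (fun t => cos c * cos (INR n * h t - IZR nu * t)
                               - sin c * sin (INR n * h t - IZR nu * t)))
    by (intros; rewrite cos_plus; req; ring).
  rewrite RInt_sub, !RInt_mul by exint.
  rewrite (RInt_even (fun t => cos (INR n * h t - IZR nu * t))).
  2: intros; cont.
  2:{ intros t. rewrite (phase_odd _ _ _ _ Ph), <- cos_neg. f_equal. ring. }
  rewrite (RInt_odd (fun t => sin (INR n * h t - IZR nu * t))).
  2: intros; cont.
  2:{ intros t. rewrite (phase_odd _ _ _ _ Ph), <- sin_neg. f_equal. ring. }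
  unfold fc. field. lra.
Qed.

Lemma fc_coef h h1 h2 k n nu :
  phase h h1 h2 k ->
  fc h n nu = coef (fun t => cos (INR n * h t)) (fun t => sin (INR n * h t)) nu.
Proof.
  intros Ph. rewrite <- (Rmult_1_r (fc h n nu)), <- cos_0.
  rewrite (fc_full_period _ _ _ _ _ _ _ Ph). unfold coef. f_equal.
  apply RInt_eq; intros t. rewrite Rplus_0_r. apply cos_minus.
Qed.

Lemma fc_bessel h h1 h2 k n p q :
  phase h h1 h2 k -> sumZ (fun nu => fc h n nu ^ 2) p q <= 1.
Proof.
  intros Ph. assert (Ch := phase_c0 _ _ _ _ Ph). assert (P := PI_RGT_0).
  rewrite (sumZ_ext _ (fun nu => coef (fun t => cos (INR n * h t))
                                   (fun t => sin (INR n * h t)) nu ^ 2))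
    by (intros; now rewrite (fc_coef _ _ _ _ _ _ Ph)).
  eapply Rle_trans; [apply bessel; intros t _; cont|].
  unfold energy. rewrite (RInt_eq _ (fun _ => 1)).
  - rewrite RInt_cst. right. field. lra.
  - intros t. assert (T := sin2_cos2 (INR n * h t)). unfold Rsqr in T. lra.
Qed.

Lemma sumZ_sin_sym (N : nat) (x : R) :
  sumZ (fun nu => sin (IZR nu * x)) (- Z.of_nat N) (Z.of_nat N + 1) = 0.
Proof.
  induction N as [|N IH].
  - unfold sumZ; simpl. rewrite Rmult_0_l, sin_0. ring.
  - rewrite sumZ_S by lia. rewrite (sumZ_Chasles _ _ (- Z.of_nat N)) by lia.
    replace (- Z.of_nat N)%Z with (- Z.of_nat (S N) + 1)%Z at 1 by lia.
    rewrite sumZ_S, sumZ_nil by lia.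
    replace (Z.of_nat N + 1)%Z with (Z.of_nat (S N)) in IH by lia.
    rewrite IH, opp_IZR.
    replace (- IZR (Z.of_nat (S N)) * x) with (- (IZR (Z.of_nat (S N)) * x)) by ring.
    rewrite sin_neg. ring.
Qed.

(** Translating by [t0] makes the partial sum at [t0] a Dirichlet integral at
    [0]. Taking [c = 0] and [c = - PI / 2] yields the real and the imaginary
    part of the Fourier series. *)
Lemma fc_partial_sums h h1 h2 k n t0 c :
  phase h h1 h2 k ->
  is_lim_seq (fun N => sumZ (fun nu => fc h n nu * cos (IZR nu * t0 + c))
                         (- Z.of_nat N) (Z.of_nat N + 1))
    (cos (INR n * h t0 + c)).
Proof.
  intros Ph. assert (Ch := phase_c0 _ _ _ _ Ph). assert (P := PI_RGT_0).
  set (F := fun x => cos (INR n * h (t0 + x) + c)).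
  assert (CF : forall x, continuous F x) by (intros; unfold F; cont).
  assert (DF : is_derive F 0 (- (INR n * h1 t0) * sin (INR n * h t0 + c))).
  { unfold F. assert (D := phase_d1 _ _ _ _ Ph t0).
    auto_derive; rewrite Rplus_0_r.
    - eexists; exact D.
    - replace (Derive (fun x => h x) t0) with (h1 t0)
        by (symmetry; apply is_derive_unique; exact D). ring. }
  assert (L := dirichlet_limit F _ CF DF).
  replace (cos (INR n * h t0 + c)) with (F 0) by (unfold F; now rewrite Rplus_0_r).
  eapply is_lim_seq_ext; [|exact L]. intros N. simpl.
  rewrite (sumZ_ext _ (fun nu => / (2 * PI) *
             RInt (fun x => cos (INR n * h (t0 + x) - IZR nu * x + c)) (- PI) PI)).
  2:{ intros nu _. rewrite (fc_full_period _ _ _ _ _ _ _ Ph). f_equal.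
      set (f := fun t => cos (INR n * h t - IZR nu * t + (IZR nu * t0 + c))).
      assert (Cf : forall x, continuous f x) by (intros; unfold f; cont).
      assert (Pf : forall x, f (x + 2 * PI) = f x).
      { intros x. unfold f. rewrite (phase_per _ _ _ _ Ph).
        rewrite <- (cos_Z_period (INR n * h x - _ + _) (Z.of_nat n * k - nu)). f_equal.
        rewrite minus_IZR, mult_IZR, <- INR_IZR_INZ. ring. }
      assert (E := RInt_period f (2 * PI) t0 (- PI) Cf Pf).
      replace (- PI + 2 * PI) with PI in E by ring. rewrite <- E.
      assert (E2 := RInt_lin f 1 t0 (- PI) PI Cf).
      replace (- PI + t0 + 2 * PI) with (1 * PI + t0) by ring.
      replace (- PI + t0) with (1 * - PI + t0) by ring. rewrite <- E2.
      rewrite (RInt_eq (fun y => f (1 * y + t0))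
                 (fun x => cos (INR n * h (t0 + x) - IZR nu * x + c))).
      - req; ring.
      - intros x; unfold f; rewrite Rmult_1_l, (Rplus_comm x t0); f_equal; ring. }
  rewrite sumZ_scal. f_equal.
  assert (E : forall nu : Z, ex_RInt (fun x => cos (INR n * h (t0 + x) - IZR nu * x + c)) (- PI) PI)
    by (intros; exint).
  rewrite <- (proj2 (sumZ_RInt _ (- PI) PI (- Z.of_nat N) (Z.of_nat N + 1) ltac:(lia) E)).
  apply RInt_eq. intros x. unfold dirichlet.
  rewrite (sumZ_ext (fun v => cos (INR n * h (t0 + x) - IZR v * x + c))
             (fun nu => F x * cos (IZR nu * x)
                        + sin (INR n * h (t0 + x) + c) * sin (IZR nu * x))).
  - rewrite sumZ_plus, !sumZ_scal, sumZ_sin_sym. req; ring.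
  - intros nu _. unfold F. rewrite <- cos_minus. f_equal. ring.
Qed.

(** * Summability over Z *)

Definition nonneg_half (a : Z -> R) (n : nat) : R := a (Z.of_nat n).
Definition neg_half (a : Z -> R) (n : nat) : R := a (- Z.of_nat (S n))%Z.

Lemma sumZ_halves (a : Z -> R) (M N : nat) :
  sumZ a (- Z.of_nat M) (Z.of_nat N)
  = rsum (nonneg_half a) N + rsum (neg_half a) M.
Proof.
  rewrite (sumZ_Chasles a _ 0) by lia. rewrite Rplus_comm. f_equal.
  - unfold sumZ. replace (Z.to_nat (Z.of_nat N - 0)) with N by lia. reflexivity.
  - induction M as [|M IH]; [apply sumZ_nil; lia|].
    rewrite (sumZ_Chasles a _ (- Z.of_nat M)) by lia. simpl rsum. rewrite <- IH.
    replace (- Z.of_nat M)%Z with (- Z.of_nat (S M) + 1)%Z at 1 by lia.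
    rewrite sumZ_S, sumZ_nil by lia. unfold neg_half. ring.
Qed.

Lemma rsum_lim (b : nat -> R) : ex_series b -> is_lim_seq (rsum b) (Series b).
Proof.
  intros H. apply is_lim_seq_incr_1.
  apply (is_lim_seq_ext (sum_n b)); [intros; symmetry; apply rsum_sum_n|].
  exact (Series_correct b H).
Qed.

Lemma sumZ_lim (a : Z -> R) :
  ex_series (nonneg_half a) -> ex_series (neg_half a) ->
  is_lim_seq (fun N => sumZ a (- Z.of_nat N) (Z.of_nat N + 1)) (Zseries a).
Proof.
  intros H1 H2.
  apply (is_lim_seq_ext (fun N => rsum (nonneg_half a) (S N) + rsum (neg_half a) N)).
  - intros N. rewrite <- sumZ_halves. f_equal. lia.
  - apply is_lim_seq_plus'; [|now apply rsum_lim].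
    apply (is_lim_seq_incr_1 (rsum (nonneg_half a))). now apply rsum_lim.
Qed.

Lemma Zseries_of_windows (a : Z -> R) (X : R) :
  (forall nu, 0 <= a nu) -> (forall p q, sumZ a p q <= X) ->
  ex_series (nonneg_half a) /\ ex_series (neg_half a) /\
  Zseries a <= X /\ forall p q, sumZ a p q <= Zseries a.
Proof.
  intros Ha HX.
  assert (H1 : ex_series (nonneg_half a)).
  { apply ex_finite_lim_seq_incr with (M := X).
    - intros n. rewrite sum_Sn. assert (H := Ha (Z.of_nat (S n))).
      change (sum_n (nonneg_half a) n <= sum_n (nonneg_half a) n + a (Z.of_nat (S n))). lra.
    - intros n. rewrite <- rsum_sum_n.
      eapply Rle_trans; [|apply (HX (- Z.of_nat 0)%Z (Z.of_nat (S n)))].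
      rewrite sumZ_halves. simpl. lra. }
  assert (H2 : ex_series (neg_half a)).
  { apply ex_finite_lim_seq_incr with (M := X).
    - intros n. rewrite sum_Sn. assert (H := Ha (- Z.of_nat (S (S n)))%Z).
      change (sum_n (neg_half a) n <= sum_n (neg_half a) n + a (- Z.of_nat (S (S n)))%Z). lra.
    - intros n. rewrite <- rsum_sum_n.
      eapply Rle_trans; [|apply (HX (- Z.of_nat (S n))%Z (Z.of_nat 0))].
      rewrite sumZ_halves. simpl. lra. }
  split; [exact H1|]. split; [exact H2|].
  assert (L := sumZ_lim a H1 H2). split.
  - apply (is_lim_seq_le _ (fun _ => X) (Zseries a) X (fun n => HX _ _) L).
    apply is_lim_seq_const.
  - intros p q.
    set (M := (Z.to_nat (Z.abs p) + Z.to_nat (Z.abs q))%nat).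
    apply Rle_trans with (sumZ a (- Z.of_nat M) (Z.of_nat M + 1)).
    + apply sumZ_incr; [assumption| |]; unfold M; lia.
    + apply (is_lim_seq_incr_compare
               (fun N => sumZ a (- Z.of_nat N) (Z.of_nat N + 1)) (Zseries a) L).
      intros N. apply sumZ_incr; [assumption| |]; lia.
Qed.

Lemma is_series_C (a : nat -> C) (x y : R) :
  is_series (fun n => fst (a n)) x -> is_series (fun n => snd (a n)) y ->
  is_series (V := C_R_NormedModule) a (x, y).
Proof.
  intros Hx Hy. unfold is_series in *.
  assert (E : forall n, sum_n (G := C_R_NormedModule) a n
              = (sum_n (fun n => fst (a n)) n, sum_n (fun n => snd (a n)) n)).
  { induction n as [|n IH].
    - rewrite !sum_O. destruct (a O); reflexivity.
    - rewrite !sum_Sn, IH. reflexivity. }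
  apply filterlim_locally. intros eps.
  assert (Fx := proj1 (filterlim_locally _ _) Hx eps).
  assert (Fy := proj1 (filterlim_locally _ _) Hy eps).
  generalize (filter_and _ _ Fx Fy). apply filter_imp.
  intros n [Bx By]. rewrite E. split; assumption.
Qed.

Lemma ex_series_dominated (u v : nat -> R) :
  (forall n, Rabs (u n) <= v n) -> ex_series v -> ex_series u.
Proof. intros H. apply (@ex_series_le R_AbsRing R_CompleteNormedModule u v H). Qed.

Lemma fc_summable_Fourier h h1 h2 k n :
  phase h h1 h2 k ->
  ex_series (nonneg_half (fun nu => Rabs (fc h n nu))) ->
  ex_series (neg_half (fun nu => Rabs (fc h n nu))) ->
  has_abs_conv_Fourier_series (fun t => expi (INR n * h t)).
Proof.
  intros Ph S1 S2. set (a := fc h n) in *.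
  assert (FC : forall nu, Fourier_coeff (fun t => expi (INR n * h t)) nu = RtoC (a nu))
    by (intros; apply (Fourier_coeff_fc _ _ _ _ _ _ Ph)).
  assert (N : forall nu, Cmod (Fourier_coeff (fun t => expi (INR n * h t)) nu) = Rabs (a nu))
    by (intros; rewrite FC; apply Cmod_R).
  split.
  - destruct S1 as [l1 S1], S2 as [l2 S2]. exists (plus l1 l2), l1, l2.
    split; [|split; [|reflexivity]].
    + eapply is_series_ext; [|exact S1]. intros m; simpl. now rewrite N.
    + eapply is_series_ext; [|exact S2]. intros m; simpl. now rewrite N.
  - intros t.
    assert (half : forall c, let b := fun nu => a nu * cos (IZR nu * t + c) in
      ex_series (nonneg_half b) /\ ex_series (neg_half b) /\
      Series (nonneg_half b) + Series (neg_half b) = cos (INR n * h t + c)).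
    { intros c b.
      assert (Hb : forall nu, Rabs (b nu) <= Rabs (a nu)).
      { intros nu; unfold b; rewrite Rabs_mult.
        rewrite <- (Rmult_1_r (Rabs (a nu))) at 2.
        apply Rmult_le_compat_l; [apply Rabs_pos|apply Rabs_le, COS_bound]. }
      assert (B1 : ex_series (nonneg_half b))
        by exact (ex_series_dominated _ _ (fun m => Hb _) S1).
      assert (B2 : ex_series (neg_half b))
        by exact (ex_series_dominated _ _ (fun m => Hb _) S2).
      split; [exact B1|]. split; [exact B2|].
      assert (L := eq_trans (eq_sym (is_lim_seq_unique _ _ (sumZ_lim b B1 B2)))
                     (is_lim_seq_unique _ _ (fc_partial_sums _ _ _ _ n t c Ph))).
      injection L; intros E; exact E. }
    destruct (half 0) as (R1 & R2 & RS). destruct (half (- (PI / 2))) as (I1 & I2 & IS).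
    assert (V : forall nu, (Fourier_coeff (fun t => expi (INR n * h t)) nu * expi (IZR nu * t))%C
                = (a nu * cos (IZR nu * t + 0), a nu * cos (IZR nu * t + - (PI / 2)))).
    { intros nu. rewrite FC, Rplus_0_r.
      replace (IZR nu * t + - (PI / 2)) with (IZR nu * t - PI / 2) by ring.
      rewrite cos_minus_PI2. unfold expi, RtoC, Cmult; simpl. f_equal; ring. }
    do 2 eexists. split; [|split].
    + apply is_series_C.
      * eapply is_series_ext; [|apply Series_correct; exact R1].
        intros m; rewrite V; reflexivity.
      * eapply is_series_ext; [|apply Series_correct; exact I1].
        intros m; rewrite V; reflexivity.
    + apply is_series_C.
      * eapply is_series_ext; [|apply Series_correct; exact R2].
        intros m; rewrite V; reflexivity.
      * eapply is_series_ext; [|apply Series_correct; exact I2].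
        intros m; rewrite V; reflexivity.
    + unfold expi. rewrite Rplus_0_r in RS.
      replace (INR n * h t + - (PI / 2)) with (INR n * h t - PI / 2) in IS by ring.
      rewrite cos_minus_PI2 in IS. rewrite <- RS, <- IS. reflexivity.
Qed.

Lemma A_norm_fc h h1 h2 k n :
  phase h h1 h2 k ->
  A_norm (fun t => expi (INR n * h t)) = Zseries (fun nu => Rabs (fc h n nu)).
Proof.
  intros Ph. unfold A_norm, Zseries.
  f_equal; apply Series_ext; intros m;
    rewrite (Fourier_coeff_fc _ _ _ _ _ _ Ph); apply Cmod_R.
Qed.

(** * Coefficients away from the range of [n h'] *)

Lemma increment_ge (f df : R -> R) (x y m : R) :
  x <= y -> (forall t, x <= t <= y -> is_derive f t (df t)) ->
  (forall t, x <= t <= y -> m <= df t) -> m * (y - x) <= f y - f x.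
Proof.
  intros Hxy D H. destruct (MVT_gen f x y df) as [c [Hc E]].
  - intros t; rewrite Rmin_left, Rmax_right by lra; intros; apply D; lra.
  - intros t; rewrite Rmin_left, Rmax_right by lra; intros Ht.
    apply continuity_pt_filterlim, (cont_derive _ _ _ (D t Ht)).
  - rewrite Rmin_left, Rmax_right in Hc by lra. rewrite E.
    apply Rmult_le_compat_r; [lra|auto].
Qed.

Lemma increment_abs_le (f df : R -> R) (x y m : R) :
  (forall t, Rmin x y <= t <= Rmax x y -> is_derive f t (df t)) ->
  (forall t, Rmin x y <= t <= Rmax x y -> Rabs (df t) <= m) ->
  Rabs (f y - f x) <= m * Rabs (y - x).
Proof.
  intros D H. destruct (MVT_gen f x y df) as [c [Hc E]].
  - intros t Ht; apply D; lra.
  - intros t Ht. apply continuity_pt_filterlim, (cont_derive _ _ _ (D t Ht)).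
  - rewrite E, Rabs_mult. apply Rmult_le_compat_r; [apply Rabs_pos|auto].
Qed.

(** At the end points [0] and [PI] the sign passes to the limit. *)
Lemma phase_nonneg h h1 h2 k t : phase h h1 h2 k -> 0 <= t <= PI -> 0 <= h2 t.
Proof.
  intros Ph Ht. assert (P := PI_RGT_0).
  destruct (Rle_lt_dec 0 (h2 t)) as [H|H]; [exact H|exfalso].
  assert (C := proj1 (filterlim_locally _ _) (phase_c2 _ _ _ _ Ph t)).
  assert (He : 0 < - h2 t) by lra.
  destruct (C (mkposreal _ He)) as [d Hd]. assert (Hd0 := cond_pos d).
  assert (K : forall y, Rabs (y - t) < d -> h2 y < 0).
  { intros y Hy. assert (B := Hd y Hy). unfold ball in B; simpl in B.
    unfold AbsRing_ball, abs, minus, plus, opp in B; simpl in B.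
    apply Rabs_def2 in B. lra. }
  set (e := Rmin (d / 2) (PI / 2)).
  assert (0 < e <= d / 2 /\ e <= PI / 2).
  { unfold e; split; [split|]; [apply Rmin_pos; lra|apply Rmin_l|apply Rmin_r]. }
  destruct (Rle_lt_dec t (PI / 2)).
  - assert (h2 (t + e) < 0) by (apply K; rewrite Rabs_pos_eq; lra).
    destruct (Rlt_le_dec (t + e) PI).
    + assert (0 < h2 (t + e)) by (apply (phase_pos _ _ _ _ Ph); lra). lra.
    + assert (h2 (t + e / 2) < 0) by (apply K; rewrite Rabs_pos_eq; lra).
      assert (0 < h2 (t + e / 2)) by (apply (phase_pos _ _ _ _ Ph); lra). lra.
  - assert (h2 (t - e / 2) < 0) by (apply K; rewrite Rabs_left1; lra).
    assert (0 < h2 (t - e / 2)) by (apply (phase_pos _ _ _ _ Ph); lra). lra.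
Qed.

Lemma phase_h1_incr h h1 h2 k s t :
  phase h h1 h2 k -> 0 <= s -> s <= t -> t <= PI -> h1 s <= h1 t.
Proof.
  intros Ph H0 H1 H2. assert (0 * (t - s) <= h1 t - h1 s); [|lra].
  apply (increment_ge h1 h2); [lra|intros; apply (phase_d2 _ _ _ _ Ph)|].
  intros; apply (phase_nonneg _ _ _ _ _ Ph); lra.
Qed.

Lemma phase_at_0 h h1 h2 k : phase h h1 h2 k -> h 0 = 0.
Proof.
  intros Ph. assert (H := phase_odd _ _ _ _ Ph 0). rewrite Ropp_0 in H. lra.
Qed.

Lemma phase_at_PI h h1 h2 k : phase h h1 h2 k -> h PI = IZR k * PI.
Proof.
  intros Ph. assert (H := phase_odd _ _ _ _ Ph PI).
  assert (H2 := phase_per _ _ _ _ Ph (- PI)).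
  replace (- PI + 2 * PI) with PI in H2 by ring. lra.
Qed.

(** One integration by parts; the boundary terms vanish because [h 0 = 0] and
    [h PI] is a multiple of [PI]. *)
Lemma fc_nonstationary h h1 h2 k n nu d :
  phase h h1 h2 k -> 0 < d ->
  (forall t, 0 <= t <= PI -> d <= Rabs (INR n * h1 t - IZR nu)) ->
  Rabs (fc h n nu) <= INR n * ((h1 PI - h1 0) / PI) * / d ^ 2.
Proof.
  intros Ph Hd HD. assert (P := PI_RGT_0). assert (Hn := pos_INR n).
  assert (C0 := phase_c0 _ _ _ _ Ph). assert (C1 := phase_c1 _ _ _ _ Ph).
  assert (C2 := phase_c2 _ _ _ _ Ph).
  set (psi := fun t => INR n * h t - IZR nu * t).
  set (p1 := fun t => INR n * h1 t - IZR nu).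
  assert (seg : forall t, Rmin 0 PI <= t <= Rmax 0 PI -> 0 <= t <= PI)
    by (intros t; rewrite Rmin_left, Rmax_right by lra; tauto).
  assert (N : forall t, 0 <= t <= PI -> p1 t <> 0).
  { intros t Ht E. specialize (HD t Ht). fold (p1 t) in HD.
    rewrite E, Rabs_R0 in HD. lra. }
  assert (Dpsi : forall t, is_derive psi t (p1 t)).
  { intros t. unfold psi, p1. assert (D := phase_d1 _ _ _ _ Ph t). auto_derive.
    - eexists; exact D.
    - replace (Derive (fun x => h x) t) with (h1 t)
        by (symmetry; apply is_derive_unique; exact D). ring. }
  assert (Dp1 : forall t, is_derive p1 t (INR n * h2 t)).
  { intros t. unfold p1. assert (D := phase_d2 _ _ _ _ Ph t). auto_derive.
    - eexists; exact D.
    - replace (Derive (fun x => h1 x) t) with (h2 t)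
        by (symmetry; apply is_derive_unique; exact D). ring. }
  assert (Cpsi : forall t, continuous psi t) by (intros; unfold psi; cont).
  assert (Cp1 : forall t, continuous p1 t) by (intros; unfold p1; cont).
  assert (E1 : ex_RInt (fun t => sin (psi t) * (INR n * h2 t / p1 t ^ 2)) 0 PI).
  { apply @ex_RInt_continuous; intros z Hz; apply seg in Hz; cont.
    apply pow_nonzero; auto. }
  assert (E2 : ex_RInt (fun t => cos (psi t)) 0 PI) by exint.
  assert (I : RInt (fun t => cos (psi t) - sin (psi t) * (INR n * h2 t / p1 t ^ 2)) 0 PI
              = 0).
  { rewrite (RInt_FTC (fun t => sin (psi t) * / p1 t)).
    - unfold psi at 1 2. rewrite (phase_at_PI _ _ _ _ Ph), (phase_at_0 _ _ _ _ Ph).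
      replace (INR n * (IZR k * PI) - IZR nu * PI) with (IZR (Z.of_nat n * k - nu) * PI)
        by (rewrite minus_IZR, mult_IZR, <- INR_IZR_INZ; ring).
      rewrite sin_Z_PI. replace (INR n * 0 - IZR nu * 0) with 0 by ring.
      rewrite sin_0. req; ring.
    - intros t Ht; apply seg in Ht.
      apply (is_derive_val _ _ (p1 t * cos (psi t) * / p1 t
               + sin (psi t) * (- (INR n * h2 t) / p1 t ^ 2))).
      + apply (is_derive_mult (fun t => sin (psi t)) (fun t => / p1 t));
          [| |intros; apply Rmult_comm].
        * apply (is_derive_comp sin psi); [apply is_derive_sin|auto].
        * apply (is_derive_inv p1); auto.
      + field; auto.
    - intros t Ht; apply seg in Ht; cont. apply pow_nonzero; auto. }
  rewrite RInt_sub in I by assumption.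
  assert (B : Rabs (RInt (fun t => cos (psi t)) 0 PI)
              <= RInt (fun t => INR n * / d ^ 2 * h2 t) 0 PI).
  { replace (RInt (fun t => cos (psi t)) 0 PI : R)
      with (RInt (fun t => sin (psi t) * (INR n * h2 t / p1 t ^ 2)) 0 PI : R) by (req; lra).
    eapply Rle_trans; [apply abs_RInt_le; [lra|assumption]|].
    apply RInt_le; [lra| |exint|].
    - apply @ex_RInt_continuous; intros z Hz; apply seg in Hz; cont.
      apply pow_nonzero; auto.
    - intros t Ht. assert (Hh := phase_nonneg _ _ _ _ t Ph ltac:(lra)).
      assert (H1 := HD t ltac:(lra)). fold (p1 t) in H1.
      assert (Hd2 : d ^ 2 <= p1 t ^ 2).
      { rewrite <- (pow2_abs (p1 t)). apply pow_incr; lra. }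
      assert (Hd3 : 0 < d ^ 2) by (apply pow_lt; assumption).
      assert (0 <= INR n * h2 t / p1 t ^ 2).
      { apply Rmult_le_pos; [apply Rmult_le_pos; assumption|].
        left; apply Rinv_0_lt_compat; lra. }
      rewrite Rabs_mult, (Rabs_pos_eq (_ / _)) by assumption.
      apply Rle_trans with (1 * (INR n * h2 t / p1 t ^ 2)).
      + apply Rmult_le_compat_r; [assumption|apply Rabs_le, SIN_bound].
      + rewrite Rmult_1_l.
        replace (INR n * / d ^ 2 * h2 t) with (INR n * h2 t * / d ^ 2) by ring.
        apply Rmult_le_compat_l; [apply Rmult_le_pos; assumption|].
        apply Rinv_le_contravar; assumption. }
  rewrite RInt_mul in B by exint.
  rewrite (RInt_FTC h1 h2) in B
    by (intros; (apply (phase_d2 _ _ _ _ Ph) || apply (phase_c2 _ _ _ _ Ph))).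
  unfold fc. fold psi. rewrite Rabs_mult, (Rabs_pos_eq (/ PI))
    by (left; apply Rinv_0_lt_compat; lra).
  replace (INR n * ((h1 PI - h1 0) / PI) * / d ^ 2)
    with (/ PI * (INR n * / d ^ 2 * (h1 PI - h1 0))) by (field; split; [apply Rgt_not_eq|]; lra).
  apply Rmult_le_compat_l; [left; apply Rinv_0_lt_compat; lra|exact B].
Qed.

(** Both bounds telescope: [1 / m^2 <= 1 / (m - 1) - 1 / m]. *)
Lemma sum_inv_sq_above (x : R) (q r : Z) :
  x < IZR q - 1 -> sumZ (fun v => / (IZR v - x) ^ 2) q r <= / (IZR q - 1 - x).
Proof.
  intros Hx. destruct (Z_le_dec q r) as [L|L].
  - apply Rle_trans with (/ (IZR q - 1 - x) - / (IZR r - 1 - x)).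
    + revert r L. apply Z_ge_ind.
      * rewrite sumZ_nil by lia; lra.
      * intros r Hr IH. rewrite sumZ_S by lia. apply IZR_le in Hr.
        rewrite plus_IZR.
        assert (/ (IZR r - x) ^ 2 <= / (IZR r - 1 - x) - / (IZR r + 1 - 1 - x)); [|lra].
        replace (/ (IZR r - 1 - x) - / (IZR r + 1 - 1 - x))
          with (/ ((IZR r - 1 - x) * (IZR r - x))) by (field; lra).
        apply Rinv_le_contravar; [apply Rmult_lt_0_compat; lra|].
        simpl; rewrite Rmult_1_r. apply Rmult_le_compat_r; lra.
    + apply IZR_le in L. assert (0 < / (IZR r - 1 - x)) by (apply Rinv_0_lt_compat; lra). lra.
  - rewrite sumZ_nil by lia. left; apply Rinv_0_lt_compat; lra.
Qed.

Lemma sum_inv_sq_below (x : R) (p q : Z) :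
  IZR q < x -> sumZ (fun v => / (x - IZR v) ^ 2) p q <= / (x - IZR q).
Proof.
  intros Hx. destruct (Z_le_dec p q) as [L|L].
  - apply Rle_trans with (/ (x - IZR q) - / (x - IZR p)).
    + revert q L Hx. apply (Z_ge_ind p (fun q => IZR q < x ->
        sumZ (fun v => / (x - IZR v) ^ 2) p q <= / (x - IZR q) - / (x - IZR p))).
      * intros; rewrite sumZ_nil by lia; lra.
      * intros r Hr IH Hx. rewrite plus_IZR in *. specialize (IH ltac:(lra)).
        rewrite sumZ_S by lia.
        assert (/ (x - IZR r) ^ 2 <= / (x - (IZR r + 1)) - / (x - IZR r)); [|lra].
        replace (/ (x - (IZR r + 1)) - / (x - IZR r))
          with (/ ((x - (IZR r + 1)) * (x - IZR r))) by (field; lra).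
        apply Rinv_le_contravar; [apply Rmult_lt_0_compat; lra|].
        simpl; rewrite Rmult_1_r. apply Rmult_le_compat_r; lra.
    + apply IZR_le in L. assert (0 < / (x - IZR p)) by (apply Rinv_0_lt_compat; lra). lra.
  - rewrite sumZ_nil by lia. left; apply Rinv_0_lt_compat; lra.
Qed.

Lemma up_incr (x y : R) : x <= y -> (up x <= up y)%Z.
Proof.
  intros H. destruct (archimed x), (archimed y).
  apply Z.lt_succ_r, lt_IZR. rewrite succ_IZR. lra.
Qed.

(** Every window sum is controlled by the window [n A < nu <= n B]. Where [nu]
    is within [n e] of the missing ends of the range of [n h'], Bessel's
    inequality alone makes the sum at most the square root of the number of
    terms; beyond, the coefficients are summable with a bound free of [n]. *)
Lemma fc_window_bound h h1 h2 k n A B e p q :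
  phase h h1 h2 k -> (0 < n)%nat -> 0 < e -> h1 0 <= A <= B -> B <= h1 PI ->
  sumZ (fun nu => Rabs (fc h n nu)) p q
  <= 2 * ((h1 PI - h1 0) / PI / e)
     + sqrt (INR n * (A - h1 0 + e) + 2) + sqrt (INR n * (h1 PI - B + e) + 2)
     + sumZ (fun nu => Rabs (fc h n nu)) (up (INR n * A)) (up (INR n * B)).
Proof.
  intros Ph Hn0 He HA HB. assert (P := PI_RGT_0).
  assert (Hn : 0 < INR n) by (apply lt_0_INR; assumption).
  set (al := h1 0) in *. set (be := h1 PI) in *.
  set (al' := INR n * (al - e)). set (be' := INR n * (be + e)).
  set (p1 := (up al' - 1)%Z). set (p4 := (up be' + 1)%Z).
  set (a := fun nu => Rabs (fc h n nu)).
  assert (Ha : forall nu, 0 <= a nu) by (intros; apply Rabs_pos).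
  assert (M1 : al' <= INR n * A) by (apply Rmult_le_compat_l; lra).
  assert (M2 : INR n * A <= INR n * B) by (apply Rmult_le_compat_l; lra).
  assert (M3 : INR n * B <= be') by (apply Rmult_le_compat_l; lra).
  assert (U1 := up_incr _ _ M1). assert (U2 := up_incr _ _ M2). assert (U3 := up_incr _ _ M3).
  destruct (archimed al') as [a1 a2]. destruct (archimed (INR n * A)) as [A1 A2].
  destruct (archimed (INR n * B)) as [B1 B2]. destruct (archimed be') as [b1 b2].
  assert (Hp1 : IZR p1 = IZR (up al') - 1) by (unfold p1; now rewrite minus_IZR).
  assert (Hp4 : IZR p4 = IZR (up be') + 1) by (unfold p4; now rewrite plus_IZR).
  assert (Cpos : 0 <= (be - al) / PI).
  { apply Rmult_le_pos; [lra|left; apply Rinv_0_lt_compat; lra]. }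
  assert (range : forall t, 0 <= t <= PI -> INR n * al <= INR n * h1 t <= INR n * be).
  { intros t Ht; split; (apply Rmult_le_compat_l; [lra|]);
      apply (phase_h1_incr _ _ _ _ _ _ Ph); lra. }
  set (pp := Z.min p p1). set (qq := Z.max q p4).
  apply Rle_trans with (sumZ a pp qq); [apply sumZ_incr; [assumption|lia|lia]|].
  rewrite (sumZ_Chasles a pp p1), (sumZ_Chasles a p1 (up (INR n * A))),
    (sumZ_Chasles a (up (INR n * A)) (up (INR n * B))),
    (sumZ_Chasles a (up (INR n * B)) p4) by lia.
  assert (T1 : sumZ a pp p1 <= (be - al) / PI / e).
  { assert (G : INR n * e <= INR n * al - IZR p1) by (rewrite Hp1; unfold al' in *; lra).
    assert (G0 : 0 < INR n * e) by (apply Rmult_lt_0_compat; lra).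
    apply Rle_trans with
      (sumZ (fun v => INR n * ((be - al) / PI) * / (INR n * al - IZR v) ^ 2) pp p1).
    - apply sumZ_le. intros v Hv.
      assert (IZR v < IZR p1) by (apply IZR_lt; lia).
      apply (fc_nonstationary _ _ _ _ _ _ _ Ph); [lra|].
      intros t Ht. assert (Hr := range t Ht). rewrite Rabs_pos_eq; lra.
    - rewrite sumZ_scal.
      apply Rle_trans with (INR n * ((be - al) / PI) * / (INR n * e)).
      + apply Rmult_le_compat_l; [apply Rmult_le_pos; lra|].
        eapply Rle_trans; [apply sum_inv_sq_below; lra|].
        apply Rinv_le_contravar; lra.
      + right; field; lra. }
  assert (T4 : sumZ a p4 qq <= (be - al) / PI / e).
  { assert (G : INR n * e <= IZR p4 - 1 - INR n * be) by (rewrite Hp4; unfold be' in *; lra).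
    assert (G0 : 0 < INR n * e) by (apply Rmult_lt_0_compat; lra).
    apply Rle_trans with
      (sumZ (fun v => INR n * ((be - al) / PI) * / (IZR v - INR n * be) ^ 2) p4 qq).
    - apply sumZ_le. intros v Hv.
      assert (IZR p4 <= IZR v) by (apply IZR_le; lia).
      apply (fc_nonstationary _ _ _ _ _ _ _ Ph); [lra|].
      intros t Ht. assert (Hr := range t Ht). rewrite Rabs_left1; lra.
    - rewrite sumZ_scal.
      apply Rle_trans with (INR n * ((be - al) / PI) * / (INR n * e)).
      + apply Rmult_le_compat_l; [apply Rmult_le_pos; lra|].
        eapply Rle_trans; [apply sum_inv_sq_above; lra|].
        apply Rinv_le_contravar; lra.
      + right; field; lra. }
  assert (T2 : sumZ a p1 (up (INR n * A)) <= sqrt (INR n * (A - al + e) + 2)).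
  { apply sumZ_abs_le_sqrt; [lia| |apply (fc_bessel _ _ _ _ _ _ _ Ph)].
    rewrite Hp1; unfold al' in *; lra. }
  assert (T3 : sumZ a (up (INR n * B)) p4 <= sqrt (INR n * (be - B + e) + 2)).
  { apply sumZ_abs_le_sqrt; [lia| |apply (fc_bessel _ _ _ _ _ _ _ Ph)].
    rewrite Hp4; unfold be' in *; lra. }
  fold a. lra.
Qed.

(** * Stationary phase *)

Lemma cos_lipschitz (x y : R) : Rabs (cos x - cos y) <= Rabs (x - y).
Proof.
  replace (Rabs (x - y)) with (1 * Rabs (x - y)) by ring.
  apply (increment_abs_le cos (fun t => - sin t)).
  - intros; apply is_derive_cos.
  - intros; rewrite Rabs_Ropp; apply Rabs_le, SIN_bound.
Qed.

(** The exactly quadratic model of a stationary point. *)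
Lemma quadratic_phase (phi0 th lam tau r : R) :
  fresnel_phase phi0 -> 0 < lam -> 0 < r ->
  Rabs (lam * RInt (fun t => cos (th + (lam * (t - tau)) ^ 2)) (tau - r) (tau + r)
        - sqrt PI * cos (th + phi0)) <= 8 / (lam * r).
Proof.
  intros HF Hl Hr.
  assert (HX : 0 < lam * r) by (apply Rmult_lt_0_compat; assumption).
  assert (E := RInt_lin (fun v => cos (th + v ^ 2)) lam (- (lam * tau)) (tau - r) (tau + r)
                 ltac:(intros; cont)).
  rewrite (RInt_eq (fun y => cos (th + (lam * y + - (lam * tau)) ^ 2))
             (fun t => cos (th + (lam * (t - tau)) ^ 2))) in E
    by (intros; do 2 f_equal; ring).
  rewrite E.
  replace (lam * (tau - r) + - (lam * tau)) with (- (lam * r)) by ring.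
  replace (lam * (tau + r) + - (lam * tau)) with (lam * r) by ring.
  rewrite RInt_even.
  2: intros; cont.
  2: intros; do 2 f_equal; ring.
  rewrite fresnel_cos_sin, cos_plus.
  destruct (HF _ HX) as [HP HQ].
  set (X := lam * r) in *.
  replace (2 * (cos th * fresnel_cos X - sin th * fresnel_sin X)
           - sqrt PI * (cos th * cos phi0 - sin th * sin phi0))
    with (2 * (cos th * (fresnel_cos X - sqrt PI / 2 * cos phi0))
          + - (2 * (sin th * (fresnel_sin X - sqrt PI / 2 * sin phi0)))) by field.
  replace (8 / X) with (2 * (1 * (2 / X)) + 2 * (1 * (2 / X))) by (field; lra).
  eapply Rle_trans; [apply Rabs_triang|]. rewrite Rabs_Ropp, !Rabs_mult.
  rewrite (Rabs_pos_eq 2) by lra.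
  apply Rplus_le_compat; (apply Rmult_le_compat_l; [lra|]);
    apply Rmult_le_compat; try apply Rabs_pos; try assumption;
    apply Rabs_le; [apply COS_bound|apply SIN_bound].
Qed.

(** The window [|t - tau| <= rad / sqrt n] carries the main term, up to the
    deviation [om] of [h''] from [h'' tau] there; the rest is [O(1 / rad)] by the
    first derivative test. *)
Lemma stationary_phase_local h h1 h2 k phi0 n nu tau rad mu om :
  phase h h1 h2 k -> fresnel_phase phi0 -> (0 < n)%nat -> 0 < rad -> 0 < mu ->
  IZR nu = INR n * h1 tau ->
  0 <= tau - rad / sqrt (INR n) -> tau + rad / sqrt (INR n) <= PI ->
  (forall t, Rabs (t - tau) <= rad / sqrt (INR n) ->
     mu <= h2 t /\ Rabs (h2 t - h2 tau) <= om) ->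
  Rabs (sqrt (INR n) * (PI * fc h n nu)
        - sqrt (2 * PI / h2 tau) * cos (INR n * h tau - IZR nu * tau + phi0))
  <= 24 / (mu * rad) + 2 * om * rad ^ 3.
Proof.
  intros Ph HF Hn0 HR Hmu Hnu Hl Hr Hloc. assert (P := PI_RGT_0).
  assert (Hn : 0 < INR n) by (apply lt_0_INR; assumption).
  assert (C0 := phase_c0 _ _ _ _ Ph). assert (C1 := phase_c1 _ _ _ _ Ph).
  assert (C2 := phase_c2 _ _ _ _ Ph).
  set (s := sqrt (INR n)) in *.
  assert (Hs : 0 < s) by (apply sqrt_lt_R0; assumption).
  assert (Hss : INR n = s * s) by (symmetry; apply sqrt_sqrt; lra).
  set (r := rad / s) in *.
  assert (Hr0 : 0 < r) by (apply Rdiv_lt_0_compat; assumption).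
  assert (HRr : rad = r * s) by (unfold r; field; lra).
  assert (Hk : mu <= h2 tau).
  { apply Hloc. rewrite Rminus_diag, Rabs_R0; lra. }
  assert (Hom : 0 <= om).
  { apply Rle_trans with (Rabs (h2 tau - h2 tau)); [apply Rabs_pos|].
    apply Hloc. rewrite Rminus_diag, Rabs_R0; lra. }
  set (kap := h2 tau) in *.
  set (psi := fun t => INR n * h t - IZR nu * t).
  set (psi1 := fun t => INR n * h1 t - IZR nu).
  set (psi2 := fun t => INR n * h2 t).
  assert (Dpsi : forall t, is_derive psi t (psi1 t)).
  { intros t. unfold psi, psi1. assert (D := phase_d1 _ _ _ _ Ph t). auto_derive.
    - eexists; exact D.
    - replace (Derive (fun x => h x) t) with (h1 t)
        by (symmetry; apply is_derive_unique; exact D). ring. }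
  assert (Dpsi1 : forall t, is_derive psi1 t (psi2 t)).
  { intros t. unfold psi1, psi2. assert (D := phase_d2 _ _ _ _ Ph t). auto_derive.
    - eexists; exact D.
    - replace (Derive (fun x => h1 x) t) with (h2 t)
        by (symmetry; apply is_derive_unique; exact D). ring. }
  assert (Cpsi : forall t, continuous psi t) by (intros; unfold psi; cont).
  assert (Cpsi2 : forall t, continuous psi2 t) by (intros; unfold psi2; cont).
  assert (Hpsi2 : forall t, 0 <= t <= PI -> 0 <= psi2 t).
  { intros t Ht. apply Rmult_le_pos; [lra|]. apply (phase_nonneg _ _ _ _ _ Ph Ht). }
  assert (Hlam : 0 < mu * rad * s) by (repeat apply Rmult_lt_0_compat; assumption).
  assert (J1 : Rabs (RInt (fun t => cos (psi t)) 0 (tau - r)) <= 4 / (mu * rad * s)).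
  { apply (first_derivative_test psi psi1 psi2); auto.
    - intros t Ht; apply Hpsi2; lra.
    - intros t Ht. unfold psi1. rewrite Hnu.
      assert (h1 t <= h1 (tau - r)) by (apply (phase_h1_incr _ _ _ _ _ _ Ph); lra).
      assert (mu * (tau - (tau - r)) <= h1 tau - h1 (tau - r)).
      { apply (increment_ge h1 h2); [lra|intros; apply (phase_d2 _ _ _ _ Ph)|].
        intros u Hu. apply Hloc. rewrite Rabs_left1; lra. }
      assert (INR n * (mu * r) <= INR n * (h1 tau - h1 t))
        by (apply Rmult_le_compat_l; lra).
      rewrite Rabs_left1; rewrite Hss, HRr in *; nra. }
  assert (J3 : Rabs (RInt (fun t => cos (psi t)) (tau + r) PI) <= 4 / (mu * rad * s)).
  { apply (first_derivative_test psi psi1 psi2); auto.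
    - intros t Ht; apply Hpsi2; lra.
    - intros t Ht. unfold psi1. rewrite Hnu.
      assert (h1 (tau + r) <= h1 t) by (apply (phase_h1_incr _ _ _ _ _ _ Ph); lra).
      assert (mu * (tau + r - tau) <= h1 (tau + r) - h1 tau).
      { apply (increment_ge h1 h2); [lra|intros; apply (phase_d2 _ _ _ _ Ph)|].
        intros u Hu. apply Hloc. rewrite Rabs_pos_eq; lra. }
      assert (INR n * (mu * r) <= INR n * (h1 t - h1 tau))
        by (apply Rmult_le_compat_l; lra).
      rewrite Rabs_pos_eq; rewrite Hss, HRr in *; nra. }
  set (l := sqrt (kap / 2)).
  assert (Hl0 : 0 < l) by (apply sqrt_lt_R0; lra).
  assert (Hll : l * l = kap / 2) by (apply sqrt_sqrt; lra).
  set (lam := s * l). assert (Hlam0 : 0 < lam) by (apply Rmult_lt_0_compat; assumption).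
  set (th := psi tau).
  assert (J2 : Rabs (RInt (fun t => cos (psi t)) (tau - r) (tau + r)
                 - RInt (fun t => cos (th + (lam * (t - tau)) ^ 2)) (tau - r) (tau + r))
               <= (tau + r - (tau - r)) * (INR n * (om * r ^ 2))).
  { apply RInt_diff_le; [lra|exint|exint|]. intros t Ht.
    assert (Htr : Rabs (t - tau) <= r) by (apply Rabs_le; lra).
    assert (bt : forall u, Rmin tau t <= u <= Rmax tau t -> Rabs (u - tau) <= Rabs (t - tau)).
    { intros u. unfold Rmin, Rmax. destruct (Rle_dec tau t); intros Hu.
      - rewrite !Rabs_pos_eq; lra.
      - rewrite !Rabs_left1; lra. }
    set (e := fun u => h u - h1 tau * u - kap * (u - tau) ^ 2 / 2).
    set (e1 := fun u => h1 u - h1 tau - kap * (u - tau)).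
    assert (De : forall u, is_derive e u (e1 u)).
    { intros u. unfold e, e1. assert (D := phase_d1 _ _ _ _ Ph u). auto_derive.
      - eexists; exact D.
      - replace (Derive (fun x => h x) u) with (h1 u)
          by (symmetry; apply is_derive_unique; exact D). field. }
    assert (De1 : forall u, is_derive e1 u (h2 u - kap)).
    { intros u. unfold e1. assert (D := phase_d2 _ _ _ _ Ph u). auto_derive.
      - eexists; exact D.
      - replace (Derive (fun x => h1 x) u) with (h2 u)
          by (symmetry; apply is_derive_unique; exact D). ring. }
    assert (B1 : forall u, Rabs (u - tau) <= r -> Rabs (e1 u) <= om * Rabs (u - tau)).
    { intros u Hu. replace (e1 u) with (e1 u - e1 tau) by (unfold e1; ring).
      apply (increment_abs_le e1 (fun u => h2 u - kap)); [intros; apply De1|].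
      intros v Hv. apply Hloc.
      apply Rle_trans with (Rabs (u - tau)); [|assumption].
      revert Hv. unfold Rmin, Rmax. destruct (Rle_dec tau u); intros Hv.
      - rewrite !Rabs_pos_eq; lra.
      - rewrite !Rabs_left1; lra. }
    assert (B2 : Rabs (e t - e tau) <= om * r * Rabs (t - tau)).
    { apply (increment_abs_le e e1); [intros; apply De|]. intros u Hu.
      apply bt in Hu. apply Rle_trans with (om * Rabs (u - tau)); [apply B1; lra|].
      apply Rmult_le_compat_l; lra. }
    eapply Rle_trans; [apply cos_lipschitz|].
    replace (psi t - (th + (lam * (t - tau)) ^ 2)) with (INR n * (e t - e tau)).
    2:{ unfold th, psi, e, lam. rewrite Hnu.
        replace ((s * l * (t - tau)) ^ 2) with ((s * s) * (l * l) * (t - tau) ^ 2) by ring.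
        rewrite Hll, <- Hss. field. }
    rewrite Rabs_mult, (Rabs_pos_eq (INR n)) by lra.
    apply Rmult_le_compat_l; [lra|].
    eapply Rle_trans; [exact B2|].
    replace (om * r ^ 2) with (om * r * r) by ring.
    apply Rmult_le_compat_l; [apply Rmult_le_pos; lra|assumption]. }
  assert (J4 := quadratic_phase phi0 th lam tau r HF Hlam0 Hr0).
  assert (Hmain : sqrt (2 * PI / kap) = sqrt PI / l).
  { replace (2 * PI / kap) with (PI / (kap / 2)) by (field; lra).
    apply sqrt_div_alt. lra. }
  replace (PI * fc h n nu)
    with (RInt (fun t => cos (psi t)) 0 (tau - r)
          + RInt (fun t => cos (psi t)) (tau - r) (tau + r)
          + RInt (fun t => cos (psi t)) (tau + r) PI).
  2:{ unfold fc. change (fun t => cos (INR n * h t - IZR nu * t)) with (fun t => cos (psi t)).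
      rewrite (RInt_split _ 0 (tau - r) PI) by exint.
      rewrite (RInt_split _ (tau - r) (tau + r) PI) by exint. field. lra. }
  rewrite Hmain.
  change (INR n * h tau - IZR nu * tau) with th.
  revert J1 J2 J3 J4.
  generalize (RInt (fun t => cos (psi t)) 0 (tau - r) : R).
  generalize (RInt (fun t => cos (psi t)) (tau - r) (tau + r) : R).
  generalize (RInt (fun t => cos (psi t)) (tau + r) PI : R).
  generalize (RInt (fun t => cos (th + (lam * (t - tau)) ^ 2)) (tau - r) (tau + r)
              : R).
  intros I4 I3 I2 I1 J1 J2 J3 J4.
  replace (s * (I1 + I2 + I3) - sqrt PI / l * cos (th + phi0))
    with (s * I1 + s * (I2 - I4) + s * I3 + / l * (lam * I4 - sqrt PI * cos (th + phi0)))
    by (unfold lam; field; lra).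
  assert (K1 : Rabs (s * I1) <= 4 / (mu * rad)).
  { rewrite Rabs_mult, (Rabs_pos_eq s) by lra.
    replace (4 / (mu * rad)) with (s * (4 / (mu * rad * s))) by (field; lra).
    apply Rmult_le_compat_l; lra. }
  assert (K3 : Rabs (s * I3) <= 4 / (mu * rad)).
  { rewrite Rabs_mult, (Rabs_pos_eq s) by lra.
    replace (4 / (mu * rad)) with (s * (4 / (mu * rad * s))) by (field; lra).
    apply Rmult_le_compat_l; lra. }
  assert (K2 : Rabs (s * (I2 - I4)) <= 2 * om * rad ^ 3).
  { rewrite Rabs_mult, (Rabs_pos_eq s) by lra.
    replace (2 * om * rad ^ 3) with (s * ((tau + r - (tau - r)) * (INR n * (om * r ^ 2))))
      by (rewrite HRr, Hss; ring).
    apply Rmult_le_compat_l; lra. }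
  assert (K4 : Rabs (/ l * (lam * I4 - sqrt PI * cos (th + phi0))) <= 16 / (mu * rad)).
  { assert (0 < / l) by (apply Rinv_0_lt_compat; assumption).
    rewrite Rabs_mult, (Rabs_pos_eq (/ l)) by lra.
    apply Rle_trans with (/ l * (8 / (lam * r))); [apply Rmult_le_compat_l; lra|].
    replace (/ l * (8 / (lam * r))) with (8 * / ((l * l) * rad))
      by (unfold lam; rewrite HRr; field; lra).
    rewrite Hll. replace (16 / (mu * rad)) with (8 * / (mu / 2 * rad)) by (field; lra).
    apply Rmult_le_compat_l; [lra|]. apply Rinv_le_contravar.
    - apply Rmult_lt_0_compat; lra.
    - apply Rmult_le_compat_r; lra. }
  replace (24 / (mu * rad) + 2 * om * rad ^ 3)
    with (4 / (mu * rad) + 2 * om * rad ^ 3 + 4 / (mu * rad) + 16 / (mu * rad)) by (field; lra).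
  eapply Rle_trans; [apply Rabs_triang|]. apply Rplus_le_compat; [|exact K4].
  eapply Rle_trans; [apply Rabs_triang|]. apply Rplus_le_compat; [|exact K3].
  eapply Rle_trans; [apply Rabs_triang|]. apply Rplus_le_compat; assumption.
Qed.

Lemma continuous_pos_lower_bound (f : R -> R) (a b : R) :
  a <= b -> (forall t, continuous f t) -> (forall t, a <= t <= b -> 0 < f t) ->
  exists mu, 0 < mu /\ forall t, a <= t <= b -> mu <= f t.
Proof.
  intros Hab Cf Hf.
  destruct (continuity_ab_min f a b Hab) as [m [Hm1 Hm2]].
  { intros; apply continuity_pt_filterlim, Cf. }
  exists (f m). split; [apply Hf; assumption|assumption].
Qed.

Lemma large_INR (x : R) : exists N : nat, forall n, (N <= n)%nat -> x <= INR n.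
Proof.
  destruct (Rle_lt_dec 0 x) as [H|H].
  - destruct (nfloor_ex x H) as [N HN]. exists (S N). intros n Hn.
    apply le_INR in Hn. rewrite S_INR in Hn. lra.
  - exists O. intros n _. assert (0 <= INR n) by apply pos_INR. lra.
Qed.

(** The local bound is made small by a large [rad], then by a small oscillation
    [om] of [h''], available once [rad / sqrt n] is small. *)
Lemma stationary_phase h h1 h2 k phi0 a b eps :
  phase h h1 h2 k -> fresnel_phase phi0 -> 0 < a -> a <= b -> b < PI -> 0 < eps ->
  exists N : nat, forall n, (N <= n)%nat -> forall nu tau,
    a <= tau <= b -> IZR nu = INR n * h1 tau ->
    Rabs (sqrt (INR n) * (PI * fc h n nu)
          - sqrt (2 * PI / h2 tau) * cos (INR n * h tau - IZR nu * tau + phi0)) <= eps.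
Proof.
  intros Ph HF Ha Hab Hb He. assert (P := PI_RGT_0).
  set (dl := Rmin a (PI - b) / 2).
  assert (Hdl : 0 < dl /\ dl < a /\ dl < PI - b).
  { assert (Rmin a (PI - b) <= a) by apply Rmin_l.
    assert (Rmin a (PI - b) <= PI - b) by apply Rmin_r.
    assert (0 < Rmin a (PI - b)) by (apply Rmin_pos; lra). unfold dl; lra. }
  destruct (continuous_pos_lower_bound h2 (a - dl) (b + dl)) as [mu [Hmu Hmin]];
    [lra|apply (phase_c2 _ _ _ _ Ph)|intros; apply (phase_pos _ _ _ _ Ph); lra|].
  set (rad := 48 / (mu * eps)).
  assert (HR : 0 < rad).
  { apply Rdiv_lt_0_compat; [lra|apply Rmult_lt_0_compat; assumption]. }
  assert (HR3 : 0 < rad ^ 3) by (apply pow_lt; assumption).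
  set (om := eps / (4 * rad ^ 3)).
  assert (Hom : 0 < om) by (apply Rdiv_lt_0_compat; lra).
  destruct (@Heine_cor2 h2 0 PI) with (eps := mkposreal _ Hom) as [d Hd].
  { intros; apply continuity_pt_filterlim, (phase_c2 _ _ _ _ Ph). }
  assert (Hd0 := cond_pos d).
  set (m := Rmin dl (d / 2)).
  assert (Hm : 0 < m /\ m <= dl /\ m <= d / 2).
  { unfold m; split; [apply Rmin_pos; lra|split; [apply Rmin_l|apply Rmin_r]]. }
  destruct (large_INR ((rad / m) ^ 2)) as [N HN].
  exists (S N). intros n Hn nu tau Htau Hnu.
  assert (HRm : 0 < rad / m) by (apply Rdiv_lt_0_compat; lra).
  assert (Hs : rad / m <= sqrt (INR n)).
  { rewrite <- (sqrt_pow2 (rad / m)) by lra. apply sqrt_le_1_alt, HN. lia. }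
  assert (Hr : rad / sqrt (INR n) <= m).
  { apply Rmult_le_reg_r with (sqrt (INR n)); [lra|].
    unfold Rdiv at 1. rewrite Rmult_assoc, Rinv_l, Rmult_1_r by lra.
    replace rad with (m * (rad / m)) at 1 by (field; lra). apply Rmult_le_compat_l; lra. }
  replace eps with (24 / (mu * rad) + 2 * om * rad ^ 3)
    by (unfold om; unfold rad at 1; field; repeat split; try apply Rgt_not_eq; lra).
  apply (stationary_phase_local h h1 h2 k); try assumption; try lra; try lia.
  intros t Ht. apply Rabs_le_between in Ht. split.
  - apply Hmin; lra.
  - left. apply Hd; [lra|lra|]. apply Rabs_def1; lra.
Qed.

(** * Riemann sums and equidistribution *)

Lemma is_lim_seq_eps (u : nat -> R) (l : R) :
  (forall eps, 0 < eps -> exists N : nat, forall n, (N <= n)%nat -> Rabs (u n - l) <= eps)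
  <-> is_lim_seq u l.
Proof.
  split.
  - intros H. apply is_lim_seq_spec. intros eps. assert (He := cond_pos eps).
    destruct (H (eps / 2)) as [N HN]; [lra|]. exists N. intros n Hn.
    specialize (HN n Hn). lra.
  - intros H eps He. apply is_lim_seq_spec in H.
    destruct (H (mkposreal _ He)) as [N HN]. exists N. intros n Hn.
    left. apply HN, Hn.
Qed.

Lemma continuous_bounded (f : R -> R) (a b : R) :
  (forall t, continuous f t) -> exists M, 0 < M /\ forall t, a <= t <= b -> Rabs (f t) <= M.
Proof.
  intros Cf. destruct (Rle_lt_dec a b) as [H|H].
  - destruct (continuity_ab_maj (fun t => Rabs (f t)) a b H) as [m [Hm _]].
    { intros; apply continuity_pt_filterlim. apply (cont_abs f), Cf. }
    exists (Rabs (f m) + 1). assert (0 <= Rabs (f m)) by apply Rabs_pos.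
    split; [lra|]. intros t Ht. specialize (Hm t Ht). lra.
  - exists 1. split; [lra|intros; lra].
Qed.

(** With [up] at both ends the points [nu / n] are exactly those of [(A, B]],
    so this is a Riemann sum. *)
Definition grid_sum (F : R -> R) (A B : R) (n : nat) : R :=
  / INR n * sumZ (fun nu => F (IZR nu / INR n)) (up (INR n * A)) (up (INR n * B)).

Lemma grid_window (A B : R) (n : nat) (nu : Z) :
  (0 < n)%nat -> (up (INR n * A) <= nu < up (INR n * B))%Z -> A < IZR nu / INR n <= B.
Proof.
  intros Hn [H1 H2]. assert (Hn0 : 0 < INR n) by (apply lt_0_INR; assumption).
  destruct (archimed (INR n * A)) as [A1 A2]. destruct (archimed (INR n * B)) as [B1 B2].
  apply IZR_le in H1. assert (H3 : (nu + 1 <= up (INR n * B))%Z) by lia.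
  apply IZR_le in H3. rewrite plus_IZR in H3. split.
  - apply Rmult_lt_reg_l with (INR n); [assumption|].
    replace (INR n * (IZR nu / INR n)) with (IZR nu) by (field; lra). lra.
  - apply Rmult_le_reg_l with (INR n); [assumption|].
    replace (INR n * (IZR nu / INR n)) with (IZR nu) by (field; lra). lra.
Qed.

Lemma grid_count (A B : R) (n : nat) :
  (0 < n)%nat -> A <= B ->
  (up (INR n * A) <= up (INR n * B))%Z /\
  IZR (up (INR n * B)) - IZR (up (INR n * A)) <= INR n * (B - A + 1).
Proof.
  intros Hn HAB. assert (Hn0 : 1 <= INR n) by (apply (le_INR 1); lia).
  destruct (archimed (INR n * A)) as [A1 A2]. destruct (archimed (INR n * B)) as [B1 B2].
  split; [apply up_incr, Rmult_le_compat_l; lra|]. lra.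
Qed.

Lemma grid_sum_le (F : R -> R) (A B c : R) (n : nat) :
  (0 < n)%nat -> A <= B -> (forall y, A < y <= B -> Rabs (F y) <= c) -> 0 <= c ->
  Rabs (grid_sum F A B n) <= (B - A + 1) * c.
Proof.
  intros Hn HAB HF Hc. assert (Hn0 : 0 < INR n) by (apply lt_0_INR; assumption).
  destruct (grid_count A B n Hn HAB) as [G1 G2].
  assert (Hi : 0 < / INR n) by (apply Rinv_0_lt_compat; assumption).
  unfold grid_sum. rewrite Rabs_mult, (Rabs_pos_eq (/ INR n)) by lra.
  apply Rle_trans with (/ INR n * (INR n * (B - A + 1) * c)).
  - apply Rmult_le_compat_l; [lra|]. eapply Rle_trans.
    + apply sumZ_le_const; [assumption|]. intros v Hv. apply HF.
      apply grid_window; assumption.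
    + apply Rmult_le_compat_r; assumption.
  - right; field; lra.
Qed.

Lemma grid_sum_minus (F G : R -> R) (A B : R) (n : nat) :
  grid_sum (fun y => F y - G y) A B n = grid_sum F A B n - grid_sum G A B n.
Proof. unfold grid_sum. rewrite sumZ_minus. ring. Qed.

Lemma grid_sum_plus (F G : R -> R) (A B : R) (n : nat) :
  grid_sum (fun y => F y + G y) A B n = grid_sum F A B n + grid_sum G A B n.
Proof. unfold grid_sum. rewrite sumZ_plus. ring. Qed.

Lemma grid_sum_scal (c : R) (F : R -> R) (A B : R) (n : nat) :
  grid_sum (fun y => c * F y) A B n = c * grid_sum F A B n.
Proof. unfold grid_sum. rewrite sumZ_scal. ring. Qed.

Lemma grid_sum_ext (F G : R -> R) (A B : R) (n : nat) :
  (forall y, F y = G y) -> grid_sum F A B n = grid_sum G A B n.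
Proof. intros H. unfold grid_sum. f_equal. apply sumZ_ext; intros; apply H. Qed.

Lemma sumZ_RInt_Chasles (V : R -> R) (w : R) (p q : Z) :
  (forall t, continuous V t) -> (p <= q)%Z ->
  sumZ (fun nu => RInt V ((IZR nu - 1) * w) (IZR nu * w)) p q
  = RInt V ((IZR p - 1) * w) ((IZR q - 1) * w).
Proof.
  intros CV. revert q. apply Z_ge_ind.
  - rewrite sumZ_nil by lia. symmetry. apply (RInt_point _ V).
  - intros q Hq IH. rewrite sumZ_S, IH, plus_IZR by assumption.
    replace (IZR q + 1 - 1) with (IZR q) by ring.
    symmetry. apply RInt_split; exint.
Qed.

Lemma riemann_sum (V : R -> R) (A B : R) :
  (forall t, continuous V t) -> A <= B ->
  is_lim_seq (grid_sum V A B) (RInt V A B).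
Proof.
  intros CV HAB. apply is_lim_seq_eps. intros eps He.
  destruct (continuous_bounded V (A - 1) (B + 1) CV) as [M [HM0 HM]].
  set (om := eps / (2 * (B - A + 1))).
  assert (Hom : 0 < om) by (apply Rdiv_lt_0_compat; lra).
  destruct (@Heine_cor2 V (A - 1) (B + 1)) with (eps := mkposreal _ Hom) as [d Hd].
  { intros; apply continuity_pt_filterlim, CV. }
  assert (Hd0 := cond_pos d).
  destruct (large_INR (2 / d + 4 * M / eps + 1)) as [N HN].
  exists N. intros n Hn. specialize (HN n Hn).
  assert (D1 : 0 < 2 / d) by (apply Rdiv_lt_0_compat; lra).
  assert (D2 : 0 < 4 * M / eps) by (apply Rdiv_lt_0_compat; lra).
  assert (Hn0 : 0 < INR n) by lra.
  assert (Hnn : (0 < n)%nat) by (apply INR_lt; simpl; lra).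
  set (w := / INR n).
  assert (Hw0 : 0 < w) by (apply Rinv_0_lt_compat; lra).
  assert (Hnw : INR n * w = 1) by (apply Rinv_r; lra).
  assert (Hw1 : w <= 1) by (apply Rmult_le_reg_l with (INR n); lra).
  assert (Hwd : w < d).
  { apply Rmult_lt_reg_l with (INR n); [lra|]. rewrite Hnw.
    apply Rlt_le_trans with (2 / d * d); [|apply Rmult_le_compat_r; lra].
    unfold Rdiv. rewrite Rmult_assoc, Rinv_l; lra. }
  assert (HwM : 2 * M * w <= eps / 2).
  { apply Rmult_le_reg_l with (INR n); [lra|].
    replace (INR n * (2 * M * w)) with (4 * M / eps * (eps / 2))
      by (replace (INR n * (2 * M * w)) with (2 * M * (INR n * w)) by ring; rewrite Hnw; field; lra).
    apply Rmult_le_compat_r; lra. }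
  destruct (grid_count A B n Hnn HAB) as [G1 G2].
  destruct (archimed (INR n * A)) as [A1 A2]. destruct (archimed (INR n * B)) as [B1 B2].
  set (p := up (INR n * A)) in *. set (q := up (INR n * B)) in *.
  assert (PA : A - w <= (IZR p - 1) * w <= A).
  { split; apply Rmult_le_reg_l with (INR n); try lra;
      replace (INR n * ((IZR p - 1) * w)) with ((IZR p - 1) * (INR n * w)) by ring;
      rewrite Hnw; [rewrite Rmult_minus_distr_l, Hnw|]; lra. }
  assert (QB : B - w <= (IZR q - 1) * w <= B).
  { split; apply Rmult_le_reg_l with (INR n); try lra;
      replace (INR n * ((IZR q - 1) * w)) with ((IZR q - 1) * (INR n * w)) by ring;
      rewrite Hnw; [rewrite Rmult_minus_distr_l, Hnw|]; lra. }
  assert (E1 : Rabs (grid_sum V A B n - RInt V ((IZR p - 1) * w) ((IZR q - 1) * w)) <= eps / 2).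
  { rewrite <- sumZ_RInt_Chasles by assumption. unfold grid_sum. fold p q w.
    rewrite <- sumZ_scal, <- sumZ_minus.
    eapply Rle_trans.
    - apply sumZ_le_const with (c := w * om); [assumption|]. intros v Hv.
      destruct (grid_window A B n v Hnn Hv) as [V1 V2]. unfold Rdiv in V1, V2. fold w in V1, V2.
      replace (w * V (IZR v / INR n)) with (RInt (fun _ => V (IZR v * w)) ((IZR v - 1) * w) (IZR v * w) : R)
        by (rewrite RInt_cst; unfold Rdiv; fold w; ring).
      replace (w * om) with ((IZR v * w - (IZR v - 1) * w) * om) by ring.
      apply RInt_diff_le; [lra|exint|exint|]. intros t Ht. left. apply Hd; [lra|lra|].
      rewrite Rabs_pos_eq; lra.
    - apply Rle_trans with (INR n * (B - A + 1) * (w * om)).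
      + apply Rmult_le_compat_r; [apply Rmult_le_pos; lra|assumption].
      + replace (INR n * (B - A + 1) * (w * om)) with ((INR n * w) * ((B - A + 1) * om)) by ring.
        rewrite Hnw. right. unfold om; field; lra. }
  assert (E2 : Rabs (RInt V ((IZR p - 1) * w) ((IZR q - 1) * w) - RInt V A B) <= eps / 2).
  { rewrite (RInt_split V ((IZR p - 1) * w) A ((IZR q - 1) * w)) by exint.
    rewrite (RInt_split V A ((IZR q - 1) * w) B) by exint.
    assert (X1 : Rabs (RInt V ((IZR p - 1) * w) A) <= (A - (IZR p - 1) * w) * M).
    { apply abs_RInt_le_const; [lra|exint|]. intros t Ht; apply HM; lra. }
    assert (X2 : Rabs (RInt V ((IZR q - 1) * w) B) <= (B - (IZR q - 1) * w) * M).
    { apply abs_RInt_le_const; [lra|exint|]. intros t Ht; apply HM; lra. }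
    assert ((A - (IZR p - 1) * w) * M <= w * M) by (apply Rmult_le_compat_r; lra).
    assert ((B - (IZR q - 1) * w) * M <= w * M) by (apply Rmult_le_compat_r; lra).
    revert X1 X2.
    generalize (RInt V ((IZR p - 1) * w) A : R) (RInt V ((IZR q - 1) * w) B : R)
      (RInt V A ((IZR q - 1) * w) : R). intros r1 r2 r3 X1 X2.
    apply Rabs_le_between in X1. apply Rabs_le_between in X2.
    apply Rabs_le. lra. }
  replace (grid_sum V A B n - RInt V A B)
    with ((grid_sum V A B n - RInt V ((IZR p - 1) * w) ((IZR q - 1) * w))
          + (RInt V ((IZR p - 1) * w) ((IZR q - 1) * w) - RInt V A B)) by ring.
  eapply Rle_trans; [apply Rabs_triang|]. lra.
Qed.

(** The squared modulus of [sum_(l < L) exp(i l x)]. *)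
Definition fejer (L : nat) (x : R) : R :=
  rsum (fun l => cos (INR l * x)) L ^ 2 + rsum (fun l => sin (INR l * x)) L ^ 2.

Lemma fejer_nonneg (L : nat) (x : R) : 0 <= fejer L x.
Proof.
  assert (H1 := pow2_ge_0 (rsum (fun l => cos (INR l * x)) L)).
  assert (H2 := pow2_ge_0 (rsum (fun l => sin (INR l * x)) L)). unfold fejer; lra.
Qed.

Lemma fejer_cont (L : nat) (x : R) : continuous (fejer L) x.
Proof.
  unfold fejer. cont; induction L as [|L IH]; simpl; cont.
Qed.

(** Cauchy-Schwarz removes the phase [th]; the free parameter [u] then trades
    the modulus for its square, the quantity with a computable mean. *)
Lemma fejer_bound (L : nat) (th x u : R) :
  0 < u -> Rabs (rsum (fun l => cos (th - INR l * x)) L) <= u / 2 + fejer L x / (2 * u).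
Proof.
  intros Hu. set (X := rsum (fun l => cos (th - INR l * x)) L).
  assert (E : X = cos th * rsum (fun l => cos (INR l * x)) L
                  + sin th * rsum (fun l => sin (INR l * x)) L).
  { unfold X. rewrite <- !rsum_scal, <- rsum_plus. apply rsum_ext.
    intros; apply cos_minus. }
  assert (X2 : X ^ 2 <= fejer L x).
  { unfold fejer. rewrite E.
    set (c := rsum (fun l => cos (INR l * x)) L). set (s := rsum (fun l => sin (INR l * x)) L).
    assert (T := sin2_cos2 th). unfold Rsqr in T.
    assert (0 <= (cos th * s - sin th * c) ^ 2) by apply pow2_ge_0.
    assert ((cos th * c + sin th * s) ^ 2 + (cos th * s - sin th * c) ^ 2
            = (sin th * sin th + cos th * cos th) * (c ^ 2 + s ^ 2)) by ring.
    rewrite T in H0. lra. }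
  assert (Hi : 0 < / (2 * u)) by (apply Rinv_0_lt_compat; lra).
  assert (0 <= / (2 * u) * (Rabs X - u) ^ 2) by (apply Rmult_le_pos; [lra|apply pow2_ge_0]).
  assert (/ (2 * u) * (Rabs X - u) ^ 2 = u / 2 + / (2 * u) * X ^ 2 - Rabs X).
  { rewrite <- (pow2_abs X). field. lra. }
  assert (/ (2 * u) * X ^ 2 <= / (2 * u) * fejer L x) by (apply Rmult_le_compat_l; lra).
  unfold Rdiv at 2. lra.
Qed.

(** Orthogonality: only the [L] diagonal terms of the double sum survive. *)
Lemma fejer_mass (j : Z) (L : nat) :
  j <> 0%Z -> RInt (fun t => fejer L (2 * IZR j * t)) 0 PI = INR L * PI.
Proof.
  intros Hj. assert (Hj' : IZR j <> 0) by (apply not_0_IZR; assumption).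
  assert (Cf : forall L z, continuous (fun t => fejer L (2 * IZR j * t)) z).
  { intros L' z. apply (cont_app _ (fejer L') _ (fejer_cont L')). cont. }
  induction L as [|L IH].
  - rewrite (RInt_eq _ (fun _ => 0)) by (intros; unfold fejer; simpl; ring).
    rewrite RInt_cst. simpl; ring.
  - assert (S : forall M z, continuous (fun t => rsum (fun l => cos ((INR L - INR l) * (2 * IZR j * t))) M) z)
      by (intros M z; induction M as [|M IHM]; simpl; cont).
    rewrite (RInt_eq _ (fun t => fejer L (2 * IZR j * t)
        + (2 * rsum (fun l => cos ((INR L - INR l) * (2 * IZR j * t))) L + 1))).
    2:{ intros t. unfold fejer. simpl rsum. set (x := 2 * IZR j * t).
        assert (T := sin2_cos2 (INR L * x)). unfold Rsqr in T.
        rewrite (rsum_ext (fun l => cos ((INR L - INR l) * x))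
          (fun l => cos (INR L * x) * cos (INR l * x) + sin (INR L * x) * sin (INR l * x)))
          by (intros; rewrite <- cos_minus; f_equal; ring).
        rewrite rsum_plus, !rsum_scal.
        set (C := rsum (fun l => cos (INR l * x)) L). set (D := rsum (fun l => sin (INR l * x)) L).
        rewrite <- T. ring. }
    rewrite RInt_add, RInt_add, RInt_mul, RInt_cst, IH by (exint; auto).
    assert (Z : forall M, (M <= L)%nat ->
      RInt (fun t => rsum (fun l => cos ((INR L - INR l) * (2 * IZR j * t))) M) 0 PI = 0).
    { induction M as [|M IHM]; intros HM; simpl.
      - rewrite RInt_cst; req; ring.
      - assert (HL : INR L - INR M <> 0).
        { apply lt_INR in HM. lra. }
        rewrite RInt_add.
        2:{ apply @ex_RInt_continuous; intros.
            clear; induction M as [|M IHM]; simpl; cont. }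
        2: exint.
        rewrite IHM by lia.
        rewrite (RInt_eq _ (fun t => cos (((INR L - INR M) * (2 * IZR j)) * t)))
          by (intros; f_equal; ring).
        rewrite RInt_cos_lin by (repeat apply Rmult_integral_contrapositive_currified; lra || assumption).
        rewrite Rmult_0_r, sin_0.
        replace ((INR L - INR M) * (2 * IZR j) * PI)
          with (IZR ((Z.of_nat L - Z.of_nat M) * (2 * j)) * PI)
          by (rewrite mult_IZR, minus_IZR, mult_IZR, <- !INR_IZR_INZ; ring).
        rewrite sin_Z_PI. req; unfold Rdiv; ring. }
    rewrite Z by lia. rewrite S_INR. req. ring.
Qed.

(** What the equidistribution argument uses of the inverse [T] of [h'] and of
    the Legendre transform [g], whose derivative is [- T]. The last field says
    that the image under [T] of Lebesgue measure has bounded density. *)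
Record legendre (T g : R -> R) (A B Lam M : R) : Prop := {
  leg_AB : A <= B;
  leg_Lam : 0 < Lam;
  leg_M : 0 < M;
  leg_T : forall x y, Rabs (T x - T y) <= Lam * Rabs (x - y);
  leg_g : forall x y, Rabs (g y - g x + (y - x) * T x) <= Lam * (y - x) ^ 2;
  leg_mass : forall V, (forall t, continuous V t) -> (forall t, 0 <= V t) ->
    RInt (fun y => V (T y)) A B <= M * RInt V 0 PI
}.

Definition unif_cont (W : R -> R) : Prop :=
  forall eps, 0 < eps -> exists d, 0 < d /\
    forall x y, Rabs (x - y) <= d -> Rabs (W x - W y) <= eps.

Lemma unif_cont_continuous (W : R -> R) : unif_cont W -> forall t, continuous W t.
Proof.
  intros H t. apply filterlim_locally. intros eps. assert (He := cond_pos eps).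
  destruct (H (eps / 2)) as [d [Hd HW]]; [lra|].
  exists (mkposreal _ Hd). intros y Hy.
  apply Rle_lt_trans with (eps / 2); [|lra]. apply HW. left; exact Hy.
Qed.

Lemma leg_T_cont T g A B Lam M :
  legendre T g A B Lam M -> forall t, continuous T t.
Proof.
  intros HL. apply unif_cont_continuous. intros eps He.
  assert (HLam := leg_Lam _ _ _ _ _ _ HL).
  exists (eps / Lam). split; [apply Rdiv_lt_0_compat; assumption|].
  intros x y Hxy. eapply Rle_trans; [apply (leg_T _ _ _ _ _ _ HL)|].
  replace eps with (Lam * (eps / Lam)) by (field; lra).
  apply Rmult_le_compat_l; lra.
Qed.

Lemma sumZ_shift_diff (U : Z -> R) (p q : Z) (l : nat) (C : R) :
  (p <= q)%Z -> (forall v, Rabs (U v) <= C) ->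
  Rabs (sumZ U p q - sumZ (fun v => U (v + Z.of_nat l)%Z) p q) <= 2 * INR l * C.
Proof.
  intros Hpq HU. rewrite sumZ_shift.
  assert (E1 := sumZ_Chasles U p q (q + Z.of_nat l) ltac:(lia)).
  assert (E2 := sumZ_Chasles U p (p + Z.of_nat l) (q + Z.of_nat l) ltac:(lia)).
  assert (B : forall r, Rabs (sumZ U r (r + Z.of_nat l)) <= INR l * C).
  { intros r. eapply Rle_trans; [apply sumZ_le_const with (c := C); [lia|intros; apply HU]|].
    right. rewrite plus_IZR, <- INR_IZR_INZ. ring. }
  assert (B1 := B p). assert (B2 := B q).
  apply Rabs_le_between in B1. apply Rabs_le_between in B2.
  apply Rabs_le. lra.
Qed.

(** Averaging over shifts: replacing [nu] by [nu + l], [l < L], changes the sum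
    by [O(L)], while the phase [theta nu] advances almost linearly in [l] with
    slope [- x nu]; so the shifted terms add up to a geometric sum. *)
Lemma shift_average (w theta x : Z -> R) (p q : Z) (L : nat) (Wm e u : R) :
  (p <= q)%Z -> 0 < u -> 0 <= Wm ->
  (forall v, Rabs (w v) <= Wm) ->
  (forall v l, (l < L)%nat ->
     Rabs (w (v + Z.of_nat l)%Z * cos (theta (v + Z.of_nat l)%Z)
           - w v * cos (theta v - INR l * x v)) <= e) ->
  INR L * Rabs (sumZ (fun v => w v * cos (theta v)) p q)
  <= INR L * (2 * INR L * Wm + (IZR q - IZR p) * e)
     + Wm * ((IZR q - IZR p) * (u / 2) + sumZ (fun v => fejer L (x v)) p q / (2 * u)).
Proof.
  intros Hpq Hu HWm Hw He.
  set (U := fun v => w v * cos (theta v)).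
  set (F := fun l v => w v * cos (theta v - INR l * x v)).
  set (S := sumZ U p q).
  assert (HU : forall v, Rabs (U v) <= Wm).
  { intros v. unfold U. rewrite Rabs_mult.
    apply Rle_trans with (Wm * 1); [|lra].
    apply Rmult_le_compat; try apply Rabs_pos; [apply Hw|apply Rabs_le, COS_bound]. }
  assert (H1 : forall l, (l < L)%nat ->
    Rabs (S - sumZ (F l) p q) <= 2 * INR L * Wm + (IZR q - IZR p) * e).
  { intros l Hl.
    replace (S - sumZ (F l) p q)
      with ((S - sumZ (fun v => U (v + Z.of_nat l)%Z) p q)
            + sumZ (fun v => U (v + Z.of_nat l)%Z - F l v) p q)
      by (rewrite sumZ_minus; ring).
    eapply Rle_trans; [apply Rabs_triang|]. apply Rplus_le_compat.
    - eapply Rle_trans; [apply sumZ_shift_diff with (C := Wm); assumption|].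
      apply Rmult_le_compat_r; [assumption|]. apply Rmult_le_compat_l; [lra|].
      apply le_INR; lia.
    - apply sumZ_le_const; [assumption|]. intros v _. apply He; assumption. }
  assert (H2 : forall K, rsum (fun l => sumZ (F l) p q) K
               = sumZ (fun v => w v * rsum (fun l => cos (theta v - INR l * x v)) K) p q).
  { induction K as [|K IH]; simpl.
    - rewrite (sumZ_ext _ (fun _ => 0 * 0)) by (intros; ring). rewrite sumZ_scal; ring.
    - rewrite IH, <- sumZ_plus. apply sumZ_ext; intros; unfold F; ring. }
  assert (H3 : Rabs (rsum (fun l => sumZ (F l) p q) L)
     <= Wm * ((IZR q - IZR p) * (u / 2) + sumZ (fun v => fejer L (x v)) p q / (2 * u))).
  { rewrite H2. eapply Rle_trans; [apply sumZ_abs|].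
    apply Rle_trans with (sumZ (fun v => Wm * (u / 2 + / (2 * u) * fejer L (x v))) p q).
    - apply sumZ_le. intros v _. rewrite Rabs_mult.
      apply Rmult_le_compat; try apply Rabs_pos; [apply Hw|].
      eapply Rle_trans; [apply fejer_bound; exact Hu|]. right; unfold Rdiv; ring.
    - rewrite sumZ_scal, sumZ_plus, sumZ_scal, sumZ_const by assumption.
      right; unfold Rdiv; ring. }
  assert (H4 : INR L * S = rsum (fun l => S - sumZ (F l) p q) L
                           + rsum (fun l => sumZ (F l) p q) L).
  { rewrite <- rsum_plus, <- rsum_const. apply rsum_ext; intros; ring. }
  replace (INR L * Rabs S) with (Rabs (INR L * S))
    by (rewrite Rabs_mult, (Rabs_pos_eq (INR L)) by apply pos_INR; reflexivity).
  rewrite H4. eapply Rle_trans; [apply Rabs_triang|].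
  apply Rplus_le_compat; [|exact H3].
  eapply Rle_trans; [apply rsum_abs|]. rewrite <- rsum_const. apply rsum_le. exact H1.
Qed.

(** Since [theta] advances by [- 2 j T] per step, up to a quadratic error,
    [shift_average] reduces the claim to the mean of [fejer L (2 j T)]. It is at
    most [M PI L], negligible against [L^2]. *)
Lemma equidistribution_cos T g A B Lam M W Wm (j : Z) c :
  legendre T g A B Lam M -> unif_cont W -> 0 < Wm -> (forall y, Rabs (W y) <= Wm) ->
  j <> 0%Z ->
  is_lim_seq
    (fun n => grid_sum (fun y => W y * cos (2 * IZR j * (INR n * g y) + c)) A B n) 0.
Proof.
  intros HL UW HWm HW Hj. assert (P := PI_RGT_0).
  destruct HL as [HAB HLam HM HT Hg Hmass] eqn:EL. clear EL.
  assert (CT := leg_T_cont _ _ _ _ _ _ HL).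
  apply is_lim_seq_eps. intros eps He.
  set (Nw := B - A + 1). assert (HNw : 1 <= Nw) by (unfold Nw; lra).
  (* Parameters: [sg] splits the Cauchy-Schwarz bound, then the number [L] of
     shifts, then the oscillation [om] of [W] over [L] grid steps. *)
  set (sg := eps / (2 * (Wm * Nw))).
  assert (Hsg : 0 < sg).
  { apply Rdiv_lt_0_compat; [lra|]. apply Rmult_lt_0_compat; [lra|]. apply Rmult_lt_0_compat; lra. }
  assert (HMP : 0 < M * PI) by (apply Rmult_lt_0_compat; lra).
  destruct (large_INR (2 * Wm * (M * PI + 1) / (sg * eps) + 1)) as [L HLl].
  specialize (HLl L (le_n L)).
  assert (D0 : 0 < 2 * Wm * (M * PI + 1) / (sg * eps)).
  { apply Rdiv_lt_0_compat; [repeat apply Rmult_lt_0_compat; lra|].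
    apply Rmult_lt_0_compat; lra. }
  assert (HL1 : 1 <= INR L) by lra.
  assert (HLs : Wm * ((M * PI * INR L + 1) / (2 * sg * INR L)) <= INR L * (eps / 4)).
  { apply Rmult_le_reg_r with (4 * sg * / eps).
    { apply Rmult_lt_0_compat; [lra|apply Rinv_0_lt_compat; lra]. }
    replace (Wm * ((M * PI * INR L + 1) / (2 * sg * INR L)) * (4 * sg * / eps))
      with (2 * Wm * (M * PI + / INR L) / eps) by (field; lra).
    replace (INR L * (eps / 4) * (4 * sg * / eps)) with (INR L * sg) by (field; lra).
    apply Rle_trans with (2 * Wm * (M * PI + 1) / eps).
    - apply Rmult_le_compat_r; [left; apply Rinv_0_lt_compat; lra|].
      apply Rmult_le_compat_l; [lra|]. apply Rplus_le_compat_l.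
      rewrite <- Rinv_1. apply Rinv_le_contravar; lra.
    - replace (2 * Wm * (M * PI + 1) / eps)
        with (2 * Wm * (M * PI + 1) / (sg * eps) * sg) by (field; lra).
      apply Rmult_le_compat_r; lra. }
  set (om := eps / (4 * Nw)).
  assert (Hom : 0 < om) by (apply Rdiv_lt_0_compat; lra).
  destruct (UW om Hom) as [d [Hd0 Hd]].
  assert (CF : forall t, continuous (fun y => fejer L (2 * IZR j * T y)) t).
  { intros t. apply (cont_app _ (fejer L) _ (fejer_cont L)). cont. }
  assert (RS := proj2 (is_lim_seq_eps _ _) (riemann_sum _ A B CF HAB)).
  destruct (RS 1 Rlt_0_1) as [N1 HN1].
  assert (Hfm : RInt (fun y => fejer L (2 * IZR j * T y)) A B <= M * (INR L * PI)).
  { rewrite <- (fejer_mass j L Hj).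
    apply (Hmass (fun t => fejer L (2 * IZR j * t))).
    - intros t. apply (cont_app _ (fejer L) _ (fejer_cont L)). cont.
    - intros; apply fejer_nonneg. }
  set (Q := 2 * Rabs (IZR j) * Lam * INR L ^ 2).
  assert (HQ : 0 <= Q).
  { assert (0 <= Rabs (IZR j)) by apply Rabs_pos.
    assert (0 <= INR L ^ 2) by apply pow2_ge_0.
    unfold Q. repeat apply Rmult_le_pos; lra. }
  destruct (large_INR (INR L / d + (2 * INR L * Wm + Nw * (Wm * Q)) / (eps / 4) + 1)) as [N2 HN2].
  exists (N1 + N2)%nat. intros n Hn.
  specialize (HN1 n ltac:(lia)). specialize (HN2 n ltac:(lia)).
  assert (D1 : 0 < INR L / d) by (apply Rdiv_lt_0_compat; lra).
  assert (D2 : 0 <= (2 * INR L * Wm + Nw * (Wm * Q)) / (eps / 4)).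
  { apply Rmult_le_pos; [|left; apply Rinv_0_lt_compat; lra].
    apply Rplus_le_le_0_compat; apply Rmult_le_pos; try lra.
    apply Rmult_le_pos; lra. }
  assert (Hn0 : 1 <= INR n) by lra.
  assert (Hnn : (0 < n)%nat) by (apply INR_lt; simpl; lra).
  assert (HnL : INR L / INR n <= d).
  { apply Rmult_le_reg_r with (INR n); [lra|].
    unfold Rdiv; rewrite Rmult_assoc, Rinv_l, Rmult_1_r by lra.
    apply Rle_trans with (d * (INR L / d)).
    - right; field; lra.
    - apply Rmult_le_compat_l; lra. }
  assert (HnQ : (2 * INR L * Wm + Nw * (Wm * Q)) / INR n <= eps / 4).
  { apply Rmult_le_reg_r with (INR n); [lra|].
    unfold Rdiv at 1; rewrite Rmult_assoc, Rinv_l, Rmult_1_r by lra.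
    apply Rle_trans with (eps / 4 * ((2 * INR L * Wm + Nw * (Wm * Q)) / (eps / 4))).
    - right; field; lra.
    - apply Rmult_le_compat_l; lra. }
  destruct (grid_count A B n Hnn HAB) as [G1 G2]. fold Nw in G2.
  unfold grid_sum in *.
  set (p := up (INR n * A)) in *. set (q := up (INR n * B)) in *.
  set (S := sumZ (fun nu => W (IZR nu / INR n)
              * cos (2 * IZR j * (INR n * g (IZR nu / INR n)) + c)) p q).
  assert (HS : INR L * Rabs S
    <= INR L * (2 * INR L * Wm + (IZR q - IZR p) * (om + Wm * (Q / INR n)))
       + Wm * ((IZR q - IZR p) * (sg * INR L / 2)
               + sumZ (fun v => fejer L (2 * IZR j * T (IZR v / INR n))) p q / (2 * (sg * INR L)))).
  { apply (shift_average (fun v => W (IZR v / INR n))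
             (fun v => 2 * IZR j * (INR n * g (IZR v / INR n)) + c)
             (fun v => 2 * IZR j * T (IZR v / INR n))).
    - assumption.
    - apply Rmult_lt_0_compat; lra.
    - lra.
    - intros; apply HW.
    - intros v l Hl.
      rewrite plus_IZR, <- INR_IZR_INZ.
      set (y := IZR v / INR n).
      replace ((IZR v + INR l) / INR n) with (y + INR l / INR n) by (unfold y; field; lra).
      set (y' := y + INR l / INR n).
      assert (Hl0 : 0 <= INR l) by apply pos_INR.
      assert (HlL : INR l <= INR L) by (apply le_INR; lia).
      assert (Hi : 0 < / INR n) by (apply Rinv_0_lt_compat; lra).
      assert (Hyy : 0 <= y' - y <= INR L / INR n).
      { unfold y', Rdiv. split.
        - assert (0 <= INR l * / INR n) by (apply Rmult_le_pos; lra). lra.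
        - assert (INR l * / INR n <= INR L * / INR n) by (apply Rmult_le_compat_r; lra). lra. }
      set (th' := 2 * IZR j * (INR n * g y') + c).
      set (th := 2 * IZR j * (INR n * g y) + c - INR l * (2 * IZR j * T y)).
      assert (Hth : Rabs (th' - th) <= Q / INR n).
      { replace (th' - th)
          with (2 * IZR j * (INR n * (g y' - g y + (y' - y) * T y)))
          by (unfold th', th, y'; field; lra).
        rewrite !Rabs_mult, (Rabs_pos_eq 2), (Rabs_pos_eq (INR n)) by lra.
        assert (Hgg := Hg y y').
        assert ((y' - y) ^ 2 <= (INR L / INR n) ^ 2) by (apply pow_incr; lra).
        apply Rle_trans with (2 * Rabs (IZR j) * (INR n * (Lam * (INR L / INR n) ^ 2))).
        - assert (0 <= Rabs (IZR j)) by apply Rabs_pos.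
          apply Rmult_le_compat_l; [lra|]. apply Rmult_le_compat_l; [lra|].
          eapply Rle_trans; [exact Hgg|]. apply Rmult_le_compat_l; lra.
        - right. unfold Q. field. lra. }
      replace (W y' * cos th' - W y * cos th)
        with ((W y' - W y) * cos th' + W y * (cos th' - cos th)) by ring.
      eapply Rle_trans; [apply Rabs_triang|]. rewrite !Rabs_mult.
      apply Rplus_le_compat.
      + replace om with (om * 1) by ring.
        apply Rmult_le_compat; try apply Rabs_pos; [|apply Rabs_le, COS_bound].
        apply Hd. rewrite Rabs_pos_eq; lra.
      + apply Rmult_le_compat; try apply Rabs_pos; [apply HW|].
        eapply Rle_trans; [apply cos_lipschitz|exact Hth]. }
  rewrite Rminus_0_r, Rabs_mult.
  assert (Hi : 0 < / INR n) by (apply Rinv_0_lt_compat; lra).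
  rewrite (Rabs_pos_eq (/ INR n)) by lra. fold S.
  apply Rmult_le_reg_l with (INR L); [lra|].
  replace (INR L * (/ INR n * Rabs S)) with (/ INR n * (INR L * Rabs S)) by ring.
  eapply Rle_trans; [apply Rmult_le_compat_l; [lra|exact HS]|].
  set (K := IZR q - IZR p) in *.
  assert (HK : / INR n * K <= Nw).
  { apply Rmult_le_reg_l with (INR n); [lra|].
    rewrite <- Rmult_assoc, Rinv_r, Rmult_1_l by lra. exact G2. }
  assert (HK0 : 0 <= K) by (apply IZR_le in G1; unfold K; lra).
  set (FS := sumZ (fun v => fejer L (2 * IZR j * T (IZR v / INR n))) p q) in *.
  assert (HFS : / INR n * FS <= M * PI * INR L + 1).
  { assert (HN3 : Rabs (/ INR n * FS - RInt (fun y => fejer L (2 * IZR j * T y)) A B) <= 1)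
      by exact HN1.
    apply Rabs_le_between in HN3. lra. }
  assert (Q0 : 0 <= Wm * (Q / INR n)).
  { apply Rmult_le_pos; [lra|]. apply Rmult_le_pos; lra. }
  replace (/ INR n * (INR L * (2 * INR L * Wm + K * (om + Wm * (Q / INR n))) +
      Wm * (K * (sg * INR L / 2) + FS / (2 * (sg * INR L)))))
    with (INR L * (2 * INR L * Wm / INR n + (/ INR n * K) * (om + Wm * (Q / INR n)))
          + Wm * ((/ INR n * K) * (sg * INR L / 2))
          + Wm * ((/ INR n * FS) / (2 * sg * INR L))) by (field; lra).
  assert (X1 : (/ INR n * K) * (om + Wm * (Q / INR n)) <= Nw * (om + Wm * (Q / INR n)))
    by (apply Rmult_le_compat_r; lra).
  assert (X2 : Nw * om = eps / 4) by (unfold om; field; lra).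
  assert (X3 : 2 * INR L * Wm / INR n + Nw * (Wm * (Q / INR n)) <= eps / 4).
  { replace (2 * INR L * Wm / INR n + Nw * (Wm * (Q / INR n)))
      with ((2 * INR L * Wm + Nw * (Wm * Q)) / INR n) by (field; lra). exact HnQ. }
  assert (Y1 : INR L * (2 * INR L * Wm / INR n + (/ INR n * K) * (om + Wm * (Q / INR n)))
               <= INR L * (eps / 2)) by (apply Rmult_le_compat_l; lra).
  assert (Y2 : Wm * ((/ INR n * K) * (sg * INR L / 2)) <= INR L * (eps / 4)).
  { apply Rle_trans with (Wm * (Nw * (sg * INR L / 2))).
    - apply Rmult_le_compat_l; [lra|]. apply Rmult_le_compat_r; [|exact HK].
      assert (0 < sg * INR L) by (apply Rmult_lt_0_compat; lra). lra.
    - right. unfold sg. field. lra. }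
  assert (Y3 : Wm * ((/ INR n * FS) / (2 * sg * INR L)) <= INR L * (eps / 4)).
  { eapply Rle_trans; [|exact HLs]. apply Rmult_le_compat_l; [lra|].
    apply Rmult_le_compat_r; [|exact HFS]. left; apply Rinv_0_lt_compat.
    apply Rmult_lt_0_compat; [apply Rmult_lt_0_compat|]; lra. }
  lra.
Qed.

(** Only even frequencies occur: [PI] is the period of the absolute value of
    [cos]. *)
Inductive trig_poly : (R -> R) -> Prop :=
  | trig_cos (j : Z) (c : R) : trig_poly (fun x => cos (2 * IZR j * x + c))
  | trig_scal (a : R) G : trig_poly G -> trig_poly (fun x => a * G x)
  | trig_plus G H : trig_poly G -> trig_poly H -> trig_poly (fun x => G x + H x)
  | trig_ext G H : (forall x, G x = H x) -> trig_poly G -> trig_poly H.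

Lemma trig_mult_cos (j : Z) (c : R) (H : R -> R) :
  trig_poly H -> trig_poly (fun x => cos (2 * IZR j * x + c) * H x).
Proof.
  induction 1 as [i d|a G HG IH|G H HG IHG HH IHH|G H E HG IH].
  - apply (trig_ext (fun x => / 2 * (cos (2 * IZR (j + i) * x + (c + d))
                                   + cos (2 * IZR (j - i) * x + (c - d))))).
    + intros x. rewrite plus_IZR, minus_IZR.
      replace (2 * (IZR j + IZR i) * x + (c + d))
        with ((2 * IZR j * x + c) + (2 * IZR i * x + d)) by ring.
      replace (2 * (IZR j - IZR i) * x + (c - d))
        with ((2 * IZR j * x + c) - (2 * IZR i * x + d)) by ring.
      rewrite cos_plus, cos_minus. field.
    + apply trig_scal, trig_plus; apply trig_cos.
  - apply (trig_ext (fun x => a * (cos (2 * IZR j * x + c) * G x)));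
      [intros; ring|now apply trig_scal].
  - apply (trig_ext (fun x => cos (2 * IZR j * x + c) * G x + cos (2 * IZR j * x + c) * H x));
      [intros; ring|now apply trig_plus].
  - apply (trig_ext (fun x => cos (2 * IZR j * x + c) * G x));
      [intros; now rewrite E|assumption].
Qed.

Lemma trig_mult (G H : R -> R) :
  trig_poly G -> trig_poly H -> trig_poly (fun x => G x * H x).
Proof.
  intros HG HH. induction HG as [j c|a G HG IH|G1 G2 H1 IH1 H2 IH2|G1 G2 E H1 IH].
  - now apply trig_mult_cos.
  - apply (trig_ext (fun x => a * (G x * H x))); [intros; ring|now apply trig_scal].
  - apply (trig_ext (fun x => G1 x * H x + G2 x * H x)); [intros; ring|now apply trig_plus].
  - apply (trig_ext (fun x => G1 x * H x)); [intros; now rewrite E|assumption].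
Qed.

Lemma trig_const (a : R) : trig_poly (fun _ => a).
Proof.
  apply (trig_ext (fun x => a * cos (2 * IZR 0 * x + 0))).
  - intros x. replace (2 * 0 * x + 0) with 0 by ring. rewrite cos_0; ring.
  - apply trig_scal, trig_cos.
Qed.

Lemma trig_cont (G : R -> R) : trig_poly G -> forall x, continuous G x.
Proof.
  induction 1 as [j c|a G HG IH|G1 G2 H1 IH1 H2 IH2|G1 G2 E H1 IH]; intros x.
  - cont.
  - cont.
  - cont.
  - apply (continuous_ext G1); [exact E|apply IH].
Qed.

(** On [[0, 1]] this iteration increases to [sqrt s] through polynomials in
    [s]. *)
Fixpoint sqrt_approx (k : nat) (s : R) : R :=
  match k with
  | O => 0
  | S k => sqrt_approx k s + / 2 * (s + -1 * (sqrt_approx k s * sqrt_approx k s))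
  end.

Lemma sqrt_approx_bound (k : nat) (x : R) :
  0 <= x <= 1 ->
  0 <= sqrt_approx k (x * x) <= x /\
  (x - sqrt_approx k (x * x)) * (1 + INR k * (x / 2)) <= x.
Proof.
  intros Hx. induction k as [|k [IH1 IH2]].
  - simpl. lra.
  - simpl sqrt_approx. rewrite S_INR. set (y := sqrt_approx k (x * x)) in *.
    assert (E : x - (y + / 2 * (x * x + -1 * (y * y))) = (x - y) * (1 - (x + y) / 2)) by field.
    assert (Hd : 0 <= x - y) by lra.
    assert (Hf : 0 <= 1 - (x + y) / 2) by lra.
    assert (Hp : 0 <= (x - y) * (1 - (x + y) / 2)) by (apply Rmult_le_pos; assumption).
    assert (Hk : 0 <= INR k) by apply pos_INR.
    split; [split|].
    + assert (0 <= (x - y) * (x + y)) by (apply Rmult_le_pos; lra). nra.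
    + lra.
    + rewrite E. eapply Rle_trans; [|exact IH2].
      rewrite Rmult_assoc. apply Rmult_le_compat_l; [assumption|].
      apply Rle_trans with ((1 - x / 2) * (1 + (INR k + 1) * (x / 2))).
      * apply Rmult_le_compat_r; [|lra].
        assert (0 <= (INR k + 1) * (x / 2)) by (apply Rmult_le_pos; lra). lra.
      * assert (0 <= (INR k + 1) * (x / 2 * (x / 2))).
        { apply Rmult_le_pos; [lra|]. apply Rmult_le_pos; lra. }
        lra.
Qed.

(** Absolute value as the square root of a square, with the square root
    approximated by polynomials. *)
Lemma abs_cos_trig_approx (phi eps : R) :
  0 < eps -> exists G, trig_poly G /\ forall x, Rabs (G x - Rabs (cos (x + phi))) <= eps.
Proof.
  intros He.
  destruct (large_INR (2 / eps)) as [k Hk]. specialize (Hk k (le_n k)).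
  exists (fun x => sqrt_approx k (cos (x + phi) * cos (x + phi))). split.
  - assert (Hc : trig_poly (fun x => cos (x + phi) * cos (x + phi))).
    { apply (trig_ext (fun x => / 2 * (1 + cos (2 * IZR 1 * x + 2 * phi)))).
      - intros x. replace (2 * 1 * x + 2 * phi) with (2 * (x + phi)) by ring.
        rewrite cos_2a_cos. field.
      - apply trig_scal, trig_plus; [apply trig_const|apply trig_cos]. }
    clear Hk. induction k as [|k IH]; simpl; [apply trig_const|].
    apply trig_plus; [exact IH|]. apply trig_scal, trig_plus; [exact Hc|].
    apply trig_scal. now apply trig_mult.
  - intros x. set (t := Rabs (cos (x + phi))).
    assert (Ht : 0 <= t <= 1) by (split; [apply Rabs_pos|apply Rabs_le, COS_bound]).
    replace (cos (x + phi) * cos (x + phi)) with (t * t)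
      by (unfold t; rewrite <- Rabs_mult; apply Rabs_pos_eq, Rle_0_sqr).
    destruct (sqrt_approx_bound k t Ht) as [B1 B2].
    rewrite Rabs_minus_sym, Rabs_pos_eq by lra.
    set (y := t - sqrt_approx k (t * t)) in *.
    assert (Hy : 0 <= y) by (unfold y; lra).
    destruct (Req_dec t 0) as [Z|Z]; [unfold y; lra|].
    assert (Hk2 : 2 / eps * (t / 2) <= INR k * (t / 2)) by (apply Rmult_le_compat_r; lra).
    assert (y * (t / eps) <= t).
    { eapply Rle_trans; [|exact B2]. apply Rmult_le_compat_l; [assumption|].
      replace (t / eps) with (2 / eps * (t / 2)) by (field; lra). lra. }
    apply Rmult_le_reg_r with (t / eps); [apply Rdiv_lt_0_compat; lra|].
    replace (eps * (t / eps)) with t by (field; lra). assumption.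
Qed.

Definition mean (G : R -> R) : R := / PI * RInt G 0 PI.

Lemma mean_trig_cos (j : Z) (c : R) :
  mean (fun x => cos (2 * IZR j * x + c)) = if Z.eq_dec j 0 then cos c else 0.
Proof.
  assert (P := PI_RGT_0). unfold mean. destruct (Z.eq_dec j 0) as [->|Hj].
  - rewrite (RInt_eq _ (fun _ => cos c)) by (intros; f_equal; ring).
    rewrite RInt_cst. field. lra.
  - assert (Hj' : IZR j <> 0) by (apply not_0_IZR; assumption).
    rewrite (RInt_FTC (fun x => sin (2 * IZR j * x + c) / (2 * IZR j))).
    + replace (2 * IZR j * PI + c) with (c + 2 * PI * IZR j) by ring.
      rewrite sin_Z_period. replace (2 * IZR j * 0 + c) with c by ring. ring.
    + intros. auto_derive; [trivial|field; assumption].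
    + intros; cont.
Qed.

Lemma mean_abs_cos (phi : R) : mean (fun x => Rabs (cos (x + phi))) = 2 / PI.
Proof.
  assert (P := PI_RGT_0). unfold mean.
  assert (Ca : forall x, continuous (fun y => Rabs (cos y)) x) by (intros; cont).
  assert (Pa : forall x, Rabs (cos (x + PI)) = Rabs (cos x))
    by (intros; rewrite neg_cos; apply Rabs_Ropp).
  assert (E1 := RInt_lin _ 1 phi 0 PI Ca).
  rewrite (RInt_eq _ (fun x => Rabs (cos (x + phi)))) in E1
    by (intros x; cbv beta; now rewrite Rmult_1_l).
  rewrite Rmult_1_l in E1. rewrite E1.
  replace (1 * 0 + phi) with (- (PI / 2) + (phi + PI / 2)) by field.
  replace (1 * PI + phi) with (- (PI / 2) + (phi + PI / 2) + PI) by field.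
  rewrite (RInt_period _ PI (phi + PI / 2) (- (PI / 2)) Ca Pa).
  replace (- (PI / 2) + PI) with (PI / 2) by field.
  rewrite (RInt_ext _ cos).
  - rewrite (RInt_FTC sin).
    + rewrite sin_neg, sin_PI2. field. lra.
    + intros; apply is_derive_sin.
    + intros; cont.
  - intros x. rewrite Rmin_left, Rmax_right by lra. intros Hx.
    apply Rabs_pos_eq, cos_ge_0; lra.
Qed.

Lemma equidistribution_trig T g A B Lam M W Wm G :
  legendre T g A B Lam M -> unif_cont W -> 0 < Wm -> (forall y, Rabs (W y) <= Wm) ->
  trig_poly G ->
  is_lim_seq (fun n => grid_sum (fun y => W y * G (INR n * g y)) A B n)
    (mean G * RInt W A B).
Proof.
  intros HL UW HWm HW HG. assert (P := PI_RGT_0).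
  assert (HAB := leg_AB _ _ _ _ _ _ HL).
  assert (CW := unif_cont_continuous W UW).
  induction HG as [j c|a G HG IH|G1 G2 H1 IH1 H2 IH2|G1 G2 E H1 IH].
  - rewrite mean_trig_cos. destruct (Z.eq_dec j 0) as [->|Hj].
    + apply (is_lim_seq_ext (fun n => cos c * grid_sum W A B n)).
      * intros n. rewrite <- grid_sum_scal. apply grid_sum_ext. intros y.
        replace (2 * 0 * (INR n * g y) + c) with c by ring. ring.
      * apply (is_lim_seq_scal_l _ (cos c) (RInt W A B)).
        exact (riemann_sum W A B CW HAB).
    + rewrite Rmult_0_l. exact (equidistribution_cos T g A B Lam M W Wm j c HL UW HWm HW Hj).
  - apply (is_lim_seq_ext (fun n => a * grid_sum (fun y => W y * G (INR n * g y)) A B n)).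
    + intros n. rewrite <- grid_sum_scal. apply grid_sum_ext. intros; ring.
    + replace (mean (fun x => a * G x) * RInt W A B) with (a * (mean G * RInt W A B)).
      * apply (is_lim_seq_scal_l _ a (mean G * RInt W A B)). exact IH.
      * assert (CG := trig_cont G HG). unfold mean. rewrite RInt_mul by exint. ring.
  - apply (is_lim_seq_ext (fun n => grid_sum (fun y => W y * G1 (INR n * g y)) A B n
                                   + grid_sum (fun y => W y * G2 (INR n * g y)) A B n)).
    + intros n. rewrite <- grid_sum_plus. apply grid_sum_ext. intros; ring.
    + replace (mean (fun x => G1 x + G2 x) * RInt W A B)
        with (mean G1 * RInt W A B + mean G2 * RInt W A B).
      * now apply is_lim_seq_plus'.
      * assert (CG1 := trig_cont G1 H1). assert (CG2 := trig_cont G2 H2).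
        unfold mean. rewrite RInt_add by exint. ring.
  - replace (mean G2) with (mean G1) by (unfold mean; f_equal; now apply RInt_eq).
    eapply is_lim_seq_ext; [|exact IH]. intros n. apply grid_sum_ext.
    intros; now rewrite E.
Qed.

(** Both sides depend on the averaged function continuously for the uniform
    norm. *)
Lemma equidistribution_abs_cos T g A B Lam M W Wm phi :
  legendre T g A B Lam M -> unif_cont W -> 0 < Wm -> (forall y, Rabs (W y) <= Wm) ->
  is_lim_seq (fun n => grid_sum (fun y => W y * Rabs (cos (INR n * g y + phi))) A B n)
    (2 / PI * RInt W A B).
Proof.
  intros HL UW HWm HW. assert (P := PI_RGT_0).
  assert (HAB := leg_AB _ _ _ _ _ _ HL).
  assert (CW := unif_cont_continuous W UW).
  apply is_lim_seq_eps. intros eps He.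
  set (Nw := B - A + 1). assert (HNw : 1 <= Nw) by (unfold Nw; lra).
  set (e := eps / (3 * (Nw * Wm))).
  assert (HNW : 0 < Nw * Wm) by (apply Rmult_lt_0_compat; lra).
  assert (He0 : 0 < e) by (apply Rdiv_lt_0_compat; lra).
  destruct (abs_cos_trig_approx phi e He0) as [G [HG HGa]].
  assert (L := equidistribution_trig _ _ _ _ _ _ _ _ _ HL UW HWm HW HG).
  destruct (proj2 (is_lim_seq_eps _ _) L (eps / 3)) as [N HN]; [lra|].
  assert (CG := trig_cont G HG).
  assert (Em : Rabs (mean G - 2 / PI) <= e).
  { rewrite <- (mean_abs_cos phi). unfold mean.
    rewrite <- Rmult_minus_distr_l, Rabs_mult.
    assert (Hi : 0 < / PI) by (apply Rinv_0_lt_compat; lra).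
    rewrite (Rabs_pos_eq (/ PI)) by lra.
    apply Rle_trans with (/ PI * ((PI - 0) * e)); [|right; field; lra].
    apply Rmult_le_compat_l; [lra|].
    apply RInt_diff_le; [lra|exint|exint|]. intros t _; apply HGa. }
  assert (Ei : Rabs (RInt W A B) <= Nw * Wm).
  { apply Rle_trans with ((B - A) * Wm).
    - apply abs_RInt_le_const; [lra|exint|]. intros; apply HW.
    - apply Rmult_le_compat_r; unfold Nw; lra. }
  exists (S N). intros n Hn. specialize (HN n ltac:(lia)).
  assert (E1 : Rabs (grid_sum (fun y => W y * G (INR n * g y)
                   - W y * Rabs (cos (INR n * g y + phi))) A B n) <= Nw * (Wm * e)).
  { apply grid_sum_le; [lia|assumption| |apply Rmult_le_pos; lra]. intros y _.
    rewrite <- Rmult_minus_distr_l, Rabs_mult.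
    apply Rmult_le_compat; try apply Rabs_pos; [apply HW|apply HGa]. }
  rewrite grid_sum_minus in E1.
  assert (E2 : Rabs ((mean G - 2 / PI) * RInt W A B) <= e * (Nw * Wm)).
  { rewrite Rabs_mult. apply Rmult_le_compat; try apply Rabs_pos; assumption. }
  assert (E3 : e * (Nw * Wm) = eps / 3) by (unfold e; field; lra).
  apply Rabs_le_between in E1. apply Rabs_le_between in E2. apply Rabs_le_between in HN.
  apply Rabs_le. lra.
Qed.

(** * The inverse of [h'] and the limit *)

Definition clamp (lo hi y : R) : R := Rmax lo (Rmin hi y).

Lemma clamp_range (lo hi y : R) : lo <= hi -> lo <= clamp lo hi y <= hi.
Proof.
  intros H. unfold clamp, Rmax, Rmin.
  destruct (Rle_dec hi y), (Rle_dec lo _); lra.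
Qed.

Lemma clamp_id (lo hi y : R) : lo <= y <= hi -> clamp lo hi y = y.
Proof.
  intros H. unfold clamp, Rmax, Rmin. destruct (Rle_dec hi y), (Rle_dec lo _); lra.
Qed.

Lemma clamp_lipschitz (lo hi x y : R) :
  lo <= hi -> Rabs (clamp lo hi x - clamp lo hi y) <= Rabs (x - y).
Proof.
  intros H. unfold clamp, Rmax, Rmin.
  destruct (Rle_dec hi x), (Rle_dec hi y);
    repeat destruct (Rle_dec lo _); unfold Rabs; repeat destruct (Rcase_abs _); lra.
Qed.

Lemma phase_tangent h h1 h2 k s t :
  phase h h1 h2 k -> 0 <= s <= PI -> 0 <= t <= PI -> h1 t * (s - t) <= h s - h t.
Proof.
  intros Ph Hs Ht. destruct (Rle_lt_dec t s) as [L|L].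
  - apply (increment_ge h h1); [lra|intros; apply (phase_d1 _ _ _ _ Ph)|].
    intros u Hu. apply (phase_h1_incr _ _ _ _ _ _ Ph); lra.
  - assert (G := increment_ge (fun u => - h u) (fun u => - h1 u) s t (- h1 t)).
    assert (- h1 t * (t - s) <= - h t - - h s); [|lra]. apply G; [lra| |].
    + intros u _. apply (is_derive_opp h), (phase_d1 _ _ _ _ Ph).
    + intros u Hu. assert (h1 u <= h1 t) by (apply (phase_h1_incr _ _ _ _ _ _ Ph); lra). lra.
Qed.

Lemma change_of_variable h h1 h2 k (U : R -> R) a b :
  phase h h1 h2 k -> (forall y, continuous U y) ->
  RInt U (h1 a) (h1 b) = RInt (fun t => h2 t * U (h1 t)) a b.
Proof.
  intros Ph CU. symmetry. apply (RInt_comp U h1 h2).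
  - intros; apply CU.
  - intros t _; split; [apply (phase_d2 _ _ _ _ Ph)|apply (phase_c2 _ _ _ _ Ph)].
Qed.

(** [T] inverts [h'] on [[a, b]], and is constant outside the image. Since
    [g y] is then the minimum of [h s - y s] over [s] in [[a, b]], testing the
    minimum for [y] at the minimiser for [x], and conversely, gives the
    quadratic estimate. *)
Lemma legendre_transform h h1 h2 k a b :
  phase h h1 h2 k -> 0 < a -> a <= b -> b < PI ->
  exists T Lam M,
    (forall y, a <= T y <= b) /\
    (forall y, h1 a <= y <= h1 b -> h1 (T y) = y) /\
    (forall t, a <= t <= b -> T (h1 t) = t) /\
    legendre T (fun y => h (T y) - y * T y) (h1 a) (h1 b) Lam M.
Proof.
  intros Ph Ha Hab Hb. assert (P := PI_RGT_0).
  assert (C1 := phase_c1 _ _ _ _ Ph). assert (C2 := phase_c2 _ _ _ _ Ph).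
  destruct (continuous_pos_lower_bound h2 a b) as [mu [Hmu Hmin]];
    [lra|exact C2|intros; apply (phase_pos _ _ _ _ Ph); lra|].
  destruct (continuous_bounded h2 0 PI C2) as [M [HM Hmax]].
  assert (mono : forall s t, 0 <= s -> s <= t -> t <= PI -> h1 s <= h1 t)
    by (intros; apply (phase_h1_incr _ _ _ _ _ _ Ph); lra).
  assert (HAB : h1 a <= h1 b) by (apply mono; lra).
  assert (grow : forall s t, a <= s <= b -> a <= t <= b ->
            mu * Rabs (s - t) <= Rabs (h1 s - h1 t)).
  { assert (W : forall s t, a <= s -> s <= t -> t <= b -> mu * (t - s) <= h1 t - h1 s).
    { intros s t Hs Hst Ht.
      apply (increment_ge h1 h2); [lra|intros; apply (phase_d2 _ _ _ _ Ph)|].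
      intros; apply Hmin; lra. }
    intros s t Hs Ht. destruct (Rle_lt_dec s t) as [L|L].
    - rewrite (Rabs_minus_sym s t), (Rabs_minus_sym (h1 s)), (Rabs_pos_eq (t - s)) by lra.
      eapply Rle_trans; [apply W; lra|apply Rle_abs].
    - rewrite (Rabs_pos_eq (s - t)) by lra.
      eapply Rle_trans; [apply W; lra|apply Rle_abs]. }
  assert (inj : forall s t, a <= s <= b -> a <= t <= b -> h1 s = h1 t -> s = t).
  { intros s t Hs Ht E. assert (G := grow s t Hs Ht). rewrite E, Rminus_diag, Rabs_R0 in G.
    assert (G0 := Rabs_pos (s - t)).
    assert (Rabs (s - t) = 0).
    { apply Rle_antisym; [|assumption]. apply Rmult_le_reg_l with mu; lra. }
    destruct (Req_dec (s - t) 0) as [Z|Z]; [lra|]. apply Rabs_no_R0 in Z. lra. }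
  assert (c1 : continuity h1) by (intros t; apply continuity_pt_filterlim, C1).
  assert (rng : forall y, Rmin (h1 a) (h1 b) <= clamp (h1 a) (h1 b) y <= Rmax (h1 a) (h1 b)).
  { intros y. rewrite Rmin_left, Rmax_right by lra. now apply clamp_range. }
  set (T := fun y => proj1_sig (IVT_gen h1 a b (clamp (h1 a) (h1 b) y) c1 (rng y))).
  assert (HT : forall y, a <= T y <= b /\ h1 (T y) = clamp (h1 a) (h1 b) y).
  { intros y. unfold T. destruct (IVT_gen _ _ _ _ _ _) as [t [Ht E]]; simpl.
    rewrite Rmin_left, Rmax_right in Ht by lra. tauto. }
  clearbody T.
  assert (HLam : 0 < / mu) by (apply Rinv_0_lt_compat; assumption).
  exists T, (/ mu), M.
  split; [apply HT|]. split; [intros y Hy; rewrite (proj2 (HT y)); now apply clamp_id|].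
  split.
  { intros t Ht. apply inj; [apply HT|exact Ht|].
    rewrite (proj2 (HT _)). apply clamp_id. split; apply mono; lra. }
  assert (lip : forall x y, Rabs (T x - T y) <= / mu * Rabs (x - y)).
  { intros x y. apply Rmult_le_reg_l with mu; [assumption|].
    rewrite <- Rmult_assoc, Rinv_r, Rmult_1_l by lra.
    eapply Rle_trans; [apply grow; apply HT|].
    rewrite (proj2 (HT x)), (proj2 (HT y)). now apply clamp_lipschitz. }
  assert (CT : forall y, continuous T y).
  { apply unif_cont_continuous. intros eps He. exists (mu * eps).
    split; [apply Rmult_lt_0_compat; assumption|].
    intros x y Hxy. eapply Rle_trans; [apply lip|].
    replace eps with (/ mu * (mu * eps)) by (field; lra). apply Rmult_le_compat_l; lra. }
  assert (opt : forall y s, a <= s <= b -> h (T y) - y * T y <= h s - y * s).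
  { intros y s Hs. destruct (HT y) as [Hty Ey].
    assert (Tg := phase_tangent _ _ _ _ s (T y) Ph ltac:(lra) ltac:(lra)).
    assert (0 <= (h1 (T y) - y) * (s - T y)); [|lra].
    destruct (Rlt_le_dec (h1 b) y) as [L|L].
    - assert (E : h1 (T y) = h1 b).
      { rewrite Ey. unfold clamp. rewrite Rmin_left, Rmax_right by lra. reflexivity. }
      assert (T y = b) by (apply inj; lra). rewrite E.
      replace ((h1 b - y) * (s - T y)) with ((y - h1 b) * (T y - s)) by ring.
      apply Rmult_le_pos; lra.
    - destruct (Rlt_le_dec y (h1 a)) as [L2|L2].
      + assert (E : h1 (T y) = h1 a).
        { rewrite Ey. unfold clamp. rewrite Rmin_right, Rmax_left by lra. reflexivity. }
        assert (T y = a) by (apply inj; lra). rewrite E.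
        apply Rmult_le_pos; lra.
      + rewrite Ey, clamp_id by lra. lra. }
  split; try assumption.
  - intros x y. set (gx := h (T x) - x * T x). set (gy := h (T y) - y * T y).
    assert (O1 := opt y (T x) (proj1 (HT x))). assert (O2 := opt x (T y) (proj1 (HT y))).
    fold gy in O1. fold gx in O2.
    apply Rle_trans with (Rabs ((y - x) * (T y - T x))).
    + assert (O3 : - ((y - x) * (T y - T x)) <= gy - gx + (y - x) * T x <= 0)
        by (unfold gx, gy in *; lra).
      rewrite Rabs_left1 by lra. eapply Rle_trans; [|apply Rle_abs]. lra.
    + rewrite Rabs_mult.
      replace (/ mu * (y - x) ^ 2) with (Rabs (y - x) * (/ mu * Rabs (y - x)))
        by (rewrite <- (pow2_abs (y - x)); ring).
      apply Rmult_le_compat_l; [apply Rabs_pos|apply lip].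
  - intros V CV HV.
    rewrite (change_of_variable _ _ _ _ (fun y => V (T y)) _ _ Ph) by (intros; cont).
    apply Rle_trans with (RInt (fun t => M * V t) a b).
    + apply RInt_le; [lra|exint|exint|]. intros t Ht.
      replace (T (h1 t)) with t.
      * apply Rmult_le_compat_r; [apply HV|]. eapply Rle_trans; [apply Rle_abs|].
        apply Hmax; lra.
      * symmetry. apply inj; [apply HT|lra|].
        rewrite (proj2 (HT _)). apply clamp_id. split; apply mono; lra.
    + rewrite RInt_mul by exint. apply Rmult_le_compat_l; [lra|].
      rewrite (RInt_split V 0 a PI), (RInt_split V a b PI) by exint.
      assert (0 <= RInt V 0 a) by (apply RInt_ge_0; [lra|exint|auto]).
      assert (0 <= RInt V b PI) by (apply RInt_ge_0; [lra|exint|auto]). lra.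
Qed.

(** Stationary phase replaces each coefficient by its main term, with a total
    error [o(sqrt n)] because the window has [O(n)] elements; the main terms are
    averaged by equidistribution. *)
Lemma fc_interior_limit h h1 h2 k phi0 a b :
  phase h h1 h2 k -> fresnel_phase phi0 -> 0 < a -> a <= b -> b < PI ->
  is_lim_seq
    (fun n => / sqrt (INR n) * sumZ (fun nu => Rabs (fc h n nu))
                                 (up (INR n * h1 a)) (up (INR n * h1 b)))
    (/ PI * (2 / PI * RInt (fun t => h2 t * sqrt (2 * PI / h2 t)) a b)).
Proof.
  intros Ph HF Ha Hab Hb. assert (P := PI_RGT_0).
  assert (C2 := phase_c2 _ _ _ _ Ph).
  destruct (legendre_transform _ _ _ _ a b Ph Ha Hab Hb)
    as (T & Lam & M & HT & HTy & HTt & HL).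
  set (g := fun y => h (T y) - y * T y) in *.
  set (w := fun t => sqrt (2 * PI / h2 t)). set (W := fun y => w (T y)).
  assert (Hh2 : forall t, a <= t <= b -> 0 < h2 t)
    by (intros; apply (phase_pos _ _ _ _ Ph); lra).
  assert (Cw : forall t, a <= t <= b -> continuous w t).
  { intros t Ht. assert (Hh := Hh2 t Ht). unfold w. cont. lra. }
  assert (UW : unif_cont W).
  { intros eps He. destruct (@Heine_cor2 w a b) with (eps := mkposreal _ He) as [d Hd].
    { intros; apply continuity_pt_filterlim, Cw; assumption. }
    assert (Hd0 := cond_pos d). assert (HLam := leg_Lam _ _ _ _ _ _ HL).
    exists (d / 2 / Lam). split; [apply Rdiv_lt_0_compat; lra|].
    intros x y Hxy. left. apply Hd; [apply HT|apply HT|].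
    eapply Rle_lt_trans; [apply (leg_T _ _ _ _ _ _ HL)|].
    apply Rle_lt_trans with (Lam * (d / 2 / Lam)); [apply Rmult_le_compat_l; lra|].
    replace (Lam * (d / 2 / Lam)) with (d / 2) by (field; lra). lra. }
  assert (HWm : exists Wm, 0 < Wm /\ forall y, Rabs (W y) <= Wm).
  { destruct (continuity_ab_maj w a b Hab) as [m [Hm1 Hm2]].
    { intros; apply continuity_pt_filterlim, Cw; assumption. }
    exists (w m + 1). assert (0 <= w m) by apply sqrt_pos. split; [lra|].
    intros y. unfold W. rewrite Rabs_pos_eq by apply sqrt_pos.
    assert (Hw := Hm1 (T y) (HT y)). lra. }
  destruct HWm as [Wm [HWm HW]].
  assert (L := equidistribution_abs_cos _ _ _ _ _ _ _ _ phi0 HL UW HWm HW).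
  assert (EW : RInt W (h1 a) (h1 b) = RInt (fun t => h2 t * sqrt (2 * PI / h2 t)) a b).
  { rewrite (change_of_variable _ _ _ _ W _ _ Ph (unif_cont_continuous W UW)).
    apply RInt_ext. intros t. rewrite Rmin_left, Rmax_right by lra. intros Ht.
    unfold W. rewrite HTt by lra. reflexivity. }
  rewrite EW in L.
  assert (HAB := leg_AB _ _ _ _ _ _ HL).
  apply is_lim_seq_eps. intros eps He.
  set (Nw := h1 b - h1 a + 1). assert (HNw : 1 <= Nw) by (unfold Nw; lra).
  set (e := eps * PI / (2 * Nw)).
  assert (He0 : 0 < e).
  { apply Rdiv_lt_0_compat; [apply Rmult_lt_0_compat|]; lra. }
  destruct (stationary_phase _ _ _ _ phi0 a b e Ph HF Ha Hab Hb He0) as [N1 HN1].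
  assert (He1 : 0 < eps * PI / 2).
  { apply Rdiv_lt_0_compat; [apply Rmult_lt_0_compat|]; lra. }
  destruct (proj2 (is_lim_seq_eps _ _) L (eps * PI / 2) He1) as [N2 HN2].
  exists (S (N1 + N2)). intros n Hn.
  specialize (HN1 n ltac:(lia)). specialize (HN2 n ltac:(lia)).
  assert (Hnn : (0 < n)%nat) by lia.
  assert (Hn0 : 0 < INR n) by (apply lt_0_INR; assumption).
  set (s := sqrt (INR n)) in *.
  assert (Hs : 0 < s) by (apply sqrt_lt_R0; assumption).
  assert (Hss : s * s = INR n) by (apply sqrt_sqrt; lra).
  destruct (grid_count (h1 a) (h1 b) n Hnn HAB) as [G1 G2]. fold Nw in G2.
  unfold grid_sum in HN2.
  set (p := up (INR n * h1 a)) in *. set (q := up (INR n * h1 b)) in *.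
  set (main := fun nu => W (IZR nu / INR n) * Rabs (cos (INR n * g (IZR nu / INR n) + phi0))).
  assert (E : Rabs (sumZ (fun nu => s * (PI * Rabs (fc h n nu)) - main nu) p q)
              <= (IZR q - IZR p) * e).
  { apply sumZ_le_const; [assumption|]. intros nu Hnu.
    destruct (grid_window _ _ n nu Hnn Hnu) as [Y1 Y2].
    set (y := IZR nu / INR n) in *.
    assert (Ey : h1 (T y) = y) by (apply HTy; lra).
    assert (Enu : IZR nu = INR n * h1 (T y)) by (rewrite Ey; unfold y; field; lra).
    assert (St := HN1 nu (T y) (HT y) Enu).
    replace (s * (PI * Rabs (fc h n nu))) with (Rabs (s * (PI * fc h n nu)))
      by (rewrite !Rabs_mult, (Rabs_pos_eq s), (Rabs_pos_eq PI) by lra; reflexivity).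
    unfold main. fold y.
    rewrite <- (Rabs_pos_eq (W y)) by apply sqrt_pos. rewrite <- Rabs_mult.
    eapply Rle_trans; [apply Rabs_triang_inv2|]. eapply Rle_trans; [|exact St]. right.
    do 2 f_equal. unfold W, w. do 2 f_equal. unfold g.
    rewrite Enu, Ey. ring. }
  rewrite sumZ_minus, sumZ_scal, sumZ_scal in E.
  set (S0 := sumZ (fun nu => Rabs (fc h n nu)) p q) in *.
  assert (HN3 : Rabs (/ INR n * sumZ main p q
     - 2 / PI * RInt (fun t => h2 t * sqrt (2 * PI / h2 t)) a b) <= eps * PI / 2) by exact HN2.
  set (J := RInt (fun t => h2 t * sqrt (2 * PI / h2 t)) a b : R) in *.
  change (RInt (fun t => h2 t * sqrt (2 * PI / h2 t)) a b) with J in HN3.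
  replace (/ s * S0 - / PI * (2 / PI * J))
    with (/ PI * (/ INR n * (s * (PI * S0) - sumZ main p q)
                  + (/ INR n * sumZ main p q - 2 / PI * J)))
    by (rewrite <- Hss; field; lra).
  assert (Hi : 0 < / PI) by (apply Rinv_0_lt_compat; lra).
  assert (Hin : 0 < / INR n) by (apply Rinv_0_lt_compat; lra).
  rewrite Rabs_mult, (Rabs_pos_eq (/ PI)) by lra.
  apply Rle_trans with (/ PI * (eps * PI / 2 + eps * PI / 2)); [|right; field; lra].
  apply Rmult_le_compat_l; [lra|]. eapply Rle_trans; [apply Rabs_triang|].
  apply Rplus_le_compat; [|exact HN3].
  rewrite Rabs_mult, (Rabs_pos_eq (/ INR n)) by lra.
  apply Rle_trans with (/ INR n * (INR n * Nw * e)).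
  - apply Rmult_le_compat_l; [lra|]. eapply Rle_trans; [exact E|].
    apply Rmult_le_compat_r; lra.
  - right. unfold e. field. lra.
Qed.

Lemma limit_constant : Rpower (2 / PI) (3 / 2) = / PI * (2 / PI * sqrt (2 * PI)).
Proof.
  assert (P := PI_RGT_0).
  assert (H : 0 < 2 / PI) by (apply Rdiv_lt_0_compat; lra).
  replace (3 / 2) with (1 + / 2) by field.
  rewrite Rpower_plus, Rpower_1, Rpower_sqrt by assumption.
  replace (2 / PI) with (2 * PI / (PI * PI)) at 2 by (field; lra).
  rewrite sqrt_div_alt by (apply Rmult_lt_0_compat; lra).
  rewrite sqrt_square by lra. field. lra.
Qed.

Lemma main_term h h1 h2 k a b :
  phase h h1 h2 k -> 0 < a -> a <= b -> b < PI ->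
  / PI * (2 / PI * RInt (fun t => h2 t * sqrt (2 * PI / h2 t)) a b)
  = Rpower (2 / PI) (3 / 2) * RInt (fun t => sqrt (h2 t)) a b.
Proof.
  intros Ph Ha Hab Hb. assert (P := PI_RGT_0). assert (C2 := phase_c2 _ _ _ _ Ph).
  rewrite limit_constant.
  rewrite (RInt_ext _ (fun t => sqrt (2 * PI) * sqrt (h2 t))).
  - rewrite RInt_mul by exint. ring.
  - intros t. rewrite Rmin_left, Rmax_right by lra. intros Ht.
    assert (H := phase_pos _ _ _ _ Ph t ltac:(lra)).
    rewrite sqrt_div_alt by assumption.
    assert (Hs : 0 < sqrt (h2 t)) by (apply sqrt_lt_R0; assumption).
    rewrite <- (sqrt_sqrt (h2 t)) at 1 by lra. req; field. lra.
Qed.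

Lemma sqrt_subadditive (x y : R) :
  0 <= x -> 0 <= y -> sqrt (x + y) <= sqrt x + sqrt y.
Proof.
  intros Hx Hy. assert (Sx := sqrt_pos x). assert (Sy := sqrt_pos y).
  rewrite <- (sqrt_pow2 (sqrt x + sqrt y)) by lra. apply sqrt_le_1_alt.
  assert (0 <= sqrt x * sqrt y) by (apply Rmult_le_pos; assumption).
  assert (E := sqrt_sqrt x Hx). assert (E2 := sqrt_sqrt y Hy). nra.
Qed.

Lemma fc_windows_bounded h h1 h2 k n :
  phase h h1 h2 k -> (0 < n)%nat ->
  exists X, forall p q, sumZ (fun nu => Rabs (fc h n nu)) p q <= X.
Proof.
  intros Ph Hn. assert (P := PI_RGT_0).
  assert (H : h1 0 <= h1 PI) by (apply (phase_h1_incr _ _ _ _ _ _ Ph); lra).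
  eexists. intros p q.
  apply (fc_window_bound _ _ _ _ n (h1 0) (h1 PI) 1 p q Ph Hn); lra.
Qed.

(** Cutting [[0, PI]] down to [[dl, PI - dl]] costs little on both sides of the
    claim, uniformly in large [n]. *)
Lemma fc_A_norm_limit h h1 h2 k :
  phase h h1 h2 k ->
  is_lim_seq (fun n => 1 / sqrt (INR n) * Zseries (fun nu => Rabs (fc h n nu)))
    (Rpower (2 / PI) (3 / 2) * RInt (fun t => sqrt (h2 t)) 0 PI).
Proof.
  intros Ph. assert (P := PI_RGT_0). assert (C2 := phase_c2 _ _ _ _ Ph).
  destruct fresnel_limit as [phi0 HF].
  destruct (continuous_bounded h2 0 PI C2) as [M [HM Hmax]].
  set (c0 := Rpower (2 / PI) (3 / 2)).
  assert (Hc0 : 0 < c0) by apply exp_pos.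
  apply is_lim_seq_eps. intros eps He.
  (* The cut-off [dl] makes the two end ranges contribute at most [eps / 16]
     each by Bessel, and their share of the integral at most [eps / 4]. *)
  assert (Hsm : 0 <= sqrt M) by apply sqrt_pos.
  set (d1 := (eps / 16) ^ 2 / (M + 1)). set (d2 := eps / (8 * c0 * (sqrt M + 1))).
  assert (Hd1 : 0 < d1) by (apply Rdiv_lt_0_compat; [apply pow_lt|]; lra).
  assert (Hd2 : 0 < d2).
  { apply Rdiv_lt_0_compat; [lra|]. apply Rmult_lt_0_compat; [apply Rmult_lt_0_compat|]; lra. }
  set (dl := Rmin (PI / 4) (Rmin d1 d2)).
  assert (Hdl : 0 < dl /\ dl <= PI / 4 /\ dl <= d1 /\ dl <= d2).
  { assert (A1 : Rmin d1 d2 <= d1) by apply Rmin_l. assert (A2 : Rmin d1 d2 <= d2) by apply Rmin_r.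
    assert (A3 : 0 < Rmin d1 d2) by (apply Rmin_pos; assumption).
    assert (A4 : dl <= PI / 4) by apply Rmin_l. assert (A5 : dl <= Rmin d1 d2) by apply Rmin_r.
    assert (A6 : 0 < dl) by (apply Rmin_pos; lra). lra. }
  destruct Hdl as (Hdl0 & Hdl1 & Hdl2 & Hdl3). clearbody dl.
  set (a := dl). set (b := PI - dl).
  assert (Hab : a <= b) by (unfold a, b; lra).
  assert (L := fc_interior_limit _ _ _ _ phi0 a b Ph HF Hdl0 Hab ltac:(unfold b; lra)).
  rewrite (main_term _ _ _ _ a b Ph Hdl0 Hab ltac:(unfold b; lra)) in L. fold c0 in L.
  destruct (proj2 (is_lim_seq_eps _ _) L (eps / 4)) as [N1 HN1]; [lra|].
  set (Ct := (h1 PI - h1 0) / PI / dl).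
  assert (mono : forall s t, 0 <= s -> s <= t -> t <= PI -> h1 s <= h1 t)
    by (intros; apply (phase_h1_incr _ _ _ _ _ _ Ph); lra).
  assert (HCt : 0 <= Ct).
  { assert (h1 0 <= h1 PI) by (apply mono; lra).
    assert (0 < / PI) by (apply Rinv_0_lt_compat; lra).
    assert (0 < / dl) by (apply Rinv_0_lt_compat; lra).
    unfold Ct, Rdiv. repeat apply Rmult_le_pos; lra. }
  set (K := 2 * Ct + 2 * sqrt 2).
  assert (Hs2 : 0 <= sqrt 2) by apply sqrt_pos.
  destruct (large_INR ((8 * K / eps) ^ 2)) as [N2 HN2].
  exists (S (N1 + N2)). intros n Hn.
  specialize (HN1 n ltac:(lia)). specialize (HN2 n ltac:(lia)).
  assert (Hnn : (0 < n)%nat) by lia.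
  assert (Hn0 : 0 < INR n) by (apply lt_0_INR; assumption).
  set (s := sqrt (INR n)) in *.
  assert (Hs : 0 < s) by (apply sqrt_lt_R0; assumption).
  assert (Hi : 0 < / s) by (apply Rinv_0_lt_compat; assumption).
  assert (HK : / s * K <= eps / 8).
  { assert (H8 : 8 * K / eps <= s).
    { assert (0 <= 8 * K / eps).
      { apply Rmult_le_pos; [unfold K; lra|left; apply Rinv_0_lt_compat; lra]. }
      rewrite <- (sqrt_pow2 (8 * K / eps)) by assumption. apply sqrt_le_1_alt, HN2. }
    apply Rmult_le_reg_l with s; [assumption|].
    rewrite <- Rmult_assoc, Rinv_r, Rmult_1_l by lra.
    replace K with (8 * K / eps * (eps / 8)) at 1 by (field; lra).
    apply Rmult_le_compat_r; lra. }
  set (I := sumZ (fun nu => Rabs (fc h n nu)) (up (INR n * h1 a)) (up (INR n * h1 b))) in *.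
  set (Z := Zseries (fun nu => Rabs (fc h n nu))).
  assert (Za : forall nu, 0 <= Rabs (fc h n nu)) by (intros; apply Rabs_pos).
  assert (Z1 : I <= Z).
  { destruct (fc_windows_bounded _ _ _ _ n Ph Hnn) as [X HX].
    apply (Zseries_of_windows _ X Za HX). }
  assert (EA : h1 a - h1 0 <= M * dl).
  { assert (G := increment_abs_le h1 h2 0 a M). rewrite Rmin_left, Rmax_right in G by (unfold a; lra).
    eapply Rle_trans; [apply Rle_abs|].
    replace (M * dl) with (M * Rabs (a - 0)) by (rewrite Rminus_0_r, Rabs_pos_eq; unfold a; lra).
    apply G; [intros; apply (phase_d2 _ _ _ _ Ph)|]. intros; apply Hmax; unfold a in *; lra. }
  assert (EB : h1 PI - h1 b <= M * dl).
  { assert (G := increment_abs_le h1 h2 b PI M). rewrite Rmin_left, Rmax_right in G by (unfold b; lra).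
    eapply Rle_trans; [apply Rle_abs|].
    replace (M * dl) with (M * Rabs (PI - b)) by (rewrite Rabs_pos_eq; unfold b; [f_equal|]; lra).
    apply G; [intros; apply (phase_d2 _ _ _ _ Ph)|]. intros; apply Hmax; unfold b in *; lra. }
  set (x := (M + 1) * dl).
  assert (Hx : 0 <= x) by (apply Rmult_le_pos; lra).
  assert (Hsx : sqrt x <= eps / 16).
  { rewrite <- (sqrt_pow2 (eps / 16)) by lra. apply sqrt_le_1_alt.
    unfold x. replace ((eps / 16) ^ 2) with ((M + 1) * d1) by (unfold d1; field; lra).
    apply Rmult_le_compat_l; lra. }
  assert (Root : forall y, y <= x -> sqrt (INR n * y + 2) <= s * sqrt x + sqrt 2).
  { intros y Hy. unfold s. rewrite <- sqrt_mult by lra.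
    eapply Rle_trans; [apply sqrt_le_1_alt with (y := INR n * x + 2)|].
    - apply Rplus_le_compat_r, Rmult_le_compat_l; lra.
    - apply sqrt_subadditive; [apply Rmult_le_pos|]; lra. }
  assert (Z2 : Z <= 2 * Ct + (s * sqrt x + sqrt 2) + (s * sqrt x + sqrt 2) + I).
  { apply (Zseries_of_windows _ _ Za). intros p q.
    eapply Rle_trans.
    - apply (fc_window_bound _ _ _ _ n (h1 a) (h1 b) dl p q Ph Hnn Hdl0).
      + split; apply mono; unfold a, b; lra.
      + apply mono; unfold b; lra.
    - fold Ct. fold I. apply Rplus_le_compat_r.
      apply Rplus_le_compat; [apply Rplus_le_compat_l|]; apply Root; unfold x; lra. }
  assert (Z3 : / s * Z <= / s * K + 2 * sqrt x + / s * I).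
  { apply Rle_trans with (/ s * (2 * Ct + (s * sqrt x + sqrt 2) + (s * sqrt x + sqrt 2) + I)).
    - apply Rmult_le_compat_l; lra.
    - right. unfold K. field. lra. }
  assert (Z0 : / s * I <= / s * Z) by (apply Rmult_le_compat_l; lra).
  assert (Ends : forall u v, 0 <= u -> u <= v -> v <= PI -> v - u = dl ->
     0 <= c0 * RInt (fun t => sqrt (h2 t)) u v <= eps / 8).
  { intros u v Hu Huv Hv E. split.
    - apply Rmult_le_pos; [lra|]. apply RInt_ge_0; [assumption|exint|].
      intros; apply sqrt_pos.
    - apply Rle_trans with (c0 * (dl * sqrt M)).
      + apply Rmult_le_compat_l; [lra|]. rewrite <- E.
        eapply Rle_trans; [apply Rle_abs|]. apply abs_RInt_le_const; [assumption|exint|].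
        intros t Ht. rewrite Rabs_pos_eq by apply sqrt_pos. apply sqrt_le_1_alt.
        eapply Rle_trans; [apply Rle_abs|]. apply Hmax; lra.
      + apply Rle_trans with (c0 * (d2 * (sqrt M + 1))).
        * apply Rmult_le_compat_l; [lra|]. apply Rmult_le_compat; lra.
        * right. unfold d2. field. lra. }
  assert (E1 := Ends 0 a ltac:(lra) ltac:(unfold a; lra) ltac:(unfold a; lra) ltac:(unfold a; lra)).
  assert (E2 := Ends b PI ltac:(unfold b; lra) ltac:(unfold b; lra) ltac:(lra) ltac:(unfold b; lra)).
  rewrite (RInt_split (fun t => sqrt (h2 t)) 0 a PI) by exint.
  rewrite (RInt_split (fun t => sqrt (h2 t)) a b PI) by exint.
  apply Rabs_le_between in HN1. unfold Rdiv at 1. rewrite Rmult_1_l.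
  revert HN1 E1 E2.
  generalize (RInt (fun t => sqrt (h2 t)) 0 a : R) (RInt (fun t => sqrt (h2 t)) b PI : R)
    (RInt (fun t => sqrt (h2 t)) a b : R). intros r1 r2 r3 HN1 E1 E2.
  apply Rabs_le. lra.
Qed.

Theorem theorem1 (h : R -> R) (k : Z)
  (h_C2 : twice_continuously_differentiable h)
  (h_period : forall t : R, h (t + 2 * PI) = h t + 2 * IZR k * PI)
  (h2_nonzero : forall t : R, 0 < t < PI -> Derive_n h 2 t <> 0)
  (h_odd : forall t : R, h (- t) = - h t)
  (m0 mpi : R -> R) (c K : R)
  (c_pos : 0 < c) (K_pos : 0 < K)
  (m0_pos : forall t : R, 0 < t < 4 * c -> 0 < m0 t)
  (mpi_pos : forall t : R, 0 < t < 4 * c -> 0 < mpi t)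
  (m0_incr : increasing_on 0 (4 * c) m0)
  (mpi_incr : increasing_on 0 (4 * c) mpi)
  (m0_doubling : forall t : R, 0 < t < 2 * c -> m0 (2 * t) / m0 t <= K)
  (mpi_doubling : forall t : R, 0 < t < 2 * c -> mpi (2 * t) / mpi t <= K)
  (h2_near_0 : forall t : R, 0 < t < 4 * c ->
     m0 t <= Derive_n h 2 t <= K * m0 t)
  (h2_near_PI : forall t : R, 0 < t < 4 * c ->
     mpi t <= Derive_n h 2 (PI - t) <= K * mpi t) :
  (forall n : nat, (0 < n)%nat ->
     has_abs_conv_Fourier_series (fun t : R => expi (INR n * h t))) /\
  is_lim_seq
    (fun n : nat =>
       1 / sqrt (INR n) * A_norm (fun t : R => expi (INR n * h t)))
    (Rpower (2 / PI) (3 / 2) *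
     RInt (fun t : R => sqrt (Derive_n h 2 t)) 0 PI).
Proof.
  assert (P := PI_RGT_0).
  assert (C2 : forall t, continuous (Derive_n h 2) t) by (intros t; apply h_C2).
  (* Near [0] the comparison with [m0] fixes the sign that the absence of zeros
     propagates to the whole interval. *)
  assert (pos : forall t, 0 < t < PI -> 0 < Derive_n h 2 t).
  { set (t1 := Rmin (2 * c) (PI / 2)).
    assert (T1 : 0 < t1 /\ t1 <= 2 * c /\ t1 <= PI / 2).
    { split; [apply Rmin_pos; lra|split; [apply Rmin_l|apply Rmin_r]]. }
    assert (H1 : 0 < Derive_n h 2 t1).
    { apply Rlt_le_trans with (m0 t1); [apply m0_pos; lra|apply h2_near_0; lra]. }
    intros t2 T2. destruct (Rlt_le_dec 0 (Derive_n h 2 t2)) as [H|H]; [exact H|exfalso].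
    destruct (IVT_gen (Derive_n h 2) t1 t2 0) as [x [Hx E]].
    - intros t; apply continuity_pt_filterlim, C2.
    - rewrite Rmin_right, Rmax_left by lra. lra.
    - apply (h2_nonzero x); [|exact E].
      revert Hx. unfold Rmin, Rmax. destruct (Rle_dec t1 t2); lra. }
  assert (Ph : phase h (Derive h) (Derive_n h 2) k).
  { split; try assumption; intros t; destruct (h_C2 t) as (D1 & D2 & _).
    - apply Derive_correct, D1.
    - apply (Derive_correct (Derive h)), D2. }
  split.
  - intros n Hn. destruct (fc_windows_bounded _ _ _ _ n Ph Hn) as [X HX].
    destruct (Zseries_of_windows (fun nu => Rabs (fc h n nu)) X) as (S1 & S2 & _);
      [intros; apply Rabs_pos|exact HX|].
    exact (fc_summable_Fourier _ _ _ _ n Ph S1 S2).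
  - eapply is_lim_seq_ext; [|exact (fc_A_norm_limit _ _ _ _ Ph)].
    intros n. simpl. now rewrite (A_norm_fc _ _ _ _ n Ph).
Qed.
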